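(* In the setting described in the context, for every $2\le p<\infty$ there is a constant $C_p>0$, depending only on $p$, such that if $P_t1=1$ $m$-a.e. for every $t>0$ (conservativeness), then for every $f\in L^p(m)$ $$\|\widetilde H\|_p\le C_p\|f\|_p .$$
   Context: Setting. $E$ is a locally compact separable metric space with Borel $\sigma$-algebra $\mathcal B(E)$, and $m$ is a Radon measure on $E$ with $\operatorname{supp} m=E$. $L^p(m)$ is the real $L^p$-space with norm $\|\cdot\|_p$. Let $d=\{(x,y)\in E\times E: x=y\}$. $(\mathcal E,\mathcal D(\mathcal E))$ is a regular (symmetric) Dirichlet form on $L^2(m)$ which is pure-jump: there is a symmetric jumping measure $J$ on $E\times E\setminus d$ such that $$\mathcal E(u,v)=\tfrac12\iint_{E\times E\setminus d}(u(y)-u(x))(v(y)-v(x))\,J(dx,dy)$$ for all $u,v\in\mathcal D(\mathcal E)$ (taken in quasi-continuous versions). It is assumed that $J$ is given by a kernel: $J(dx,dy)=J(x,dy)\,m(dx)$. $X=(X_t)$ is the associated $m$-symmetric Hunt process, with laws $\mathbb P_x$, expectations $\mathbb E_x$ and cemetery $\Delta$. Its semigroup $P_tg(x)=\mathbb E_x g(X_t)$ (with $g(\Delta)=0$; also used for non-negative measurable $g$, with values in $[0,\infty]$) extends to a semigroup of sub-Markovian contractions on $L^p(m)$, $1\le p\le\infty$, strongly continuous for $1\le p<\infty$ and symmetric on $L^2(m)$. Square function. Let $\chi(s,t)=1$ if $|s|>|t|$, $\chi(s,t)=\tfrac12$ if $|s|=|t|$, $\chi(s,t)=0$ if $|s|<|t|$,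 and let $\widetilde\Gamma[u](x)=\int_{E\setminus\{x\}}(u(y)-u(x))^2\,\chi(u(x),u(y))\,J(x,dy)$. For $f\in L^p(m)$, $1<p<\infty$, $$\widetilde H(x)=\Big(\int_0^\infty P_t\,\widetilde\Gamma[P_tf](x)\,dt\Big)^{1/2}\in[0,\infty].$$ *)

(* Defs.v *)
From HB Require Import structures.
From mathcomp Require Import all_boot all_order all_algebra.
From mathcomp Require Import all_classical all_reals all_analysis.
From mathcomp Require Import measurable_realfun.

Set Implicit Arguments.
Unset Strict Implicit.
Unset Printing Implicit Defensive.

Import Order.TTheory GRing.Theory Num.Theory.
Import numFieldTopology.Exports numFieldNormedType.Exports.

Local Open Scope classical_set_scope.
Local Open Scope ring_scope.

(* The library's measurable types are pointed, so the metric space is too. *)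
#[short(type="pmetricType")]
HB.structure Definition PMetric (K : numDomainType) :=
  { M of Metric K M & Pointed M }.

Notation borel T := (g_sigma_algebraType (@open T)).

Notation "E '^Delta'" := (one_point_compactification E)
  (at level 2, format "E ^Delta").

Definition separable (T : topologicalType) : Prop :=
  exists2 S : set T, countable S & dense S.

Section measures.
Context {R : realType}.

(* The measure is given on all Borel sets, but only its restriction to [D] is
   constrained: this is used with D = E and with D = the off-diagonal part of
   E * E, whose compact subsets are the compact sets of E * E included in D. *)
Definition radon_on (T : topologicalType) d (B : measurableType d)
    (toT : set B -> set T) (mu : set B -> \bar R) (D : set B) : Prop :=
  (forall K, measurable K -> compact (toT K) -> K `<=` D -> (mu K < +oo)%E) /\
  (forall A, measurable A -> A `<=` D ->
    mu A = ereal_sup [set mu K | K in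
      [set K | [/\ measurable K, compact (toT K) & K `<=` A]]]).

Definition radon (E : pmetricType R) (m : set (borel E) -> \bar R) : Prop :=
  @radon_on E _ (borel E) id m setT.

Definition full_support (E : pmetricType R) (m : set (borel E) -> \bar R) :
    Prop :=
  forall U : set E, open U -> U !=set0 -> (0 < m U)%E.

End measures.

Section dirichlet_forms.
Context {R : realType} {E : pmetricType R}.
Variable m : {measure set (borel E) -> \bar R}.

(* Elements of L^2(m) are represented by square integrable Borel functions;
   domains and forms are invariant under m-a.e. equality. *)
Implicit Types (D : set (borel E -> R)).
Implicit Types (Q : (borel E -> R) -> (borel E -> R) -> R).

Definition form1 Q (u v : borel E -> R) : R :=
  Q u v + \int[m]_x (u x * v x).

Record dirichlet_form D Q : Prop := {
  df_L2 : forall u, D u -> u \in Lfun m 2%:E ;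
  df_ae : forall u v, D u -> v \in Lfun m 2%:E ->
    {ae m, forall x, u x = v x} ->
    D v /\ forall w, D w -> Q u w = Q v w ;
  df_lin : forall (a : R) u v, D u -> D v -> D (fun x => a * u x + v x) ;
  df_dense : forall f, f \in Lfun m 2%:E -> forall e : R, 0 < e ->
    exists2 u, D u & (Lnorm m 2%:E (fun x => (f x - u x)%:E) < e%:E)%E ;
  df_sym : forall u v, D u -> D v -> Q u v = Q v u ;
  df_bilin : forall (a : R) u v w, D u -> D v -> D w ->
    Q (fun x => a * u x + v x) w = a * Q u w + Q v w ;
  df_ge0 : forall u, D u -> 0 <= Q u u ;
  df_closed : forall u_ : nat -> borel E -> R,
    (forall n, D (u_ n)) ->
    (forall e : R, 0 < e -> exists N, forall i j, (N <= i)%N -> (N <= j)%N ->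
       form1 Q (fun x => u_ i x - u_ j x) (fun x => u_ i x - u_ j x) < e) ->
    exists2 u, D u &
      (fun n => form1 Q (fun x => u_ n x - u x) (fun x => u_ n x - u x))
        @ \oo --> (0 : R) ;
  df_markov : forall u, D u ->
    D (fun x => Num.min (Num.max (u x) 0) 1) /\
    Q (fun x => Num.min (Num.max (u x) 0) 1)
      (fun x => Num.min (Num.max (u x) 0) 1) <= Q u u
}.

Definition Cc (u : E -> R) : Prop :=
  continuous u /\ compact (closure [set x | u x != 0]).

Definition regular_form D Q : Prop :=
  (forall u, D u -> forall e : R, 0 < e ->
     exists w, [/\ D w, Cc w &
       form1 Q (fun x => u x - w x) (fun x => u x - w x) < e]) /\
  (forall u, Cc u -> forall e : R, 0 < e ->
     exists w, [/\ D w, Cc w & forall x, `|u x - w x| < e]).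

(* The 1-capacity of an open set. *)
Definition open_capacity D Q (G : set E) : \bar R :=
  ereal_inf [set (form1 Q u u)%:E | u in
    [set u | D u /\ {ae m, forall x, G x -> 1 <= u x}]].

Definition quasi_continuous D Q (u : E -> R) : Prop :=
  forall e : R, 0 < e -> exists G : set E,
    [/\ open G, (open_capacity D Q G < e%:E)%E &
        {within ~` G, continuous u}].

End dirichlet_forms.

Section jumps.
Context {R : realType} {E : pmetricType R}.
Variable m : {measure set (borel E) -> \bar R}.

Definition off_diag : set (borel E * borel E) := [set z | z.1 <> z.2].

(* A measure on the off-diagonal part of E * E is encoded as a measure on
   E * E whose values are only used on subsets of [off_diag]. *)
Definition jumping_measure (J : {measure set (borel E * borel E) -> \bar R}) :
    Prop :=
  @radon_on R (E * E)%type _ (borel E * borel E)%type id J off_diag /\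
  (forall A, measurable A -> A `<=` off_diag ->
     J [set z | A (z.2, z.1)] = J A).

(* J(dx,dy) = j(x,dy) m(dx) off the diagonal. *)
Definition jump_kernel (J : {measure set (borel E * borel E) -> \bar R})
    (j : R.-ker borel E ~> borel E) : Prop :=
  forall A, measurable A -> A `<=` off_diag ->
    J A = (\int[m]_x j x [set y | A (x, y)])%E.

(* Since D is stable under m-a.e. equality, the quasi-continuous versions of
   an element of the domain are the quasi-continuous members of its class. *)
Definition pure_jump (D : set (borel E -> R))
    (Q : (borel E -> R) -> (borel E -> R) -> R)
    (J : {measure set (borel E * borel E) -> \bar R}) : Prop :=
  forall u v, D u -> D v ->
    quasi_continuous m D Q u -> quasi_continuous m D Q v ->
    (Q u v)%:E = (2^-1%:E *
      \int[J]_(z in off_diag) ((u z.2 - u z.1) * (v z.2 - v z.1))%:E)%E.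

Definition chi (s t : R) : R :=
  if `|t| < `|s| then 1 else if `|s| == `|t| then 2^-1 else 0.

Definition Gamma_mod (j : R.-ker borel E ~> borel E) (u : borel E -> R)
    (x : borel E) : \bar R :=
  (\int[j x]_(y in ~` [set x]) ((u y - u x) ^+ 2 * chi (u x) (u y))%:E)%E.

End jumps.

Section processes.
Context {R : realType} {E : pmetricType R} {d : measure_display}
  {Omega : measurableType d}.

(* The cemetery Delta is [None : E^Delta]; it is isolated when E is compact. *)
Variable P : R.-pker borel E^Delta ~> Omega.
Variable X : R -> Omega -> borel E^Delta.

Definition lifetime (w : Omega) : \bar R :=
  ereal_inf [set t%:E | t in [set t : R | 0 <= t /\ X t w = None]].

(* Filtrations are indexed by R, but only used at times t >= 0. *)
Definition stopping_time (M : R -> set (set Omega)) (s : Omega -> \bar R) :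
    Prop :=
  (forall w, (0 <= s w)%E) /\
  forall t : R, 0 <= t -> M t [set w | (s w <= t%:E)%E].

Definition stopped_sigma_algebra (M : R -> set (set Omega))
    (s : Omega -> \bar R) : set (set Omega) :=
  [set A | measurable A /\
    forall t : R, 0 <= t -> M t (A `&` [set w | (s w <= t%:E)%E])].

Record admissible_filtration (M : R -> set (set Omega)) : Prop := {
  adm_sigma : forall t, 0 <= t -> sigma_algebra setT (M t) ;
  adm_sub : forall t, 0 <= t -> M t `<=` measurable ;
  adm_nondecreasing : forall s t, 0 <= s -> s <= t -> M s `<=` M t ;
  adm_right_cont : forall t, 0 <= t ->
    M t = \bigcap_(s in [set s | t < s]) M s ;
  adm_adapted : forall t, 0 <= t -> forall B, measurable B ->
    M t (X t @^-1` B)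
}.

(* Only times at which the stopping time is finite matter, since
   X_oo = Delta by convention and Delta is absorbing.  As [P] is a kernel, the
   property for all starting points gives it for all initial laws. *)
Definition strong_markov (M : R -> set (set Omega)) : Prop :=
  forall s, stopping_time M s ->
  forall x (t : R) (B : set (borel E^Delta)) (A : set Omega),
    0 <= t -> measurable B -> stopped_sigma_algebra M s A ->
    P x [set w | [/\ A w, (s w < +oo)%E & B (X (fine (s w) + t) w)]] =
    (\int[P x]_(w in A `&` [set w | (s w < +oo)%E])
       P (X (fine (s w)) w) (X t @^-1` B))%E.

Definition quasi_left_continuous (M : R -> set (set Omega)) : Prop :=
  forall (s_ : nat -> Omega -> \bar R) (s : Omega -> \bar R),
    (forall n, stopping_time M (s_ n)) -> stopping_time M s ->
    (forall w, {homo s_^~ w : i j / (i <= j)%N >-> (i <= j)%E}) ->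
    (forall w, s_^~ w @ \oo --> s w) ->
  forall x, {ae P x, forall w, (s w < +oo)%E ->
    (fun n => X (fine (s_ n w)) w : E^Delta) @ \oo
      --> (X (fine (s w)) w : E^Delta)}.

(* There is no loss in asking for kernel measurability of [P] on the
   sigma-algebra of Omega: take the one generated by the process, with the
   right limits of its natural filtration. *)
Record hunt_process : Prop := {
  hunt_measurable : forall t, 0 <= t -> measurable_fun setT (X t) ;
  hunt_normal : forall x, P x [set w | X 0 w = x] = 1%E ;
  hunt_trap : forall t, 0 <= t -> P None [set w | X t w = None] = 1%E ;
  hunt_lifetime : forall w t, 0 <= t -> (lifetime w <= t%:E)%E ->
    X t w = None ;
  hunt_shift : forall t, 0 <= t -> exists theta : Omega -> Omega,
    forall s w, 0 <= s -> X s (theta w) = X (s + t) w ;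
  hunt_right_cont : forall w t, 0 <= t ->
    (X s w : E^Delta) @[s --> t^'+] --> (X t w : E^Delta) ;
  hunt_left_lim : forall w t, 0 < t -> exists l : E^Delta,
    (X s w : E^Delta) @[s --> t^'-] --> l ;
  hunt_filtration : exists M, [/\ admissible_filtration M, strong_markov M &
    quasi_left_continuous M]
}.

(* E_x g(X_t), with g(Delta) = 0, for g >= 0. *)
Definition semigroup_ge0 (t : R) (g : borel E -> \bar R) (x : borel E) :
    \bar R :=
  (\int[P (Some x)]_w oapp g 0 (X t w))%E.

(* E_x f(X_t), with f(Delta) = 0, for real-valued f; for f in L^p(m) the
   expectation is finite for m-almost every x. *)
Definition semigroup (t : R) (f : borel E -> R) (x : borel E) : R :=
  \int[P (Some x)]_w oapp f 0 (X t w).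

Variable m : {measure set (borel E) -> \bar R}.

Definition process_symmetric : Prop :=
  forall t : R, 0 <= t -> forall f g : borel E -> \bar R,
    measurable_fun [set: borel E] f -> measurable_fun [set: borel E] g ->
    (forall x, 0 <= f x)%E -> (forall x, 0 <= g x)%E ->
    (\int[m]_x (f x * semigroup_ge0 t g x) =
     \int[m]_x (semigroup_ge0 t f x * g x))%E.

Definition approx_form (t : R) (u v : borel E -> R) : R :=
  t^-1 * \int[m]_x ((u x - semigroup t u x) * v x).

(* (Q, D) is the Dirichlet form of the L^2(m)-semigroup of the process:
   D = {u in L^2 : lim_{t -> 0} t^-1 (u - P_t u, u) < oo} and
   Q(u, v) = lim_{t -> 0} t^-1 (u - P_t u, v) on D. *)
Definition associated (D : set (borel E -> R))
    (Q : (borel E -> R) -> (borel E -> R) -> R) : Prop :=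
  (forall u, u \in Lfun m 2%:E ->
     (D u <-> cvg (approx_form t u u @[t --> 0^'+]))) /\
  (forall u v, D u -> D v -> approx_form t u v @[t --> 0^'+] --> Q u v).

Definition conservative : Prop :=
  forall t, 0 < t -> {ae m, forall x, semigroup_ge0 t (cst 1%E) x = 1%E}.

Definition square_function (j : R.-ker borel E ~> borel E) (f : borel E -> R)
    (x : borel E) : \bar R :=
  ((\int[lebesgue_measure]_(t in `[0%R, +oo[)
      semigroup_ge0 t (Gamma_mod j (semigroup t f)) x) `^ 2^-1)%E.

End processes.

(* Main.v *)
Require Import Defs.
From HB Require Import structures.
From mathcomp Require Import all_boot all_order all_algebra.
From mathcomp Require Import all_classical all_reals all_analysis.
From mathcomp Require Import measurable_realfun.
From mathcomp Require Import ring lra.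

(* Since chi <= 1, it is enough to treat the full carre du champ
   Gamma[u](x) = int (u(y) - u(x))^2 J(x,dy).  Put r = p/2 >= 1.

   For a time step s, the increments P_s((P_ks f)^2) - (P_(k+1)s f)^2 >= 0, accumulated along the
   semigroup, are the compensator of a submartingale read backwards in time.  A Bellman function,
   with symmetry and P_t 1 = 1 in place of conditional expectations on a path space, bounds the
   r-th moment of their sum by r^r int |f|^(2r).  Young's inequality turns this into the linear
   estimate r int h F_s <= r^r int |f|^(2r) + (r - 1) int g^r, valid whenever
   r h c <= c^r + (r - 1) g^r for all c >= 0.  As s -> 0 (averaging over the time grid),
   s^-1 int (P_s(u^2) - (P_s u)^2) k tends to 2 Q(u, u k) - Q(u^2, k) = int Gamma[u] k dm, so by
   Fatou the estimate holds for F = int_0^oo P_t Gamma[P_t f] dt, first for bounded integrable f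
   and then for f in L^p.  Taking for g a truncation of F gives int F^r <= r^r int |f|^(2r). *)

Set Implicit Arguments.
Unset Strict Implicit.
Unset Printing Implicit Defensive.

Import Order.TTheory GRing.Theory Num.Theory.
Import numFieldTopology.Exports numFieldNormedType.Exports.

Local Open Scope classical_set_scope.
Local Open Scope ring_scope.

(** * The Bellman function *)

(** The Bellman function comes from a formal path picture. For the stationary chain [Y] with
    one-step operator [S = P s], reversible by symmetry, [(P_((n+1-i)s) f)^2 (Y_i)] is a
    submartingale whose compensator has the conditional variances as increments; the moment bound
    for this compensator is the Garsia-Neveu inequality. No chain is built: only the conditional
    expectation of the compensator given the current position is tracked, and it obeys a recursion
    in [S] alone. Projecting on the position calls for convexity in the compensator, taking one more
    step for concavity in the submartingale.

    The other obstacles concern null sets. The integral formula for [Q] is given for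
    quasi-continuous functions, so it is extended to the domain by density. The jump kernel comes
    without s-finiteness and [P_t f] may be infinite at some points, so the measurability of
    [Gamma_mod (P_t f)] is out of reach; it is replaced by a measurable majorant equal to [+oo] on
    sets that are null at each time. *)

Section bellman.
Variable R : realType.
Implicit Types r a b c z : R.

(** Young's inequality for [b] and [a^(r-1)] with exponents [r] and [r / (r-1)], multiplied by [r].
    At [r = 1] the conjugate exponent is infinite, hence the separate case. *)
Lemma powR_amgm r a b : 1 <= r -> 0 <= a -> 0 <= b ->
  r * b * a `^ (r - 1) <= b `^ r + (r - 1) * a `^ r.
Proof.
move=> r1 a0 b0; move: r1; rewrite le_eqVlt => /predU1P[<-|r1].
  by rewrite subrr powRr0 !mul0r addr0 powRr1// mul1r mulr1.
have r0 : 0 < r by rewrite (lt_trans _ r1).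
have r10 : 0 < r - 1 by rewrite subr_gt0.
have := @conjugate_powR R b (a `^ (r - 1)) r (r / (r - 1)) b0 (powR_ge0 _ _) r0.
rewrite divr_gt0// => /(_ isT); rewrite -powRrM mulrCA mulfV ?gt_eqF// mulr1.
rewrite invf_div mulrBl divff ?gt_eqF// mul1r addrC subrK => /(_ erefl).
rewrite -(ler_pM2l r0) => /le_trans; rewrite mulrA; apply.
rewrite le_eqVlt; apply/orP; left; apply/eqP; field.
by rewrite gt_eqF.
Qed.

Lemma powR_tangent r a b : 1 <= r -> 0 <= a -> 0 <= b ->
  a `^ r + r * a `^ (r - 1) * (b - a) <= b `^ r.
Proof.
move=> r1 a0 b0; have := powR_amgm r1 a0 b0.
have := @mulr_powRB1 R a r a0 (lt_le_trans ltr01 r1).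
set A := a `^ (r - 1); set B := a `^ r; move=> <-; lra.
Qed.

Lemma powR_concave_tangent r t : 0 <= r -> r <= 1 -> 0 <= t ->
  t `^ r <= 1 + r * (t - 1).
Proof.
rewrite le_eqVlt => /predU1P[<- _ _|r0]; first by rewrite powRr0 mul0r addr0.
rewrite le_eqVlt => /predU1P[-> t0|r1 t0].
  by rewrite powRr1// mul1r addrC subrK.
have r10 : 0 < 1 - r by rewrite subr_gt0.
have := @conjugate_powR R (t `^ r) 1 r^-1 (1 - r)^-1 (powR_ge0 _ _) ler01.
rewrite !invr_gt0 => /(_ r0 r10); rewrite !invrK -powRrM mulfV ?gt_eqF//.
rewrite powRr1// powR1 mulr1 mul1r addrC subrK => /(_ erefl)/le_trans; apply.
lra.
Qed.

(** The coefficient is twice that of Taylor's formula, because for [r < 2] the second derivative of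
    [t^r] blows up at 0. For [r <= 2] use [t^r = t * t^(r-1)] and concavity of [t^(r-1)]; for
    [r > 2] its convexity. *)
Lemma powR_second_order r t : 1 <= r -> 0 <= t -> t <= 1 ->
  t `^ r <= 1 + r * (t - 1) + r * (r - 1) * (t - 1) ^+ 2.
Proof.
move=> r1 t0 t1.
have r0 : 0 < r by rewrite (lt_le_trans _ r1).
have := mulr_powRB1 t0 r0.
have [r2|r2] := leP r 2.
  have := @powR_concave_tangent (r - 1) t; rewrite subr_ge0 => /(_ r1).
  rewrite lerBlDr => /(_ r2 t0).
  set A := t `^ (r - 1) => A1 <-.
  have : t * A <= t * (1 + (r - 1) * (t - 1)) by rewrite ler_wpM2l.
  have : 0 <= (r - 1) * (r - 1) * (t - 1) ^+ 2.
    by rewrite mulr_ge0 ?sqr_ge0// mulr_ge0 ?subr_ge0.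
  nra.
have r11 : 1 <= r - 1 by lra.
have := @powR_tangent (r - 1) 1 t r11 ler01 t0.
have := @powR_tangent r t 1 r1 t0 ler01.
rewrite !powR1 !mulr1; set A := t `^ (r - 1); set B := t `^ r => H1 H2 _.
have : r * (1 - t) * (1 + (r - 1) * (t - 1)) <= r * (1 - t) * A.
  by rewrite ler_wpM2l// mulr_ge0 ?subr_ge0// ltW.
nra.
Qed.

(** Its derivative in [b] is [r^2 b^(r-2) (b - (r-1) z)], so the minimum is at [b = (r-1) z]; in [z]
    it is affine. *)
Definition bellman_gap r z b := r * b `^ r - r ^+ 2 * z * b `^ (r - 1).

Lemma bellman_gap_min r z b c : 1 <= r -> 0 <= z -> 0 <= c ->
  (b = (r - 1) * z \/ [/\ 0 <= b, (r - 1) * z <= b & b <= c]) ->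
  bellman_gap r z b <= bellman_gap r z c.
Proof.
move=> r1 z0 c0 bc; rewrite /bellman_gap.
have r0 : 0 < r by rewrite (lt_le_trans _ r1).
have b0 : 0 <= b.
  by case: bc => [->|[]//]; rewrite mulr_ge0// subr_ge0.
have := powR_amgm r1 c0 b0.
have := mulr_powRB1 b0 r0; have := mulr_powRB1 c0 r0.
have : 0 <= b `^ (r - 1) by exact: powR_ge0.
have : b <= c -> b `^ (r - 1) <= c `^ (r - 1).
  by move=> bc'; rewrite ge0_ler_powR ?nnegrE// subr_ge0.
move: r1; rewrite le_eqVlt => /predU1P[r1|r1].
  rewrite -{}r1 in bc r0 *; rewrite subrr in bc *; rewrite !powRr0 !powRr1//.
  rewrite mul0r in bc.
  move=> _ _ _ _ _; rewrite lerD2r !mul1r.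
  by case: bc => [->//|[]].
have r10 : 0 < r - 1 by rewrite subr_gt0.
set A := b `^ (r - 1); set B := c `^ (r - 1); set A' := b `^ r; set B' := c `^ r.
move=> AB A0 EB EA H.
(* Multiplied by [r - 1], the difference is [r] times the defect in Young's inequality plus
   [r^2 (b - (r-1) z) (B - A)]; the last term vanishes at the critical point and is non-negative
   beyond it. *)
rewrite -(ler_pM2l r10).
have E : (r - 1) * (r * B' - r ^+ 2 * z * B) - (r - 1) * (r * A' - r ^+ 2 * z * A)
  = r * ((r - 1) * B' + A' - r * b * B)
    + r ^+ 2 * ((b - (r - 1) * z) * (B - A)).
  by rewrite -EA; ring.
rewrite -subr_ge0 E addr_ge0//.
  rewrite mulr_ge0 ?(ltW r0)//; lra.
rewrite mulr_ge0// ?sqr_ge0//.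
by case: bc => [->|[_ H1 H2]]; [rewrite subrr mul0r|rewrite mulr_ge0// subr_ge0// AB].
Qed.

(** The second derivative in [b] is [r^2 (r-1) b^(r-3) (b - (r-2) z)], hence convexity on
    [b >= (r-1) z]. The slope has [b^(r-1) / b] for [b^(r-2)], so that it makes sense at [b = 0]
    too. *)
Lemma bellman_gap_tangent r z b c : 1 <= r -> 0 <= z -> 0 <= b -> 0 <= c ->
  (r - 1) * z <= b -> (r - 1) * z <= c ->
  bellman_gap r z b +
    r ^+ 2 * (b `^ (r - 1) - (r - 1) * z * (b `^ (r - 1) / b)) * (c - b)
  <= bellman_gap r z c.
Proof.
move=> r1 z0 b0 c0 zb zc; rewrite /bellman_gap.
have r0 : 0 < r by rewrite (lt_le_trans _ r1).
have := powR_tangent r1 b0 c0.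
have := powR_amgm r1 c0 b0.
have := mulr_powRB1 b0 r0; have := mulr_powRB1 c0 r0.
move: (b0); rewrite le_eqVlt => /predU1P[b00|bp].
  have -> : (r - 1) * z = 0 by apply/eqP; rewrite eq_le {1}b00 zb mulr_ge0// subr_ge0.
  rewrite -b00; rewrite mul0r subr0 !mul0r => _ <- _.
  move: r1; rewrite le_eqVlt => /predU1P[<-|r1].
    by rewrite subrr !powRr0 powRr1// !mulr1 !mul1r; lra.
  have r10 : 0 < r - 1 by rewrite subr_gt0.
  rewrite (@powR0 _ (r - 1)) ?gt_eqF//.
  have : z = 0.
    apply/eqP; rewrite eq_le z0 andbT -(@ler_pM2l _ (r - 1))// mulr0.
    by rewrite b00.
  by move=> ->; rewrite !mulr0 mul0r; move: (powR_ge0 c r); nra.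
have Eb : b `^ (r - 1) / b * b = b `^ (r - 1) by rewrite divfK// gt_eqF.
move: Eb; set D := b `^ (r - 1) / b.
have D0 : 0 <= D by rewrite divr_ge0// powR_ge0.
have [cb|bc] := ltP c b; last first.
  set A := b `^ (r - 1); set B := c `^ (r - 1); set A' := b `^ r; set B' := c `^ r.
  move=> EA EB EA' H1 H2.
  move: r1; rewrite le_eqVlt => /predU1P[r1|r1].
    rewrite -r1 subrr mul0r in H2 *.
    have -> : A = 1 by rewrite /A -r1 subrr powRr0.
    have -> : B = 1 by rewrite /B -r1 subrr powRr0.
    have -> : A' = b by rewrite /A' -r1 powRr1.
    have -> : B' = c by rewrite /B' -r1 powRr1.
    lra.
  have r10 : 0 < r - 1 by rewrite subr_gt0.
  rewrite -subr_ge0 -(pmulr_rge0 _ r10) -(pmulr_rge0 _ bp).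
  (* The non-negative weights [b - (r-1) z] and [(r-1) z] combine the tangent inequality for [t^r]
     with Young's inequality. *)
  have -> : b * ((r - 1) * (r * B' - r ^+ 2 * z * B -
      (r * A' - r ^+ 2 * z * A + r ^+ 2 * (A - (r - 1) * z * D) * (c - b)))) =
    r * (b - (r - 1) * z) * ((r - 1) * (B' - (A' + r * A * (c - b)))) +
    r * ((r - 1) * z) * ((r - 1) * B' + A' - r * b * B).
    by rewrite -EA' -EA; ring.
  rewrite addr_ge0// !mulr_ge0// ?(ltW r0) ?(ltW r10) ?subr_ge0//; lra.
(* For [c < b] the second weight meets the second-order bound at [t = c / b] instead of Young's
   inequality. *)
have t0 : 0 <= c / b by rewrite divr_ge0.
have t1 : c / b <= 1 by rewrite ler_pdivrMr// mul1r ltW.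
have := powR_second_order r1 t0 t1.
have -> : c / b - 1 = (c - b) / b by field; rewrite gt_eqF.
rewrite powRM// ?invr_ge0//.
rewrite -powR_inv1// powRAC powR_inv1 ?powR_ge0//.
rewrite -(@ler_pM2l _ (b `^ r)) ?powR_gt0//.
rewrite mulrCA mulfV ?gt_eqF ?powR_gt0// mulr1.
set A := b `^ (r - 1); set B := c `^ (r - 1); set A' := b `^ r; set B' := c `^ r.
move=> H EA EB EA' H1 H2.
have {}H : B' <= A' + r * A * (c - b) + r * (r - 1) * D * (c - b) ^+ 2.
  apply: (le_trans H); rewrite -EA' -EA powR_inv1//.
  rewrite le_eqVlt; apply/orP; left; apply/eqP; field; by rewrite gt_eqF.
move: r1; rewrite le_eqVlt => /predU1P[r1|r1].
  rewrite -r1 subrr mul0r in H2 *.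
  have -> : A = 1 by rewrite /A -r1 subrr powRr0.
  have -> : B = 1 by rewrite /B -r1 subrr powRr0.
  have -> : A' = b by rewrite /A' -r1 powRr1.
  have -> : B' = c by rewrite /B' -r1 powRr1.
  lra.
have r10 : 0 < r - 1 by rewrite subr_gt0.
move: (c0); rewrite le_eqVlt => /predU1P[c00|cp].
  have z00 : z = 0.
    apply/eqP; rewrite eq_le z0 andbT -(@ler_pM2l _ (r - 1))// mulr0.
    by rewrite c00.
  rewrite z00 !mulr0 mul0r !subr0; nra.
rewrite -subr_ge0 -(pmulr_rge0 _ r10) -(pmulr_rge0 _ cp).
have -> : c * ((r - 1) * (r * B' - r ^+ 2 * z * B -
      (r * A' - r ^+ 2 * z * A + r ^+ 2 * (A - (r - 1) * z * D) * (c - b)))) =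
    r * (c - (r - 1) * z) * ((r - 1) * (B' - (A' + r * A * (c - b)))) +
    r * ((r - 1) * z) * (A' + r * A * (c - b) + r * (r - 1) * D * (c - b) ^+ 2 - B').
    by rewrite -EA' -EB -EA; ring.
rewrite addr_ge0// !mulr_ge0// ?(ltW r0) ?(ltW r10) ?subr_ge0//.
Qed.

(** The point of [[a, +oo)] where [bellman_gap r z] is least. *)
Definition bellman_b r a z := Num.max a ((r - 1) * z).

(* The infimum over c >= a of r c^r - r^2 z c^(r-1): hence concave in z; it is
   also convex in a. *)
Definition bellman r a z := bellman_gap r z (bellman_b r a z).

(** The derivative of [bellman] in [a]: for [a < (r-1) z] the minimiser does not move with [a], and
    the formula gives 0. *)
Definition bellman_da r a z := let b := bellman_b r a z in
  r ^+ 2 * (b `^ (r - 1) - (r - 1) * z * (b `^ (r - 1) / b)).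

Lemma bellman_b_ge0 r a z : 0 <= a -> 0 <= bellman_b r a z.
Proof. by move=> a0; rewrite /bellman_b le_max a0. Qed.

Lemma bellman_le r a z c : 1 <= r -> 0 <= a -> 0 <= z -> a <= c ->
  bellman r a z <= bellman_gap r z c.
Proof.
move=> r1 a0 z0 ac; apply: bellman_gap_min => //; first exact: le_trans ac.
by rewrite /bellman_b; case: (leP a) => h; [left|right; split=> //; exact/ltW].
Qed.

(** The minimiser for [z] competes for [z'], and the gap is affine in [z]. *)
Lemma bellman_concave r a z z' : 1 <= r -> 0 <= a -> 0 <= z -> 0 <= z' ->
  bellman r a z' <=
  bellman r a z - r ^+ 2 * bellman_b r a z `^ (r - 1) * (z' - z).
Proof.
move=> r1 a0 z0 z'0.
apply: le_trans (@bellman_le r a z' (bellman_b r a z) r1 a0 z'0 _) _.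
  by rewrite /bellman_b le_max lexx.
rewrite /bellman /bellman_gap; lra.
Qed.

Lemma bellman_da_ge0 r a z : 1 <= r -> 0 <= a -> 0 <= z ->
  0 <= bellman_da r a z.
Proof.
move=> r1 a0 z0; rewrite /bellman_da; set b := bellman_b r a z.
have b0 : 0 <= b by exact: bellman_b_ge0.
rewrite mulr_ge0 ?sqr_ge0// subr_ge0.
move: (b0); rewrite le_eqVlt => /predU1P[<-|bp].
  by rewrite invr0 !mulr0 powR_ge0.
rewrite mulrCA -[leRHS]mulr1 ler_wpM2l ?powR_ge0// ler_pdivrMr// mul1r.
by rewrite /b /bellman_b le_max lexx orbT.
Qed.

(** Both minimisers lie where the gap is convex. Either the minimiser at [a] is [a] itself, and the
    one at [a'] is at least [a'], or the slope is 0. *)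
Lemma bellman_convex r a a' z : 1 <= r -> 0 <= a -> 0 <= a' -> 0 <= z ->
  bellman r a z + bellman_da r a z * (a' - a) <= bellman r a' z.
Proof.
move=> r1 a0 a'0 z0.
have z1 : 0 <= (r - 1) * z by rewrite mulr_ge0// subr_ge0.
have b0 := bellman_b_ge0 r z a0; have b'0 := bellman_b_ge0 r z a'0.
apply: le_trans (@bellman_gap_tangent r z (bellman_b r a z) (bellman_b r a' z)
  r1 z0 b0 b'0 _ _); last 2 first.
  by rewrite /bellman_b le_max lexx orbT.
  by rewrite /bellman_b le_max lexx orbT.
rewrite lerD2l -/(bellman_da r a z).
have [az|az] := leP ((r - 1) * z) a.
  have -> : bellman_b r a z = a by rewrite /bellman_b; apply/max_idPl.
  by rewrite ler_wpM2l ?bellman_da_ge0// lerD2r /bellman_b le_max lexx.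
have E : bellman_b r a z = (r - 1) * z by rewrite /bellman_b; apply/max_idPr/ltW.
have -> : bellman_da r a z = 0; last by rewrite !mul0r.
rewrite /bellman_da E mulrCA divff ?mulr1 ?subrr ?mulr0//.
by rewrite gt_eqF// (le_lt_trans a0).
Qed.

(** With [b + e] as competitor, the growth [r ((b+e)^r - b^r) <= r^2 e (b+e)^(r-1)] is paid exactly
    by the extra [e] in [z]; this fixes the ratio of the two coefficients of the gap. *)
Lemma bellman_shift r a z e : 1 <= r -> 0 <= a -> 0 <= z -> 0 <= e ->
  bellman r (a + e) (z + e) <= bellman r a z.
Proof.
move=> r1 a0 z0 e0; pose b := bellman_b r a z.
have b0 : 0 <= b by exact: bellman_b_ge0.
have r0 : 0 < r by rewrite (lt_le_trans _ r1).
have be0 : 0 <= b + e by rewrite addr_ge0.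
apply: le_trans (@bellman_le r (a + e) (z + e) (b + e) r1 _ _ _) _.
- by rewrite addr_ge0.
- by rewrite addr_ge0.
- by rewrite lerD2r /b /bellman_b le_max lexx.
rewrite /bellman /bellman_gap -/b.
have := @powR_tangent r (b + e) b r1 be0 b0.
have : b `^ (r - 1) <= (b + e) `^ (r - 1).
  by rewrite ge0_ler_powR ?nnegrE ?subr_ge0// lerDl.
set A := b `^ (r - 1); set B := (b + e) `^ (r - 1); set A' := b `^ r; set B' := _ `^ r.
move=> AB H.
have : 0 <= z * (B - A) by rewrite mulr_ge0// subr_ge0.
move: H; rewrite -(ler_pM2l r0) => H Z.
have : 0 <= r ^+ 2 * (z * (B - A)) by rewrite mulr_ge0// sqr_ge0.
nra.
Qed.

(** Young's inequality for [r z] and [b]: this is where the constant [r^r] arises. *)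
Lemma bellman_lower r a z : 1 <= r -> 0 <= a -> 0 <= z ->
  a `^ r <= bellman r a z + r `^ r * z `^ r.
Proof.
move=> r1 a0 z0; have b0 := bellman_b_ge0 r z a0.
have r0 : 0 < r by rewrite (lt_le_trans _ r1).
rewrite -powRM//; last exact/ltW.
have := @powR_amgm r (bellman_b r a z) (r * z) r1 b0 (mulr_ge0 (ltW r0) z0).
have : a `^ r <= bellman_b r a z `^ r.
  by rewrite ge0_ler_powR ?nnegrE ?(ltW r0)// /bellman_b le_max lexx.
rewrite /bellman /bellman_gap; lra.
Qed.

(** At the minimiser [b = (r-1) z] the gap equals [- r z b^(r-1)]. *)
Lemma bellman_le0 r z : 1 <= r -> 0 <= z -> bellman r 0 z <= 0.
Proof.
move=> r1 z0; rewrite /bellman.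
have -> : bellman_b r 0 z = (r - 1) * z.
  by apply/max_idPr; rewrite mulr_ge0// subr_ge0.
have r0 : 0 < r by rewrite (lt_le_trans _ r1).
have b0 : 0 <= (r - 1) * z by rewrite mulr_ge0// subr_ge0.
rewrite /bellman_gap; have := mulr_powRB1 b0 r0.
set B := _ `^ (r - 1) => <-.
have : 0 <= r * (z * B) by rewrite !mulr_ge0// ?powR_ge0// ltW.
nra.
Qed.

End bellman.

(** * Symmetric Markov operators and semigroups *)

Section bounded_functions.
Context {d} {T : measurableType d} {R : realType}.
Implicit Types (f g h : T -> R).

Definition bmeas f := measurable_fun setT f /\ exists c : R, forall x, `|f x| <= c.

Lemma bmeas_cst c : bmeas (cst c).
Proof. by split=> //; exists `|c|. Qed.

Lemma bmeasD f g : bmeas f -> bmeas g -> bmeas (fun x => f x + g x).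
Proof.
move=> [mf [a fa]] [mg [b gb]]; split; first exact: measurable_funD.
by exists (a + b) => x; rewrite (le_trans (ler_normD _ _))// lerD.
Qed.

Lemma bmeasN f : bmeas f -> bmeas (fun x => - f x).
Proof.
move=> [mf [a fa]]; split; first exact: measurableT_comp.
by exists a => x; rewrite normrN.
Qed.

Lemma bmeasM f g : bmeas f -> bmeas g -> bmeas (fun x => f x * g x).
Proof.
move=> [mf [a fa]] [mg [b gb]]; split; first exact: measurable_funM.
by exists (a * b) => x; rewrite normrM ler_pM.
Qed.

Lemma bmeasB f g : bmeas f -> bmeas g -> bmeas (fun x => f x - g x).
Proof. by move=> bf bg; apply: bmeasD => //; exact: bmeasN. Qed.

Lemma bmeasZ (c : R) f : bmeas f -> bmeas (fun x => c * f x).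
Proof. by move=> bf; apply: (bmeasM (bmeas_cst c)). Qed.

Lemma bmeasX f n : bmeas f -> bmeas (fun x => f x ^+ n).
Proof.
move=> [mf [a fa]]; split; first exact: measurable_funX.
by exists (a ^+ n) => x; rewrite normrX lerXn2r// nnegrE// (le_trans _ (fa x)).
Qed.

Lemma bmeas_norm f : bmeas f -> bmeas (fun x => `|f x|).
Proof.
move=> [mf [a fa]]; split; first exact: measurableT_comp.
by exists a => x; rewrite normr_id.
Qed.

Lemma bmeas_max f g : bmeas f -> bmeas g -> bmeas (fun x => Num.max (f x) (g x)).
Proof.
move=> [mf [a fa]] [mg [b gb]]; split; first exact: measurable_maxr.
exists (a + b) => x; have := fa x; have := gb x.
have : 0 <= `|f x| by []. have : 0 <= `|g x| by [].
by case: (leP (f x) (g x)); lra.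
Qed.

Lemma bmeas_powR f q : 0 <= q -> (forall x, 0 <= f x) -> bmeas f ->
  bmeas (fun x => f x `^ q).
Proof.
move=> q0 f0 [mf [a fa]]; split.
  exact: (measurableT_comp (measurable_powR q)).
exists (a `^ q) => x; rewrite ger0_norm ?powR_ge0//.
have fxa : f x <= a by have := fa x; rewrite ger0_norm.
by rewrite ge0_ler_powR ?nnegrE// (le_trans (f0 x)).
Qed.

Lemma bmeas_le (f g : T -> R) : measurable_fun setT f -> bmeas g ->
  (forall x, `|f x| <= `|g x|) -> bmeas f.
Proof. by move=> mf [_ [c gc]] fg; split=> //; exists c => x; exact: le_trans (gc x). Qed.

Lemma bmeas_sum (I : Type) (s : seq I) (P : pred I) (F : I -> T -> R) :
  (forall i, P i -> bmeas (F i)) -> bmeas (fun x => \sum_(i <- s | P i) F i x).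
Proof.
move=> bF; elim: s => [|i s ih].
  by under eq_fun do rewrite big_nil; exact: bmeas_cst.
under eq_fun do rewrite big_cons.
by case: (P i) (bF i) => // bFi; apply: bmeasD => //; exact: bFi.
Qed.

End bounded_functions.

Section bounded_integrable_functions.
Context {d} {T : measurableType d} {R : realType}.
Variable m : {measure set T -> \bar R}.
Implicit Types (f g h : T -> R).

(** Stable under products and under powers [>= 1], which keeps the Bellman argument within
    real-valued integrals. *)
Definition bint f := bmeas f /\ m.-integrable setT (EFin \o f).

Lemma bint_bmeas f : bint f -> bmeas f. Proof. by case. Qed.

Lemma bint_le f g : bint g -> bmeas f -> (forall x, `|f x| <= `|g x|) -> bint f.
Proof.
move=> [bg ig] bf fg; split=> //.
apply: le_integrable ig => //; first by apply/measurable_EFinP; case: bf.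
by move=> x _ /=; rewrite lee_fin.
Qed.

Lemma bint0 : bint (cst 0).
Proof. by split; [exact: bmeas_cst|exact: integrable0]. Qed.

Lemma bintD f g : bint f -> bint g -> bint (fun x => f x + g x).
Proof.
move=> [bf fi] [bg gi]; split; first exact: bmeasD.
exact: (@integrableD _ _ _ m _ measurableT _ _ fi gi).
Qed.

Lemma bintMr f g : bint f -> bmeas g -> bint (fun x => f x * g x).
Proof.
move=> bf bg; have [mg [c gc]] := bg.
have [bf1 fi] := bf.
split; first exact: bmeasM.
apply: (@le_integrable _ _ _ m _ measurableT _ (fun x => (c%:E * (EFin \o f) x)%E)).
- by apply/measurable_EFinP; case: (bmeasM bf1 bg).
- move=> x _ /=; rewrite lee_fin !normrM mulrC ler_wpM2r//.
  by rewrite (le_trans (gc x))// ler_norm.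
- exact: integrableZl.
Qed.

Lemma bintMl f g : bmeas f -> bint g -> bint (fun x => f x * g x).
Proof.
move=> bf bg; rewrite (_ : (fun x => _) = fun x => g x * f x); first exact: bintMr.
by apply/funext => x; rewrite mulrC.
Qed.

Lemma bintM f g : bint f -> bint g -> bint (fun x => f x * g x).
Proof. by move=> bf [bg _]; exact: bintMr. Qed.

Lemma bintZ (c : R) f : bint f -> bint (fun x => c * f x).
Proof. by move=> bf; apply: bintMl => //; exact: bmeas_cst. Qed.

Lemma bintN f : bint f -> bint (fun x => - f x).
Proof.
by move=> /(bintZ (-1)); congr bint; apply/funext => x; rewrite mulN1r.
Qed.

Lemma bintB f g : bint f -> bint g -> bint (fun x => f x - g x).
Proof. by move=> bf bg; apply: bintD => //; exact: bintN. Qed.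

Lemma bintX f n : bint f -> bint (fun x => f x ^+ n.+1).
Proof.
move=> bf; under eq_fun do rewrite exprS.
by apply: bintMr => //; apply: bmeasX; case: bf.
Qed.

Lemma bint_norm f : bint f -> bint (fun x => `|f x|).
Proof.
move=> bf; apply: (bint_le bf) => [|x]; last by rewrite normr_id.
by apply: bmeas_norm; case: bf.
Qed.

Lemma bint_max f g : bint f -> bint g -> bint (fun x => Num.max (f x) (g x)).
Proof.
move=> bf bg; apply: (bint_le (bintD (bint_norm bf) (bint_norm bg))).
  by apply: bmeas_max; [case: bf|case: bg].
move=> x; rewrite (@ger0_norm _ (`|_| + _)) ?addr_ge0//.
have : 0 <= `|f x| by []. have : 0 <= `|g x| by [].
by case: (leP (f x) (g x)); lra.
Qed.

Lemma bint_powR f q : 1 <= q -> (forall x, 0 <= f x) -> bint f ->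
  bint (fun x => f x `^ q).
Proof.
move=> q1 f0 bf; under eq_fun do rewrite -mulr_powRB1 ?(lt_le_trans _ q1)//.
by apply: bintMr => //; apply: bmeas_powR; rewrite ?subr_ge0//; case: bf.
Qed.

Lemma bint_sum (I : Type) (s : seq I) (P : pred I) (F : I -> T -> R) :
  (forall i, P i -> bint (F i)) -> bint (fun x => \sum_(i <- s | P i) F i x).
Proof.
move=> bF; elim: s => [|i s ih].
  by under eq_fun do rewrite big_nil; exact: bint0.
under eq_fun do rewrite big_cons.
by case: (P i) (bF i) => // bFi; apply: bintD => //; exact: bFi.
Qed.

Lemma RintD f g : bint f -> bint g ->
  \int[m]_x (f x + g x) = \int[m]_x f x + \int[m]_x g x.
Proof. by move=> [_ fi] [_ gi]; rewrite RintegralD. Qed.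

Lemma RintB f g : bint f -> bint g ->
  \int[m]_x (f x - g x) = \int[m]_x f x - \int[m]_x g x.
Proof. by move=> [_ fi] [_ gi]; rewrite RintegralB. Qed.

Lemma RintZ (c : R) f : bint f -> \int[m]_x (c * f x) = c * \int[m]_x f x.
Proof. by move=> [_ fi]; rewrite RintegralZl. Qed.

Lemma Rint_sum (I : Type) (s : seq I) (P : pred I) (F : I -> T -> R) :
  (forall i, P i -> bint (F i)) ->
  \int[m]_x (\sum_(i <- s | P i) F i x) = \sum_(i <- s | P i) \int[m]_x F i x.
Proof.
move=> bF; elim: s => [|i s ih].
  under eq_Rintegral do rewrite big_nil.
  by rewrite big_nil /Rintegral integral0.
rewrite big_cons; under eq_Rintegral do rewrite big_cons.
case: ifP => // Pi; rewrite RintD ?ih//; first exact: bF.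
exact: bint_sum.
Qed.

Lemma Rint_le f g : bint f -> bint g -> (forall x, f x <= g x) ->
  \int[m]_x f x <= \int[m]_x g x.
Proof. by move=> [_ fi] [_ gi] fg; apply: le_Rintegral. Qed.

Lemma Rint_ge0 f : (forall x, 0 <= f x) -> 0 <= \int[m]_x f x.
Proof. by move=> f0; apply: Rintegral_ge0. Qed.

Lemma Rint_ae f g : measurable_fun setT f -> measurable_fun setT g ->
  {ae m, forall x, f x = g x} -> \int[m]_x f x = \int[m]_x g x.
Proof.
move=> mf mg fg; rewrite /Rintegral; congr fine.
apply: ae_eq_integral => //; [exact/measurable_EFinP|exact/measurable_EFinP|].
by apply: filterS fg => x /= -> _.
Qed.

Lemma Rint_EFin f : bint f -> (\int[m]_x f x)%:E = (\int[m]_x (f x)%:E)%E.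
Proof. by move=> [_ fi]; rewrite /Rintegral fineK//; exact: integrable_fin_num. Qed.

Lemma bint_ge0P f : bmeas f -> (forall x, 0 <= f x) ->
  (\int[m]_x (f x)%:E < +oo)%E -> bint f.
Proof.
move=> bf f0 foo; split=> //; apply/integrableP; split.
  by apply/measurable_EFinP; case: bf.
by under eq_integral do rewrite /= ger0_norm//.
Qed.

End bounded_integrable_functions.

Section markov_operator.
Context {d} {T : measurableType d} {R : realType}.
Variable m : {measure set T -> \bar R}.
Implicit Types (f g h : T -> R) (S : (T -> R) -> T -> R).

(** Positivity and [S 1 <= 1] hold at every point, as for a sub-Markovian kernel, while
    conservativeness gives [S 1 = 1] only almost everywhere; it enters through [mo_ae_one]. *)
Record markov_op S : Prop := {
  mo_bmeas : forall f, bmeas f -> bmeas (S f) ;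
  mo_lin : forall a f g, bmeas f -> bmeas g ->
    S (fun x => a * f x + g x) = (fun x => a * S f x + S g x) ;
  mo_ge0 : forall f, bmeas f -> (forall x, 0 <= f x) -> forall x, 0 <= S f x ;
  mo_le1 : forall x, S (cst 1) x <= 1 ;
  mo_sym : forall f g, bmeas f -> bmeas g ->
    (forall x, 0 <= f x) -> (forall x, 0 <= g x) ->
    (\int[m]_x (f x * S g x)%:E = \int[m]_x (S f x * g x)%:E)%E ;
  mo_one : {ae m, forall x, S (cst 1) x = 1} }.

Variable S : (T -> R) -> T -> R.
Hypothesis mS : markov_op S.
Hint Resolve bmeas_cst : core.
Let ibm f : bint m f -> bmeas f := @bint_bmeas _ _ _ m f.

Lemma moD f g : bmeas f -> bmeas g ->
  S (fun x => f x + g x) = (fun x => S f x + S g x).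
Proof.
move=> bf bg; have := mo_lin mS 1 bf bg.
by under eq_fun do rewrite mul1r; move=> ->; under eq_fun do rewrite mul1r.
Qed.

Lemma mo0 : S (cst 0) = cst 0.
Proof.
have := mo_lin mS (-1) (bmeas_cst 0) (bmeas_cst 0).
under eq_fun do rewrite mulr0 addr0.
move=> ->; apply/funext => x /=; ring.
Qed.

Lemma moZ (c : R) f : bmeas f -> S (fun x => c * f x) = (fun x => c * S f x).
Proof.
move=> bf; have := mo_lin mS c bf (bmeas_cst 0).
by under eq_fun do rewrite addr0; rewrite mo0; under [RHS]eq_fun do rewrite addr0.
Qed.

Lemma moB f g : bmeas f -> bmeas g ->
  S (fun x => f x - g x) = (fun x => S f x - S g x).
Proof.
move=> bf bg; have := mo_lin mS (-1) bg bf.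
under eq_fun do rewrite mulN1r addrC; move=> ->.
by apply/funext => x; rewrite mulN1r addrC.
Qed.

Lemma mo_sum (I : Type) (s : seq I) (P : pred I) (F : I -> T -> R) :
  (forall i, P i -> bmeas (F i)) ->
  S (fun x => \sum_(i <- s | P i) F i x) =
  (fun x => \sum_(i <- s | P i) S (F i) x).
Proof.
move=> bF; elim: s => [|i s ih].
  by under eq_fun do rewrite big_nil; rewrite mo0; under [RHS]eq_fun do rewrite big_nil.
under eq_fun do rewrite big_cons; under [RHS]eq_fun do rewrite big_cons.
case: (P i) (bF i) => // bFi; rewrite moD ?ih//; first exact: bFi.
exact: bmeas_sum.
Qed.

Lemma mo_le f g : bmeas f -> bmeas g -> (forall x, f x <= g x) ->
  forall x, S f x <= S g x.
Proof.
move=> bf bg fg x; rewrite -subr_ge0.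
have -> : S g x - S f x = S (fun x => g x - f x) x by rewrite moB.
by apply: (mo_ge0 mS); [exact: bmeasB|move=> y; rewrite subr_ge0].
Qed.

Lemma mo_cst (c : R) x : S (cst c) x = c * S (cst 1) x.
Proof.
have <- : (fun x => c * (cst 1 : T -> R) x) = cst c by apply/funext => y /=; rewrite mulr1.
by rewrite moZ.
Qed.

Lemma mo_bint_ge0 f : bint m f -> (forall x, 0 <= f x) -> bint m (S f).
Proof.
move=> [bf fi] f0; apply: bint_ge0P; [exact: (mo_bmeas mS)|exact: (mo_ge0 mS)|].
have := mo_sym mS (bmeas_cst 1) bf (fun=> ler01) f0.
under eq_integral do rewrite mul1r.
move=> ->; apply: (@le_lt_trans _ _ (\int[m]_x (f x)%:E)%E).
  apply: ge0_le_integral => //.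
  - by move=> x _; rewrite lee_fin mulr_ge0// (mo_ge0 mS).
  - apply/measurable_EFinP/measurable_funM; last by case: bf.
    by case: (mo_bmeas mS (bmeas_cst 1)).
  - by apply/measurable_EFinP; case: bf.
  - by move=> x _; rewrite lee_fin -[leRHS]mul1r ler_wpM2r// (mo_le1 mS).
have /integrableP[_] := fi.
by under eq_integral do rewrite /= ger0_norm//.
Qed.

Definition fpos f x := Num.max (f x) 0.
Definition fneg f x := Num.max (- f x) 0.

Lemma fposneg f x : f x = fpos f x - fneg f x.
Proof.
by rewrite /fpos /fneg; case: (leP (f x) 0) => ?; case: (leP (- f x) 0) => ?; lra.
Qed.

Lemma fpos_ge0 f x : 0 <= fpos f x.
Proof. by rewrite /fpos le_max lexx orbT. Qed.

Lemma fneg_ge0 f x : 0 <= fneg f x.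
Proof. by rewrite /fneg le_max lexx orbT. Qed.

Lemma bint_fpos f : bint m f -> bint m (fpos f).
Proof. by move=> bf; apply: bint_max => //; exact: bint0. Qed.

Lemma bint_fneg f : bint m f -> bint m (fneg f).
Proof. by move=> bf; apply: bint_max; [exact: bintN|exact: bint0]. Qed.

Lemma bmeas_fpos f : bmeas f -> bmeas (fpos f).
Proof. by move=> bf; apply: bmeas_max => //; exact: bmeas_cst. Qed.

Lemma bmeas_fneg f : bmeas f -> bmeas (fneg f).
Proof. by move=> bf; apply: bmeas_max; [exact: bmeasN|exact: bmeas_cst]. Qed.

Lemma mo_bint f : bint m f -> bint m (S f).
Proof.
move=> bf; have -> : f = (fun x => fpos f x - fneg f x).
  by apply/funext => x; rewrite -fposneg.
rewrite moB; [|exact: bint_bmeas (bint_fpos bf)|exact: bint_bmeas (bint_fneg bf)].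
by apply: bintB; apply: mo_bint_ge0 => //;
  [exact: bint_fpos|exact: fpos_ge0|exact: bint_fneg|exact: fneg_ge0].
Qed.

Lemma mo_symR f g : bint m f -> bmeas g ->
  \int[m]_x (f x * S g x) = \int[m]_x (S f x * g x).
Proof.
have H0 u v : bint m u -> bmeas v -> (forall x, 0 <= u x) -> (forall x, 0 <= v x) ->
    \int[m]_x (u x * S v x) = \int[m]_x (S u x * v x).
  by move=> [bu _] bv u0 v0; rewrite /Rintegral (mo_sym mS).
have H1 u v : bint m u -> bmeas v -> (forall x, 0 <= u x) ->
    \int[m]_x (u x * S v x) = \int[m]_x (S u x * v x).
  move=> bu bv u0; have bpv := bmeas_fpos bv; have bnv := bmeas_fneg bv.
  have -> : v = (fun x => fpos v x - fneg v x) by apply/funext => x; rewrite -fposneg.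
  rewrite moB//.
  under eq_Rintegral do rewrite mulrBr; under [RHS]eq_Rintegral do rewrite mulrBr.
  have bSu := mo_bint bu.
  rewrite !RintB; [|apply: bintMr|apply: bintMr|apply: bintMr|apply: bintMr] => //;
    try exact: (mo_bmeas mS).
  by rewrite !H0//; try (exact: fpos_ge0); exact: fneg_ge0.
move=> bf bg; have bpf := bint_fpos bf; have bnf := bint_fneg bf.
have bSg := mo_bmeas mS bg.
have -> : f = (fun x => fpos f x - fneg f x) by apply/funext => x; rewrite -fposneg.
rewrite moB; [|by case: bpf|by case: bnf].
under eq_Rintegral do rewrite mulrBl; under [RHS]eq_Rintegral do rewrite mulrBl.
rewrite !RintB; [|apply: bintMr|apply: bintMr|apply: bintMr|apply: bintMr] => //;
  try exact: mo_bint.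
by rewrite !H1//; try (exact: fpos_ge0); exact: fneg_ge0.
Qed.

Lemma mo_ae_one f : bmeas f -> \int[m]_x (f x * S (cst 1) x) = \int[m]_x f x.
Proof.
move=> bf; apply: Rint_ae.
- by case: (bmeasM bf (mo_bmeas mS (bmeas_cst 1))).
- by case: bf.
- by apply: filterS (mo_one mS) => x ->; rewrite mulr1.
Qed.

(** Invariance of [m]: symmetry against the constant 1. *)
Lemma mo_int f : bint m f -> \int[m]_x S f x = \int[m]_x f x.
Proof.
move=> bf; rewrite -(mo_ae_one (bint_bmeas bf)) mo_symR//.
by under [RHS]eq_Rintegral do rewrite /= mulr1.
Qed.

(** The conditional variance of [f] after one step; for [S = P s] it is to first order [s] times the
    carré du champ. *)
Definition mo_var f x := S (fun y => f y ^+ 2) x - S f x ^+ 2.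

(** [S] is applied to [(y |-> (f y - a)^2) >= 0] with the constant [a = S f x], and [S 1 <= 1]. *)
Lemma mo_var_ge0 f x : bmeas f -> 0 <= mo_var f x.
Proof.
move=> bf; pose a := S f x.
have bf2 : bmeas (fun y => f y ^+ 2) by exact: bmeasX.
have b1 : bmeas (fun y => 2 * a * f y - a ^+ 2).
  by apply: bmeasB; [exact: bmeasZ|exact: bmeas_cst].
have : S (fun y => 2 * a * f y - a ^+ 2) x <= S (fun y => f y ^+ 2) x.
  by apply: mo_le => // y; have := sqr_ge0 (f y - a); lra.
rewrite moB; [|exact: bmeasZ|exact: bmeas_cst].
rewrite moZ// -/(cst (a ^+ 2)) mo_cst.
have := mo_le1 mS x; rewrite /mo_var -/a.
have : 0 <= a ^+ 2 by exact: sqr_ge0.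
nra.
Qed.

Lemma bint_mo_var f : bint m f -> bint m (mo_var f).
Proof.
move=> bf; apply: bintB; last exact/bintX/mo_bint.
exact/mo_bint/bintX.
Qed.

(** The tangent of [t^r] at [S f x] is put under [S]. The factor [S 1 x], equal to 1 only almost
    everywhere, is carried along until integration. *)
Lemma mo_jensen r f : 1 <= r -> bint m f -> (forall x, 0 <= f x) ->
  \int[m]_x (S f x `^ r) <= \int[m]_x (f x `^ r).
Proof.
move=> r1 bf f0; have bSf := mo_bint bf.
have Sf0 := mo_ge0 mS (bint_bmeas bf) f0.
have r0 : 0 <= r by rewrite (le_trans _ r1).
have bfr := bint_powR r1 f0 bf.
rewrite -(mo_int bfr).
rewrite -(mo_ae_one (bint_bmeas (bint_powR r1 Sf0 bSf))).
have b1 := mo_bmeas mS (bmeas_cst 1).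
have br1 : bmeas (fun x => S f x `^ (r - 1)).
  by apply: bmeas_powR => //; rewrite ?subr_ge0//; case: bSf.
pose F x := S f x `^ r * S (cst 1) x + r * S f x `^ (r - 1) * (S f x - S f x * S (cst 1) x).
have bF1 : bint m (fun x => S f x `^ r * S (cst 1) x).
  by apply: bintMr => //; exact: bint_powR.
have bF2 : bint m (fun x => r * S f x `^ (r - 1) * (S f x - S f x * S (cst 1) x)).
  by apply: bintMl; [exact: bmeasZ|apply: bintB => //; exact: bintMr].
apply: Rint_le => //; first exact: mo_bint.
move=> x; apply: (@le_trans _ _ (F x)).
  rewrite /F lerDl; apply: mulr_ge0; first by rewrite mulr_ge0// powR_ge0.
  by rewrite subr_ge0 -[leRHS]mulr1 ler_wpM2l// (mo_le1 mS).
pose q := r * S f x `^ (r - 1).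
have bl : bmeas (fun y => q * f y + (S f x `^ r - q * S f x)).
  by apply: bmeasD; [exact/bmeasZ/ibm|exact: bmeas_cst].
have ql y : q * f y + (S f x `^ r - q * S f x) <= f y `^ r.
  by have := powR_tangent r1 (Sf0 x) (f0 y); rewrite -/q; lra.
apply: le_trans (mo_le bl (bint_bmeas bfr) ql x).
rewrite moD; [|exact/bmeasZ/ibm|exact: bmeas_cst].
rewrite moZ; last exact: ibm.
by rewrite -/(cst (S f x `^ r - q * S f x)) mo_cst /F -/q; lra.
Qed.

(** * One step of the Bellman argument *)

Section bellman_step.
Variable r : R.
Hypothesis r1 : 1 <= r.

Lemma bmeas_bellman_b (a z : T -> R) : bmeas a -> bmeas z ->
  bmeas (fun x => bellman_b r (a x) (z x)).
Proof. by move=> ba bz; apply: bmeas_max => //; exact: bmeasZ. Qed.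

Lemma bint_bellman_b (a z : T -> R) : bint m a -> bint m z ->
  bint m (fun x => bellman_b r (a x) (z x)).
Proof. by move=> ba bz; apply: bint_max => //; exact: bintZ. Qed.

Lemma bint_bellman (a z : T -> R) : bint m a -> bint m z ->
  (forall x, 0 <= a x) -> bint m (fun x => bellman r (a x) (z x)).
Proof.
move=> ba bz a0.
have b0 x : 0 <= bellman_b r (a x) (z x) by exact: bellman_b_ge0.
have bb := bint_bellman_b ba bz.
apply: bintB; first exact/bintZ/bint_powR.
apply: bintMr; first exact: bintZ.
by apply: bmeas_powR => //; rewrite ?subr_ge0//; case: bb.
Qed.

Lemma bmeas_bellman_da (a z : T -> R) : bmeas a -> bmeas z ->
  (forall x, 0 <= a x) -> (forall x, 0 <= z x) ->
  bmeas (fun x => bellman_da r (a x) (z x)).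
Proof.
move=> ba bz a0 z0.
have b0 x : 0 <= bellman_b r (a x) (z x) by exact: bellman_b_ge0.
have bb := bmeas_bellman_b ba bz.
have bp : bmeas (fun x => bellman_b r (a x) (z x) `^ (r - 1)).
  by apply: bmeas_powR => //; rewrite subr_ge0.
apply: (@bmeas_le _ _ _ _ (fun x => r ^+ 2 * bellman_b r (a x) (z x) `^ (r - 1))).
- apply: measurable_funM => //; apply: measurable_funB; first by case: bp.
  apply: measurable_funM; first by case: (bmeasZ (r - 1) bz).
  apply: measurable_funM; first by case: bp.
  rewrite (_ : (fun x => _) = fun x => bellman_b r (a x) (z x) `^ (- 1)).
    by apply: (measurableT_comp (measurable_powR _)) => //; case: bb.
  by apply/funext => x; rewrite powR_inv1.
- exact: bmeasZ.
- move=> x; rewrite ger0_norm ?bellman_da_ge0// ger0_norm ?mulr_ge0 ?sqr_ge0 ?powR_ge0//.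
  rewrite /bellman_da ler_wpM2l ?sqr_ge0// gerBl mulr_ge0 ?mulr_ge0 ?subr_ge0//.
  - by rewrite powR_ge0.
  - by rewrite invr_ge0.
- by rewrite (le_trans _ r1).
- by rewrite (le_trans _ r1).
Qed.

Lemma bellman_step_shift (B z z' : T -> R) :
  bint m B -> bint m z -> bint m z' -> (forall x, 0 <= B x) ->
  (forall x, 0 <= z x) -> (forall x, z x <= S z' x) ->
  \int[m]_x bellman r (B x + (S z' x - z x)) (S z' x) <=
  \int[m]_x bellman r (B x) (z x).
Proof.
move=> bB bz bz' B0 z0 zz'; apply: Rint_le.
- apply: bint_bellman => //; last by move=> x; rewrite addr_ge0// subr_ge0.
    by apply: bintD => //; apply: bintB => //; exact: mo_bint.
  exact: mo_bint.
- exact: bint_bellman.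
move=> x; have {2}-> : S z' x = z x + (S z' x - z x) by rewrite addrC subrK.
by apply: bellman_shift => //; rewrite subr_ge0.
Qed.

(** For [(x, y)] with the symmetric law [m(dx) S(x, dy)], the left side is the integral of [bellman
    (E[C(x)|y]) (z'(y))], the right side that of [bellman (C(x)) (E[z'(y)|x])]; conditional Jensen,
    once in each argument, compares both with [bellman (C(x)) (z'(y))]. As [S] is just an operator,
    tangent lines stand in for the joint law. *)
Lemma bellman_step_average (C z' : T -> R) : bint m C -> bint m z' ->
  (forall x, 0 <= C x) -> (forall x, 0 <= z' x) ->
  \int[m]_x bellman r (S C x) (z' x) <= \int[m]_x bellman r (C x) (S z' x).
Proof.
move=> bC bz' C0 z'0.
have bSz' := mo_bint bz'; have bSC := mo_bint bC.
have SC0 := mo_ge0 mS (bint_bmeas bC) C0.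
have Sz'0 := mo_ge0 mS (bint_bmeas bz') z'0.
have bV := bint_bellman bSC bz' SC0.
have bW := bint_bellman bC bSz' C0.
have bD := bmeas_bellman_da (bint_bmeas bSC) (bint_bmeas bz') SC0 z'0.
have bDSC := bintMr bSC bD.
set V := fun x => bellman r (S C x) (z' x).
set D := fun x => bellman_da r (S C x) (z' x).
set W := fun x => bellman r (C x) (S z' x).
have b1 := mo_bmeas mS (bmeas_cst 1).
pose q x := r ^+ 2 * bellman_b r (C x) (S z' x) `^ (r - 1).
have bq : bmeas q.
  apply: bmeasZ; apply: bmeas_powR; first by rewrite subr_ge0.
    by move=> x; apply: bellman_b_ge0.
  by apply: ibm; apply: bint_bellman_b.
have q0 x : 0 <= q x by rewrite mulr_ge0 ?sqr_ge0 ?powR_ge0.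
(* Convexity in the first and concavity in the second argument separate the
   variables [x] and [y]; [S] is then applied in [y]. *)
have key x : S V x + C x * S D x - S (fun y => S C y * D y) x <=
    W x * S (cst 1) x - (q x * S z' x - q x * S z' x * S (cst 1) x).
  have bl : bmeas (fun y => V y + C x * D y - S C y * D y).
    apply: bmeasB; last exact: ibm.
    by apply: bmeasD; [exact: ibm|exact: bmeasZ].
  have br : bmeas (fun y => cst (W x + q x * S z' x) y - q x * z' y).
    by apply: bmeasB; [exact: bmeas_cst|exact/bmeasZ/ibm].
  have lr y : V y + C x * D y - S C y * D y <=
      cst (W x + q x * S z' x) y - q x * z' y.
    have h1 := bellman_convex r1 (SC0 y) (C0 x) (z'0 y).
    have h2 := bellman_concave r1 (C0 x) (Sz'0 x) (z'0 y).
    move: h1 h2; rewrite -/(V y) -/(D y) -/(W x) -/(q x) /=; lra.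
  have := mo_le bl br lr x.
  rewrite (moB (bmeasD (ibm bV) (bmeasZ (C x) bD)) (ibm bDSC)).
  rewrite (moD (ibm bV) (bmeasZ (C x) bD)) (moZ (C x) bD).
  rewrite (moB (bmeas_cst _) (bmeasZ (q x) (ibm bz'))) (moZ (q x) (ibm bz')).
  by rewrite mo_cst; lra.
have bSV := mo_bint bV; have bSD := mo_bmeas mS bD.
have := @Rint_le _ _ _ m _ _ _ _ key.
have i1 : bint m (fun x => S V x + C x * S D x).
  by apply: bintD => //; exact: bintMr.
have i2 : bint m (fun x => W x * S (cst 1) x) by exact: bintMr.
have i3 : bint m (fun x => q x * S z' x) by exact: bintMl.
have i4 : bint m (fun x => q x * S z' x * S (cst 1) x) by exact: bintMr.
have i5 : bint m (S (fun y => S C y * D y)) by exact: mo_bint.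
move=> /(_ (bintB i1 i5) (bintB i2 (bintB i3 i4))).
rewrite (RintB i1 i5) (RintB i2 (bintB i3 i4)) (RintB i3 i4).
rewrite (RintD bSV (bintMr bC bSD)).
(* The tangent terms cancel: those in [q] because [S 1 = 1] almost everywhere, those in [D] by
   symmetry and invariance. *)
rewrite (mo_ae_one (ibm i3)) (mo_ae_one (ibm bW)).
by rewrite (mo_int bV) (mo_int bDSC) (mo_symR bC bD) addrK subrr subr0.
Qed.

End bellman_step.

(** * The moment bound for the compensator *)

Section bellman_iteration.
Variable r : R.
Hypothesis r1 : 1 <= r.
Variables (z : nat -> T -> R) (n : nat).
Hypotheses (bz : forall k, bint m (z k)) (z0 : forall k x, 0 <= z k x).
Hypothesis zS : forall k x, (k <= n)%N -> z k x <= S (z k.+1) x.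

(** In the path picture, [doob_sum k] at [Y_k] is the conditional expectation given [Y_k] of the
    compensator of [z i (Y_i)] up to and including the increment of index [k]. By reversibility,
    projecting an earlier function on the next position is an application of [S]. *)
Fixpoint doob_sum k : T -> R :=
  fun x => (if k is k'.+1 then S (doob_sum k') x else 0) + (S (z k.+1) x - z k x).

(** The integral of [bellman] cannot increase along the recursion: averaging handles
    [S (doob_sum k)], the shift the new increment. It starts from [bellman r 0 z <= 0]. *)
Lemma doob_sum_props k : (k <= n)%N ->
  [/\ bint m (doob_sum k), forall x, 0 <= doob_sum k x &
    \int[m]_x bellman r (doob_sum k x) (S (z k.+1) x) <= 0].
Proof.
elim: k => [|k ih] kn.
  have bB : bint m (fun=> 0 : R) by exact: bint0.
  split.
  - by apply: bintD => //; apply: bintB => //; exact: mo_bint.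
  - by move=> x /=; rewrite add0r subr_ge0 zS.
  - apply: le_trans (bellman_step_shift r1 bB (bz 0) (bz 1) _ _ _) _ => //.
      by move=> x; rewrite zS.
    rewrite -[leRHS](_ : \int[m]_x (fun=> 0) x = 0); last by rewrite /Rintegral integral0.
    by apply: Rint_le => //; [exact: bint_bellman|move=> x; exact: bellman_le0].
have [bC C0 CV] := ih (ltnW kn).
have bSC := mo_bint bC.
have SC0 := mo_ge0 mS (bint_bmeas bC) C0.
split.
- by apply: bintD => //; apply: bintB => //; exact: mo_bint.
- by move=> x /=; rewrite addr_ge0// subr_ge0 zS.
- have E x : doob_sum k.+1 x = S (doob_sum k) x + (S (z k.+2) x - z k.+1 x) by [].
  under eq_Rintegral do rewrite E.
  have zS' x : z k.+1 x <= S (z k.+2) x by exact: zS.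
  apply: (le_trans (bellman_step_shift r1 bSC (bz k.+1) (bz k.+2) SC0 (z0 _) zS')).
  by apply: le_trans CV; exact: bellman_step_average.
Qed.

(** [bellman_lower] extracts the moment from the invariant, and Jensen removes the last [S]. *)
Lemma doob_sum_powR :
  \int[m]_x (doob_sum n x `^ r) <= r `^ r * \int[m]_x (z n.+1 x `^ r).
Proof.
have [bC C0 CV] := doob_sum_props (leqnn n).
have bSz := mo_bint (bz n.+1).
have Sz0 := mo_ge0 mS (bint_bmeas (bz n.+1)) (z0 n.+1).
have bV : bint m (fun x => bellman r (doob_sum n x) (S (z n.+1) x)).
  exact: bint_bellman.
have bSzr := bint_powR r1 Sz0 bSz.
apply: (@le_trans _ _ (r `^ r * \int[m]_x (S (z n.+1) x `^ r))); last first.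
  by rewrite ler_wpM2l ?powR_ge0//; exact: mo_jensen.
rewrite -RintZ//.
apply: le_trans (_ : \int[m]_x (bellman r (doob_sum n x) (S (z n.+1) x) +
    r `^ r * S (z n.+1) x `^ r) <= _); last by rewrite RintD//; [lra|exact: bintZ].
apply: Rint_le; [exact: bint_powR|by apply: bintD => //; exact: bintZ|].
by move=> x; exact: bellman_lower.
Qed.

End bellman_iteration.
End markov_operator.

Section markov_semigroup.
Context {d} {T : measurableType d} {R : realType}.
Variable m : {measure set T -> \bar R}.

Record markov_semigroup (P : R -> (T -> R) -> T -> R) : Prop := {
  ms_op : forall t, 0 <= t -> markov_op m (P t) ;
  msD : forall s t, 0 <= s -> 0 <= t -> forall f, bmeas f ->
    P (s + t) f = P s (P t f) ;
  ms0 : forall f, bmeas f -> P 0 f = f }.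

Variable P : R -> (T -> R) -> T -> R.
Hypothesis mP : markov_semigroup P.
Let ibm f : bint m f -> bmeas f := @bint_bmeas _ _ _ m f.

Lemma ms_bmeas t f : 0 <= t -> bmeas f -> bmeas (P t f).
Proof. by move=> t0; exact: (mo_bmeas (ms_op mP t0)). Qed.

Lemma ms_bint t f : 0 <= t -> bint m f -> bint m (P t f).
Proof. by move=> t0; exact: (mo_bint (ms_op mP t0)). Qed.

Lemma ms_sym t f g : 0 <= t -> bint m f -> bmeas g ->
  \int[m]_x (f x * P t g x) = \int[m]_x (P t f x * g x).
Proof. by move=> t0; exact: (mo_symR (ms_op mP t0)). Qed.

Lemma ms_sym2 s t f g : 0 <= s -> 0 <= t -> bint m f -> bmeas g ->
  \int[m]_x (P s f x * P t g x) = \int[m]_x (P (s + t) f x * g x).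
Proof.
move=> s0 t0 bf bg; rewrite ms_sym//; last exact: ms_bint.
by rewrite addrC (msD mP)//; exact: ibm.
Qed.

(* The time-discretized square function, paired with a test function. *)
Definition energy (s t : R) f h := \int[m]_x (mo_var (P s) (P t f) x * P t h x).

(** The sum is the integral of [h * P tau C] with [C] the [doob_sum] of the reversed squares, and
    the assumption on [g], [h] is used at [c = P tau C x]. The offset [tau] of the grid is there to
    be averaged over. *)
Lemma energy_sum (r s tau : R) (n : nat) f h g : 1 <= r -> 0 <= s -> 0 <= tau ->
  bint m f -> bint m h -> bint m g -> (forall x, 0 <= g x) ->
  (forall x, 0 <= h x) ->
  (forall x c, 0 <= c -> r * h x * c <= c `^ r + (r - 1) * g x `^ r) ->
  r * \sum_(k < n.+1) energy s (k%:R * s + tau) f h <=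
  r `^ r * \int[m]_x (f x ^+ 2) `^ r + (r - 1) * \int[m]_x (g x `^ r).
Proof.
move=> r1 s0 tau0 bf bh bg g0 h0 hg.
pose u k := P (k%:R * s + tau) f.
(* The index runs against the semigroup time, so that [P s (z j.+1) - z j] is the variance of
   [u (n - j)]. *)
pose z j : T -> R := fun x => u (n.+1 - j)%N x ^+ 2.
have t0 k : 0 <= k%:R * s + tau by rewrite addr_ge0// mulr_ge0.
have bu k : bint m (u k) by exact: ms_bint.
have bz k : bint m (z k) by exact: bintX.
have z0 k x : 0 <= z k x by exact: sqr_ge0.
have mS := ms_op mP s0.
have uS k : u k.+1 = P s (u k).
  by rewrite /u -(msD mP)//; [congr P; rewrite -natr1; ring|exact: ibm].
pose e j x := P s (z j.+1) x - z j x.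
have eE j : (j <= n)%N -> e j = mo_var (P s) (u (n - j)%N).
  move=> jn; apply/funext => x; rewrite /e /z /mo_var subSS subSn// uS.
  by [].
have zS k x : (k <= n)%N -> z k x <= P s (z k.+1) x.
  move=> kn; rewrite -subr_ge0 -/(e k x) eE//.
  by apply: (mo_var_ge0 mS); exact: ibm.
have be j : bint m (e j) by apply: bintB => //; exact: ms_bint.
(* The increment [e i] has been carried by [P s] through the [k - i] later steps. *)
have CE k : doob_sum (P s) z k = (fun x => \sum_(i < k.+1) P ((k - i)%:R * s) (e i) x).
  elim: k => [|k ih].
    apply/funext => x; rewrite big_ord_recr big_ord0 /= subnn mul0r (ms0 mP) ?add0r//.
    exact: ibm.
  apply/funext => x; rewrite big_ord_recr /= subnn mul0r (ms0 mP); last exact: ibm.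
  congr (_ + _); rewrite ih (mo_sum mS); last by move=> i _; apply: ms_bmeas; rewrite ?mulr_ge0//; exact: ibm.
  apply: eq_bigr => -[i] /=; rewrite ltnS => ik _.
  by rewrite -(msD mP) ?mulr_ge0//; [rewrite subSn// -natr1; congr (P _ _ _); ring|exact: ibm].
have [bC C0 _] := doob_sum_props mS r1 bz z0 zS (leqnn n).
have Cr : \int[m]_x (doob_sum (P s) z n x `^ r) <= r `^ r * \int[m]_x (f x ^+ 2) `^ r.
  apply: (le_trans (doob_sum_powR mS r1 bz z0 zS)).
  rewrite ler_wpM2l ?powR_ge0//.
  have bf2 := bintX 1 bf.
  have f20 x : 0 <= f x ^+ 2 by exact: sqr_ge0.
  have mtau := ms_op mP tau0.
  apply: le_trans (mo_jensen mtau r1 bf2 f20).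
  apply: Rint_le.
  - exact: bint_powR.
  - apply: bint_powR => //; first exact: (mo_ge0 mtau (ibm bf2)).
    exact: mo_bint.
  move=> x; rewrite ge0_ler_powR ?nnegrE//; first by rewrite (le_trans _ r1).
    exact: (mo_ge0 mtau (ibm bf2)).
  rewrite /z subnn /u mul0r add0r -subr_ge0.
  exact: (mo_var_ge0 mtau _ (ibm bf)).
pose C := doob_sum (P s) z n.
have mtau := ms_op mP tau0.
have bPC : bint m (P tau C) by exact: mo_bint.
have PC0 x : 0 <= P tau C x by exact: (mo_ge0 mtau (ibm bC) C0).
have r0 : 0 <= r by rewrite (le_trans _ r1).
(* Symmetry moves the semigroup from [h] to the variance; reversing the index then gives
   [P tau C]. *)
have E : \sum_(k < n.+1) energy s (k%:R * s + tau) f h = \int[m]_x (h x * P tau C x).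
  have bv k : bint m (mo_var (P s) (u k)) by exact: bint_mo_var.
  have -> : P tau C = (fun x => \sum_(k < n.+1) P (k%:R * s + tau) (mo_var (P s) (u k)) x).
    rewrite /C CE (mo_sum mtau); last first.
      by move=> i _; apply: ms_bmeas; rewrite ?mulr_ge0//; exact: ibm.
    apply/funext => x; rewrite (reindex_inj rev_ord_inj)/=.
    apply: eq_bigr => -[i] /=; rewrite ltnS => ik _.
    rewrite -(msD mP) ?mulr_ge0//; last exact: ibm.
    by rewrite eE subSS ?leq_subr// subKn// addrC.
  under eq_Rintegral do rewrite mulr_sumr.
  rewrite Rint_sum; last by move=> i _; apply: bintM => //; exact: ms_bint.
  apply: eq_bigr => i _; rewrite /energy (ms_sym (t0 i) (bv i) (ibm bh)).
  by apply: eq_Rintegral => x _; rewrite mulrC.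
rewrite E -RintZ; last exact: bintM.
have bgr := bint_powR r1 g0 bg.
apply: (@le_trans _ _ (\int[m]_x (P tau C x `^ r + (r - 1) * g x `^ r))).
  apply: Rint_le; [exact/bintZ/bintM|by apply: bintD; [exact: bint_powR|exact: bintZ]|].
  by move=> x; rewrite mulrA hg.
rewrite RintD; [|exact: bint_powR|exact: bintZ].
rewrite RintZ// lerD2r (le_trans _ Cr)//.
exact: mo_jensen.
Qed.

End markov_semigroup.

(** * Approximating forms *)

Section convex_sequences.
Variable R : realType.
Variable a : nat -> R.
Hypothesis a_convex : forall n, 2 * a n.+1 <= a n + a n.+2.

Lemma convex_seq_slope n : n%:R * (a n - a n.+1) <= a 0 - a n.
Proof.
elim: n => [|n ih]; first by rewrite mul0r subrr.
have := a_convex n; have : 0 <= n%:R :> R by [].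
rewrite -natr1; nra.
Qed.

(** The last slope of a convex sequence is at most its mean slope, so chord slopes from 0 are
    monotone. Applied to [(P_t u, u)] along arithmetic progressions, this takes the place of the
    spectral theorem. *)
Lemma convex_seq_mean m n : (m <= n)%N ->
  m%:R * (a 0 - a n) <= n%:R * (a 0 - a m).
Proof.
elim: n => [|n ih]; first by rewrite leqn0 => /eqP ->.
rewrite leq_eqVlt => /predU1P[->//|]; rewrite ltnS => mn.
have {}ih := ih mn.
have [n0|n0] := posnP n.
  by move: mn; rewrite n0 leqn0 => /eqP ->; rewrite mul0r subrr mulr0.
have np : 0 < n%:R :> R by rewrite ltr0n.
have := convex_seq_slope n.
rewrite -(ler_pM2l np) -natr1 => H.
have : m%:R * (n%:R * (a n - a n.+1)) <= m%:R * (a 0 - a n).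
  by rewrite ler_wpM2l// convex_seq_slope.
have : 0 <= m%:R :> R by [].
nra.
Qed.

End convex_sequences.

Section semigroup_forms.
Context {d} {T : measurableType d} {R : realType}.
Variable m : {measure set T -> \bar R}.
Variable P : R -> (T -> R) -> T -> R.
Hypothesis mP : markov_semigroup m P.
Implicit Types (u v k : T -> R) (s t : R).
Let ibm f : bint m f -> bmeas f := @bint_bmeas _ _ _ m f.

Definition sg_form t u v := t^-1 * \int[m]_x ((u x - P t u x) * v x).

Definition sg_corr t u := \int[m]_x (P t u x * u x).

Lemma sg_corrD s t u : 0 <= s -> 0 <= t -> bint m u ->
  \int[m]_x (P s u x * P t u x) = sg_corr (s + t) u.
Proof. by move=> s0 t0 bu; rewrite (ms_sym2 mP)//; exact: ibm. Qed.

Lemma sg_corr0 u : bint m u -> sg_corr 0 u = \int[m]_x (u x ^+ 2).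
Proof.
move=> bu; rewrite /sg_corr (ms0 mP (ibm bu)).
by apply: eq_Rintegral => x _; rewrite expr2.
Qed.

Lemma mo_sqr_le S u : markov_op m S -> bint m u ->
  \int[m]_x (S u x ^+ 2) <= \int[m]_x (u x ^+ 2).
Proof.
move=> mS bu; rewrite -[leRHS](mo_int mS (bintX 1 bu)).
apply: Rint_le; [exact/bintX/(mo_bint mS)|exact/(mo_bint mS)/bintX|].
by move=> x; rewrite -subr_ge0; exact: (mo_var_ge0 mS _ (ibm bu)).
Qed.

Lemma sg_corr_half t u : 0 <= t -> bint m u ->
  sg_corr t u = \int[m]_x (P (t / 2) u x ^+ 2).
Proof.
move=> t0 bu; have t20 : 0 <= t / 2 by rewrite divr_ge0.
by rewrite {1}(splitr t) -sg_corrD.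
Qed.

Lemma sg_corr_le s t u : 0 <= s -> s <= t -> bint m u ->
  sg_corr t u <= sg_corr s u.
Proof.
move=> s0 st bu; have t0 := le_trans s0 st.
have s20 : 0 <= s / 2 by rewrite divr_ge0.
have ts0 : 0 <= (t - s) / 2 by rewrite divr_ge0// subr_ge0.
rewrite !sg_corr_half// (_ : t / 2 = (t - s) / 2 + s / 2); last by field.
rewrite (msD mP)//; last exact: ibm.
apply: (mo_sqr_le (ms_op mP ts0)); exact: ms_bint.
Qed.

(** By symmetry the middle term is the inner product of [P_(ne/2) u] and [P_((n+2)e/2) u], and
    [2ab <= a^2 + b^2]. *)
Lemma sg_corr_convex e n u : 0 <= e -> bint m u ->
  2 * sg_corr (n.+1%:R * e) u <= sg_corr (n%:R * e) u + sg_corr (n.+2%:R * e) u.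
Proof.
move=> e0 bu.
have a0 i : 0 <= i%:R * e / 2 by rewrite divr_ge0// mulr_ge0.
have b0 i : 0 <= i%:R * e by rewrite mulr_ge0.
rewrite (sg_corr_half (b0 n))// (sg_corr_half (b0 n.+2))//.
rewrite (_ : n.+1%:R * e = n%:R * e / 2 + n.+2%:R * e / 2); last first.
  by rewrite -!natr1; field.
rewrite -sg_corrD//.
have bn := ms_bint mP (a0 n) bu; have bn2 := ms_bint mP (a0 n.+2) bu.
rewrite -RintZ; last exact: bintM.
rewrite -RintD; [|exact: bintX|exact: bintX].
apply: Rint_le; [exact/bintZ/bintM|by apply: bintD; exact: bintX|].
by move=> x; have := sqr_ge0 (P (n%:R * e / 2) u x - P (n.+2%:R * e / 2) u x); lra.
Qed.

Lemma sg_formE t u : 0 <= t -> bint m u ->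
  sg_form t u u = t^-1 * (sg_corr 0 u - sg_corr t u).
Proof.
move=> t0 bu; rewrite /sg_form sg_corr0// /sg_corr; congr (_ * _).
have bPu := ms_bint mP t0 bu.
rewrite -RintB; [|exact: bintX|exact: bintM].
by apply: eq_Rintegral => x _; rewrite mulrBl expr2.
Qed.

(** On the grid of step [e = t / N] this is [convex_seq_mean]. Rounding [s] down to the grid is
    controlled by monotonicity of [sg_corr] and costs [e X' = t X' / N], which tends to 0. *)
Lemma sg_form_nonincreasing s t u : 0 < s -> s <= t -> bint m u ->
  sg_form t u u <= sg_form s u u.
Proof.
move=> s0 st bu; have t0 := lt_le_trans s0 st.
rewrite !sg_formE ?(ltW s0) ?(ltW t0)//.
rewrite ler_pdivrMl// mulrCA ler_pdivlMl//.
set X' := sg_corr 0 u - sg_corr t u; set X := sg_corr 0 u - sg_corr s u.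
have X'0 : 0 <= X' by rewrite subr_ge0 sg_corr_le// ltW.
suff H N : (0 < N)%N -> s * X' <= t * X + (t * X') / N%:R.
  apply/ler_addgt0Pr => e e0.
  have [N0|N0] := leP (t * X') 0.
    apply: le_trans (H 1 isT) _; rewrite divr1 lerD2l.
    exact: le_trans N0 (ltW e0).
  pose N := (Num.truncn (t * X' / e)).+1.
  apply: (le_trans (H N isT)); rewrite lerD2l ler_pdivrMr ?ltr0n//.
  by rewrite -ler_pdivrMl// [leLHS]mulrC ltW// truncnS_gt.
move=> N0; have NR : 0 < N%:R :> R by rewrite ltr0n.
pose e := t / N%:R; have e0 : 0 < e by rewrite divr_gt0.
pose k := Num.truncn (s / e).
have /andP[k1 k2] : k%:R <= s / e < k.+1%:R.
  by apply: truncn_itv; rewrite divr_ge0// ltW.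
have kN : (k <= N)%N.
  rewrite -(ler_nat R) (le_trans k1)// ler_pdivrMr// /e mulrCA divff ?gt_eqF// mulr1.
  exact: st.
have := @convex_seq_mean R (fun n => sg_corr (n%:R * e) u)
  (fun n => sg_corr_convex n (ltW e0) bu) k N kN.
have -> : N%:R * e = t by rewrite /e mulrCA divff ?gt_eqF// mulr1.
rewrite mul0r -/X' => H.
have ke : k%:R * e <= s by rewrite -ler_pdivlMr.
have ske : s <= k%:R * e + e by move: (ltW k2); rewrite ler_pdivrMr// -natr1 mulrDl mul1r.
have H2 : N%:R * (sg_corr 0 u - sg_corr (k%:R * e) u) <= N%:R * X.
  rewrite ler_wpM2l// lerD2l lerN2 sg_corr_le// mulr_ge0// ltW//.
have H3 : e * (k%:R * X') <= e * (N%:R * X) by rewrite ler_wpM2l ?(ltW e0)//; exact: le_trans H H2.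
have -> : t * X = e * (N%:R * X) by rewrite /e; field; rewrite gt_eqF.
have -> : t * X' / N%:R = e * X' by rewrite /e mulrAC.
have : s * X' <= (k%:R * e + e) * X' by rewrite ler_wpM2r.
lra.
Qed.

(** By monotonicity, a bound along arbitrarily small times bounds all times. *)
Lemma sg_form_cvg u (M : R) : bint m u ->
  (forall e : R, 0 < e -> exists2 s, 0 < s <= e & sg_form s u u <= M) ->
  cvg (sg_form t u u @[t --> 0^'+]).
Proof.
move=> bu uM; have H y : has_ubound [set sg_form x u u | x in `]0, y[].
  exists M => z [s] /=; rewrite in_itv/= => /andP[s0 _] <-.
  have [s' /andP[s'0 s's] sM] := uM s s0.
  by apply: le_trans sM; exact: sg_form_nonincreasing.
apply: nonincreasing_at_right_is_cvgr; near=> x; last exact: H.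
move=> s t; rewrite !in_itv/= => /andP[s0 _] /andP[t0 _] st.
exact: sg_form_nonincreasing.
Unshelve. all: by end_near. Qed.

(** As [(P_s P_t f, P_t f) = (P_(2t+s) f, f)], the approximating form is a chord slope of
    [(P_a f, f)] just after [a = 2t], at most the chord slope over [[0, 2t]] by convexity. *)
Lemma sg_form_smooth t f : 0 < t -> bint m f ->
  cvg (sg_form s (P t f) (P t f) @[s --> 0^'+]).
Proof.
move=> t0 bf; have bu := ms_bint mP (ltW t0) bf.
have t2 : 0 < 2 * t by rewrite mulr_gt0.
apply: (@sg_form_cvg _ ((sg_corr 0 f - sg_corr (2 * t) f) / (2 * t))) => // e e0.
(* The step [s] divides [2t], so that [0], [2t] and [2t + s] lie on one progression. *)
pose n := (Num.truncn (2 * t / e)).+1.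
have nR : 0 < n%:R :> R by rewrite ltr0n.
pose s := 2 * t / n%:R; have s0 : 0 < s by rewrite divr_gt0.
exists s.
  by rewrite s0/= ler_pdivrMr// -ler_pdivrMl// [leLHS]mulrC ltW// truncnS_gt.
rewrite sg_formE ?(ltW s0)//.
have E a : 0 <= a -> sg_corr a (P t f) = sg_corr (2 * t + a) f.
  move=> a0; rewrite {1}/sg_corr -(msD mP) ?(ltW t0)//; last exact: ibm.
  rewrite sg_corrD ?addr_ge0 ?(ltW t0)//; congr sg_corr; ring.
rewrite !E ?(ltW s0)// addr0.
have := @convex_seq_slope R (fun n => sg_corr (n%:R * s) f)
  (fun n => sg_corr_convex n (ltW s0) bf) n.
have sn : n%:R * s = 2 * t by rewrite /s mulrCA divff ?gt_eqF// mulr1.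
have sn1 : n.+1%:R * s = 2 * t + s by rewrite -natr1 mulrDl mul1r sn.
rewrite sn sn1 mul0r ler_pdivlMr// => H.
apply: le_trans H; rewrite mulrAC -sn.
by rewrite (_ : s^-1 * (n%:R * s) = n%:R)// mulrCA mulVf ?mulr1// gt_eqF.
Qed.

(** The integrand is [P t] applied to [(u y - u x)^2] in [y], expanded; [S 1 = 1] almost everywhere
    removes the killing term. It allows pointwise bounds on increments. *)
Lemma sg_form_dirichlet t u : 0 <= t -> bint m u ->
  sg_form t u u = (2 * t)^-1 *
   \int[m]_x (P t (fun y => u y ^+ 2) x - 2 * u x * P t u x + u x ^+ 2 * P t (cst 1) x).
Proof.
move=> t0 bu; have mS := ms_op mP t0.
have bu2 := bintX 1 bu; have bPu := mo_bint mS bu.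
have b1 := mo_bmeas mS (bmeas_cst 1).
have bX : bint m (fun x => 2 * (u x * P t u x)) by exact/bintZ/bintM.
have E x : P t (fun y => u y ^+ 2) x - 2 * u x * P t u x + u x ^+ 2 * P t (cst 1) x
   = P t (fun y => u y ^+ 2) x - 2 * (u x * P t u x) + u x ^+ 2 * P t (cst 1) x.
  by ring.
under eq_Rintegral do rewrite E.
rewrite RintD; [|apply: bintB => //; exact: mo_bint|exact: bintMr].
rewrite RintB//; last exact: mo_bint.
rewrite (mo_ae_one mS) ?(mo_int mS)//; last exact: ibm.
rewrite RintZ; last exact: bintM.
rewrite sg_formE// sg_corr0// /sg_corr invfM.
have -> : \int[m]_x (u x * P t u x) = \int[m]_x (P t u x * u x).
  by apply: eq_Rintegral => x _; rewrite mulrC.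
by lra.
Qed.

Lemma sg_form_mul_le t (c : R) u k : 0 < t -> bint m u -> bint m k ->
  (forall x, `|u x| <= c) -> (forall x, `|k x| <= c) ->
  sg_form t (fun x => u x * k x) (fun x => u x * k x) <=
  2 * c ^+ 2 * sg_form t u u + 2 * c ^+ 2 * sg_form t k k.
Proof.
move=> t0 bu bk uc kc; have mS := ms_op mP (ltW t0).
have buk := bintM bu bk.
have bF v : bint m v -> bint m (fun x => P t (fun y => v y ^+ 2) x - 2 * v x * P t v x + v x ^+ 2 * P t (cst 1) x).
  move=> bv; have b1 := mo_bmeas mS (bmeas_cst 1).
  apply: bintD; last by apply: bintMr => //; exact: bintX.
  apply: bintB; first exact/(mo_bint mS)/bintX.
  by apply: bintM; [exact: bintZ|exact: mo_bint].
rewrite !sg_form_dirichlet ?(ltW t0)// !(mulrCA _ (2 * t)^-1) -mulrDr.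
rewrite ler_wpM2l ?invr_ge0 ?mulr_ge0 ?(ltW t0)//.
rewrite -(RintZ (2 * c ^+ 2) (bF _ bu)) -(RintZ (2 * c ^+ 2) (bF _ bk)).
rewrite -(RintD (bintZ _ (bF _ bu)) (bintZ _ (bF _ bk))).
apply: Rint_le; [exact: bF|by apply: bintD; exact/bintZ/bF|].
move=> x.
have F v : bmeas v -> P t (fun y => (v y - v x) ^+ 2) x =
    P t (fun y => v y ^+ 2) x - 2 * v x * P t v x + v x ^+ 2 * P t (cst 1) x.
  move=> bv.
  have -> : (fun y => (v y - v x) ^+ 2) = (fun y => (v y ^+ 2 - (2 * v x) * v y) + cst (v x ^+ 2) y).
    by apply/funext => y /=; ring.
  have bv2 := bmeasX 2 bv; have bvx := bmeasZ (2 * v x) bv.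
  rewrite (moD mS (bmeasB bv2 bvx) (bmeas_cst _)) (moB mS bv2 bvx) (moZ mS _ bv).
  by rewrite (mo_cst mS).
rewrite -!F; [|exact: ibm|exact: ibm|exact: ibm].
have bD v : bmeas v -> bmeas (fun y => (v y - v x) ^+ 2).
  by move=> bv; apply: bmeasX; apply: bmeasB => //; exact: bmeas_cst.
have bDu := bD _ (ibm bu); have bDk := bD _ (ibm bk).
have := mo_le mS (bD _ (ibm buk)) (bmeasD (bmeasZ (2 * c ^+ 2) bDu) (bmeasZ (2 * c ^+ 2) bDk)).
rewrite (moD mS (bmeasZ _ bDu) (bmeasZ _ bDk)) (moZ mS _ bDu) (moZ mS _ bDk).
apply => y.
have sq a b : `|a| <= c -> (a * b) ^+ 2 <= c ^+ 2 * b ^+ 2.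
  move=> ac; rewrite exprMn ler_wpM2r ?sqr_ge0// -(real_normK (num_real a)).
  by rewrite lerXn2r// nnegrE (le_trans _ ac).
have := sq _ (u y - u x) (kc y); have := sq _ (k y - k x) (uc x).
have := sqr_ge0 (k y * (u y - u x) - u x * (k y - k x)).
have -> : u y * k y - u x * k x = k y * (u y - u x) + u x * (k y - k x) by ring.
lra.
Qed.

(** Both approximating forms on the right have the same limit on the domain, so the squared [L^2]
    defect is [o(s)]. *)
Lemma sg_defect s u : 0 < s -> bint m u ->
  s^-1 * \int[m]_x (P s u x - u x) ^+ 2 = 2 * sg_form s u u - 2 * sg_form (2 * s) u u.
Proof.
move=> s0 bu; have bPu := ms_bint mP (ltW s0) bu.
rewrite !sg_formE ?mulr_ge0 ?(ltW s0)//.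
have E x : (P s u x - u x) ^+ 2 = P s u x ^+ 2 - 2 * (P s u x * u x) + u x ^+ 2 by ring.
under eq_Rintegral do rewrite E.
have bM := bintM bPu bu.
rewrite RintD; [|by apply: bintB; [exact: bintX|exact: bintZ]|exact: bintX].
rewrite RintB; [|exact: bintX|exact: bintZ].
rewrite RintZ// -/(sg_corr s u) -(sg_corr0 bu).
have -> : \int[m]_x P s u x ^+ 2 = sg_corr (2 * s) u.
  by rewrite sg_corr_half ?mulr_ge0 ?ltW// mulrAC divff// mul1r.
by field; rewrite gt_eqF.
Qed.

Lemma sg_var_form s u k : 0 < s -> bint m u -> bint m k ->
  s^-1 * \int[m]_x (mo_var (P s) u x * k x) =
  2 * sg_form s u (fun x => u x * k x) - sg_form s (fun x => u x ^+ 2) k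
  - s^-1 * \int[m]_x ((P s u x - u x) ^+ 2 * k x).
Proof.
move=> s0 bu bk; have bPu := ms_bint mP (ltW s0) bu.
have bu2 := bintX 1 bu; have bPu2 := ms_bint mP (ltW s0) bu2.
rewrite /sg_form mulrCA -!mulrBr; congr (_ * _).
have b1 : bint m (fun x => (u x - P s u x) * (u x * k x)).
  by apply: bintM; [exact: bintB|exact: bintM].
have b2 : bint m (fun x => (u x ^+ 2 - P s (fun y => u y ^+ 2) x) * k x).
  by apply: bintM => //; exact: bintB.
have b3 : bint m (fun x => (P s u x - u x) ^+ 2 * k x).
  by apply: bintM => //; apply: bintX; exact: bintB.
rewrite -RintZ// -RintB//; last exact: bintZ.
rewrite -RintB//; last by apply: bintB => //; exact: bintZ.
by apply: eq_Rintegral => x _; rewrite /mo_var; ring.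
Qed.

Section domain.
Variables (D : set (T -> R)) (Q : (T -> R) -> (T -> R) -> R).
Hypothesis DE : forall u, bint m u -> D u <-> cvg (sg_form t u u @[t --> 0^'+]).
Hypothesis QE : forall u v, D u -> D v -> bint m u ->
  sg_form t u v @[t --> 0^'+] --> Q u v.

Lemma dom_smooth t f : 0 < t -> bint m f -> D (P t f).
Proof.
move=> t0 bf; apply/DE; last exact: sg_form_smooth.
by apply: ms_bint => //; exact: ltW.
Qed.

Lemma sg_form_le_lim s u : 0 < s -> bint m u -> D u -> sg_form s u u <= Q u u.
Proof.
move=> s0 bu Du; have c := QE Du Du bu.
rewrite -(cvg_lim (@Rhausdorff R) c); apply: limr_ge; first by apply/cvg_ex; exists (Q u u).
near=> t; apply: sg_form_nonincreasing => //.
by near: t; exact: nbhs_right_le.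
Unshelve. all: by end_near. Qed.

(** [sg_form_mul_le] bounds the approximating forms of the product uniformly in time. *)
Lemma dom_mul u k : bint m u -> bint m k -> D u -> D k -> D (fun x => u x * k x).
Proof.
move=> bu bk Du Dk; have [[_ [a ua]] _] := bu; have [[_ [b kb]] _] := bk.
apply/DE; first exact: bintM.
pose c := Num.max a b.
apply: (@sg_form_cvg _ (2 * c ^+ 2 * Q u u + 2 * c ^+ 2 * Q k k)); first exact: bintM.
move=> e e0; exists e; first by rewrite e0 lexx.
apply: (@le_trans _ _ (2 * c ^+ 2 * sg_form e u u + 2 * c ^+ 2 * sg_form e k k)).
  apply: sg_form_mul_le => // x; rewrite /c le_max ?ua// kb orbT//.
have c0 : 0 <= 2 * c ^+ 2 by rewrite mulr_ge0// sqr_ge0.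
by apply: lerD; rewrite ler_wpM2l//; exact: sg_form_le_lim.
Qed.

Lemma dom_sqr u : bint m u -> D u -> D (fun x => u x ^+ 2).
Proof. by move=> bu Du; under eq_fun do rewrite expr2; exact: dom_mul. Qed.

Lemma sg_defect_cvg u : bint m u -> D u ->
  s^-1 * \int[m]_x (P s u x - u x) ^+ 2 @[s --> 0^'+] --> (0 : R).
Proof.
move=> bu Du; have c := QE Du Du bu.
have c2 : sg_form (2 * t) u u @[t --> 0^'+] --> Q u u.
  apply: cvg_comp c => A [e /= e0 eA]; exists (e / 2) => /=; first by rewrite divr_gt0.
  move=> t /=; rewrite sub0r normrN => te t0; apply: eA; last by rewrite mulr_gt0.
  rewrite /= sub0r normrN gtr0_norm ?mulr_gt0//.
  by move: te; rewrite gtr0_norm// ltr_pdivlMr// mulrC.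
have : 2 * sg_form s u u - 2 * sg_form (2 * s) u u @[s --> 0^'+] --> 2 * Q u u - 2 * Q u u.
  by apply: cvgB; apply: cvgMr.
rewrite subrr; apply: cvg_trans; apply: near_eq_cvg; near=> s.
by rewrite sg_defect.
Unshelve. all: by end_near. Qed.

(** In [sg_var_form] the first two terms converge by definition of [Q], and the last is dominated by
    the bound of [k] times the vanishing defect. *)
Lemma sg_var_cvg u k : bint m u -> bint m k -> D u -> D k ->
  s^-1 * \int[m]_x (mo_var (P s) u x * k x) @[s --> 0^'+] -->
    2 * Q u (fun x => u x * k x) - Q (fun x => u x ^+ 2) k.
Proof.
move=> bu bk Du Dk; have [[_ [c kc]] _] := bk.
have Duk := dom_mul bu bk Du Dk; have Duu := dom_sqr bu Du.
have c1 := QE Du Duk bu; have c2 := QE Duu Dk (bintX 1 bu).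
have c3 : s^-1 * \int[m]_x ((P s u x - u x) ^+ 2 * k x) @[s --> 0^'+] --> (0 : R).
  apply: norm_cvg0.
  have h2 : c * (s^-1 * \int[m]_x (P s u x - u x) ^+ 2) @[s --> 0^'+] --> (0 : R).
    by rewrite -[X in _ --> X](mulr0 c); apply: cvgMr; exact: sg_defect_cvg.
  apply: squeeze_cvgr (cvg_cst 0) h2; near=> s.
  have s0 : 0 < s by [].
  have bd : bint m (fun x => (P s u x - u x) ^+ 2).
    by apply: bintX; apply: bintB => //; apply: ms_bint => //; exact: ltW.
  rewrite normr_ge0/= normrM gtr0_norm ?invr_gt0// mulrCA ler_wpM2l ?invr_ge0 ?(ltW s0)//.
  rewrite -RintZ// ler_norml; apply/andP; split.
    rewrite -[leLHS]mulN1r -RintZ; last exact: bintZ.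
    apply: Rint_le; [exact/bintZ/bintZ|exact: bintM|] => x.
    have := kc x; rewrite ler_norml => /andP[k1 _].
    by have := sqr_ge0 (P s u x - u x); nra.
  apply: Rint_le; [exact: bintM|exact: bintZ|] => x.
  have := kc x; rewrite ler_norml => /andP[_ k1].
  by have := sqr_ge0 (P s u x - u x); nra.
rewrite -[X in _ --> X]subr0.
have : 2 * sg_form s u (fun x => u x * k x) - sg_form s (fun x => u x ^+ 2) k
  - s^-1 * \int[m]_x ((P s u x - u x) ^+ 2 * k x) @[s --> 0^'+] -->
    2 * Q u (fun x => u x * k x) - Q (fun x => u x ^+ 2) k - 0.
  by apply: cvgB => //; apply: cvgB => //; exact: cvgMr.
apply: cvg_trans; apply: near_eq_cvg; near=> s.
by rewrite sg_var_form.
Unshelve. all: by end_near. Qed.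

End domain.
End semigroup_forms.

(** * The semigroup of a Hunt process *)

Section metric_topology.
Context {R : realType} {E : pmetricType R}.
Implicit Types (x y : E) (U : set E).

Definition cball (c : E) (rho : R) : set E := [set y | mdist c y <= rho].

Lemma mdist_continuous (c : E) : continuous (mdist c : E -> R).
Proof.
move=> x; apply/cvgrPdist_lt => e e0; apply/nbhs_ballP; exists e => //= y.
rewrite ballEmdist /= => xy.
rewrite ltr_norml; apply/andP; split.
  have := metric_triangle c x y; lra.
have := metric_triangle c y x; rewrite (metric_sym y x); lra.
Qed.

Lemma closed_cball (c : E) rho : closed (cball c rho).
Proof.
rewrite (_ : cball c rho = mdist c @^-1` [set r | r <= rho])//.
apply: closed_comp; last exact: closed_le.
by move=> x _; exact: mdist_continuous.
Qed.

Definition oball (c : E) (rho : R) : set E := [set y | mdist c y < rho].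

Lemma open_oball c rho : open (oball c rho).
Proof.
by apply: (@open_comp _ _ (mdist c) [set r | r < rho]);
  [move=> y _; exact: mdist_continuous|exact: open_lt].
Qed.

(** Separability and local compactness packed into one sequence of balls; it yields
    sigma-finiteness, the rectangles off the diagonal and the measurability of paths. *)
Definition ball_basis (c : nat -> E) (rho : nat -> R) := [/\ forall i, 0 < rho i,
  forall i, compact (cball (c i) (rho i)) &
  forall U x, open U -> U x ->
    exists i, mdist (c i) x < rho i /\ cball (c i) (rho i) `<=` U].

(** Such a ball stays within [2e] of [x], so one [e] serves all centres near [x], in particular
    those of a dense set. *)
Lemma locally_compact_ball U x : locally_compact [set: E] -> open U -> U x ->
  exists2 e : R, 0 < e & forall c rho, mdist c x < rho -> rho <= e ->
    compact (cball c rho) /\ cball c rho `<=` U.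
Proof.
move=> lcE oU Ux; have [K xK [cK clK]] := lcE x I.
have : nbhs x (U `&` K).
  apply: filterI; first exact: open_nbhs_nbhs.
  have xK' : nbhs x [set y | setT y -> K y] := xK.
  by apply: filterS xK' => y; exact.
move=> /nbhs_ballP[e /= e0 eUK]; exists (e / 2); first by rewrite divr_gt0.
move=> c rho cx rhoe.
have sub : cball c rho `<=` U `&` K.
  move=> y cy; apply: eUK; rewrite ballEmdist /=.
  have := metric_triangle x c y; rewrite (metric_sym x c).
  move: cy; rewrite /cball /=; lra.
split; last by move=> y /sub [].
apply: subclosed_compact cK _; first exact: closed_cball.
by move=> y /sub [].
Qed.

Lemma ball_basis_exists : locally_compact [set: E] -> separable E ->
  exists c rho, ball_basis c rho.
Proof.
move=> lcE [S /countable_injP[f finj] dS].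
pose s n : E := xget point [set x | S x /\ f x = n].
have sf x : S x -> s (f x) = x.
  move=> Sx; rewrite /s; case: xgetP => [y _ [Sy fyx]|/(_ x)[]//].
  by apply: finj => //; rewrite inE.
have [e0 e00 H0] := locally_compact_ball lcE openT (I : [set: E] point).
pose good (ab : nat * nat) := compact (cball (s ab.1) ab.2.+1%:R^-1).
(* Codes that give no compact ball are sent to one fixed compact ball, so that every index
   qualifies. *)
pose cr i : E * R := if unpickle i is Some ab then
  if `[< good ab >] then (s ab.1, ab.2.+1%:R^-1) else (point, e0) else (point, e0).
have dflt : 0 < e0 /\ compact (cball point e0).
  by split=> //; have [] := H0 point e0; rewrite ?mdistxx.
exists (fun i => (cr i).1), (fun i => (cr i).2); split.
- by move=> i; rewrite /cr; case: unpickle => [ab|]; [case: asboolP|]; case: dflt => //=.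
- by move=> i; rewrite /cr; case: unpickle => [ab|]; [case: asboolP|]; case: dflt.
- move=> U x oU Ux; have [e ep He] := locally_compact_ball lcE oU Ux.
  pose b := Num.truncn e^-1.
  have b0 : 0 < b.+1%:R^-1 :> R by rewrite invr_gt0.
  have be : b.+1%:R^-1 <= e.
    by rewrite -[leRHS]invrK lef_pV2 ?posrE ?invr_gt0// ltW// truncnS_gt.
  have [] := dS (ball x b.+1%:R^-1).
  + by exists x; exact: ballxx.
  + by rewrite ballEmdist; exact: open_oball.
  move=> c [xc Sc]; move: xc; rewrite ballEmdist /= metric_sym => cx.
  have [K1 K2] := He c _ cx be.
  exists (pickle (f c, b)); rewrite /cr pickleK.
  have -> : `[< good (f c, b) >] by apply/asboolP; rewrite /good /= sf.
  by rewrite /= sf.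
Qed.

Lemma measurable_cball c rho : measurable (cball c rho : set (borel E)).
Proof.
rewrite -[cball _ _]setCK; apply: measurableC; apply: sub_sigma_algebra.
exact/closed_openC/closed_cball.
Qed.

Lemma measurable_borel_set1 (x : E) : measurable ([set x] : set (borel E)).
Proof.
rewrite -[[set x]]setCK; apply: measurableC; apply: sub_sigma_algebra.
apply: closed_openC; apply: compact_closed; first exact: metric_hausdorff.
exact: compact_set1.
Qed.

Lemma ball_basis_bigcup c rho U : ball_basis c rho -> open U ->
  U = \bigcup_(i in [set i | cball (c i) (rho i) `<=` U]) oball (c i) (rho i).
Proof.
move=> [_ _ H] oU; apply/seteqP; split.
  by move=> x Ux; have [i [i1 i2]] := H U x oU Ux; exists i.
by move=> x [i /= iU] xi; apply: iU; exact: ltW.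
Qed.

Lemma ball_basis_cover c rho : ball_basis c rho ->
  \bigcup_i cball (c i) (rho i) = [set: E].
Proof.
move=> [_ _ H]; apply/seteqP; split=> // x _.
have [i [i1 _]] := H setT x openT I.
by exists i => //; exact: ltW.
Qed.

(** Balls inside those of radius [d(x,y)/2] about [x] and [y] are disjoint. The rectangles put
    [off_diag] into the product sigma-algebra, and by compactness [J] is finite on each. *)
Lemma off_diag_rectangles c rho : ball_basis c rho ->
  exists A B : nat -> set (borel E), [/\
    forall n, measurable (A n) /\ compact (A n : set E),
    forall n, measurable (B n) /\ compact (B n : set E) &
    off_diag = \bigcup_n (A n `*` B n)].
Proof.
move=> bb; have [rho0 cK H] := bb.
pose K i := cball (c i) (rho i).
(* Invalid codes and pairs of balls that meet give the empty rectangle. *)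
pose ij n := if unpickle n is Some (i, j) then
  if `[< K i `&` K j = set0 >] then (K i, K j) else (set0, set0) else (set0, set0).
have ijP n : (measurable ((ij n).1 : set (borel E)) /\ compact (ij n).1) /\
    (measurable ((ij n).2 : set (borel E)) /\ compact (ij n).2).
  rewrite /ij; case: unpickle => [[i j]|]; last by split; split; [exact: measurable0|exact: compact0|exact: measurable0|exact: compact0].
  case: ifP => _ /=; last by split; split; [exact: measurable0|exact: compact0|exact: measurable0|exact: compact0].
  by split; split; [exact: measurable_cball|exact: cK|exact: measurable_cball|exact: cK].
exists (fun n => (ij n).1), (fun n => (ij n).2); split.
- by move=> n; case: (ijP n).
- by move=> n; case: (ijP n).
apply/seteqP; split => [[x y] /= xy|[x y] [n _] []].
  have d0 : 0 < mdist x y / 2 by rewrite divr_gt0// mdist_gt0; apply/eqP.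
  have [i [i1 i2]] := H _ x (open_oball x (mdist x y / 2)) ltac:(by rewrite /oball /= mdistxx).
  have [j [j1 j2]] := H _ y (open_oball y (mdist x y / 2)) ltac:(by rewrite /oball /= mdistxx).
  exists (pickle (i, j)) => //; rewrite /ij pickleK.
  have -> : `[< K i `&` K j = set0 >].
    apply/asboolP; rewrite -subset0 => w [/i2 + /j2]; rewrite /oball /=.
    by have := metric_triangle x w y; rewrite (metric_sym w y); lra.
  by split=> /=; exact: ltW.
rewrite /ij; case: unpickle => [[i j]|//]; case: asboolP => //= KK Kx Ky; rewrite /off_diag /= => xy.
by move: KK; rewrite -subset0 => /(_ x); apply; split=> //; rewrite xy.
Qed.

Lemma radon_sigma_finite (m : {measure set (borel E) -> \bar R}) :
  locally_compact [set: E] -> separable E -> radon m -> sigma_finite setT m.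
Proof.
move=> lcE sE [mK _]; have [c [rho bb]] := ball_basis_exists lcE sE.
have [_ cK _] := bb.
exists (fun i => cball (c i) (rho i)); first by rewrite (ball_basis_cover bb).
by move=> i; split; [exact: measurable_cball|apply: mK => //; exact: measurable_cball].
Qed.

End metric_topology.

Section compactification.
Context {R : realType} {E : pmetricType R}.

Lemma measurable_Some : measurable_fun [set: borel E] (Some : borel E -> borel E^Delta).
Proof.
apply: (@measurability _ _ (borel E) (borel E^Delta) setT Some (@open E^Delta)) => //.
move=> _ [U oU <-]; rewrite setTI; apply: sub_sigma_algebra.
rewrite /= (_ : _ @^-1` _ = (Some : E -> E^Delta) @^-1` U)//.
apply: open_comp oU => x _; exact: one_point_compactification_some_continuous.
Qed.

Lemma measurable_image_Some (B : set (borel E)) : measurable B ->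
  measurable (Some @` B : set (borel E^Delta)).
Proof.
have oS (U : set E) : open U -> measurable (Some @` U : set (borel E^Delta)).
  by move=> oU; apply: sub_sigma_algebra; exact: one_point_compactification_open_some.
move: B; apply: smallest_sub; [|by move=> U oU; exact: oS].
split=> [|B mB|F mF].
- by rewrite /= image_set0.
- rewrite /= setTD (_ : Some @` (~` B) = (Some @` setT) `\` (Some @` B)).
    by apply: measurableD => //; exact: (oS setT openT).
  apply/seteqP; split=> [_ [x nBx <-]|_ [[x _ <-] nBx]].
    by split; [exists x|case=> y By [yx]; apply: nBx; rewrite -yx].
  by exists x => // Bx; apply: nBx; exists x.
- by rewrite /= image_bigcup; exact: bigcup_measurable.
Qed.

Lemma measurable_ext d' (T' : measurableType d') (z0 : T') (g : borel E -> T') :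
  measurable_fun setT g ->
  measurable_fun [set: borel E^Delta] (oapp g z0 : borel E^Delta -> T').
Proof.
move=> mg _ B mB; rewrite setTI.
have mgB : measurable (g @^-1` B) by rewrite -[_ @^-1` _]setTI; exact: mg.
have mN : measurable ([set None] : set (borel E^Delta)).
  rewrite (_ : [set None] = ~` (Some @` setT)).
    by apply: measurableC; exact: measurable_image_Some.
  apply/seteqP; split=> [_ -> [x _]//|[x|//]].
  by move=> /= nx; exfalso; apply: nx; exists x.
have [Bz|nBz] := pselect (B z0).
  rewrite (_ : _ @^-1` _ = Some @` (g @^-1` B) `|` [set None]).
    by apply: measurableU => //; exact: measurable_image_Some.
  apply/seteqP; split=> [[x|]/=|_ [[x Bx <-//]|->//]]; last by right.
  by move=> Bx; left; exists x.
rewrite (_ : _ @^-1` _ = Some @` (g @^-1` B)).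
  exact: measurable_image_Some.
apply/seteqP; split=> [[x|//]/= Bx|_ [x Bx <-//]].
by exists x.
Qed.

Lemma ext_continuous (phi : E -> R) (K : set E) : continuous phi ->
  compact K -> closed K -> (forall x, ~ K x -> phi x = 0) ->
  continuous (oapp phi 0 : E^Delta -> R).
Proof.
move=> cphi cK clK phi0 [x|].
  by move=> A /cphi; rewrite /= nbhs_simpl.
move=> A A0; exists K; first by split.
move=> _ [[y Ky <-]|->] /=; last exact: nbhs_singleton.
by rewrite phi0//; exact: nbhs_singleton.
Qed.

End compactification.

(** * Joint measurability of the paths in time and chance *)

Section process_measurability.
Context {R : realType} {E : pmetricType R} {d : measure_display}
  {Omega : measurableType d}.
Variable P : R.-pker borel E^Delta ~> Omega.
Variable X : R -> Omega -> borel E^Delta.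
Hypothesis hX : hunt_process P X.

(** The first grid time strictly after [t]: the filter [t^'+] only sees times beyond [t]. *)
Let tn (n : nat) (t : R) : R := (Num.truncn (t * n.+1%:R)).+1%:R / n.+1%:R.

Let tn_gt n (t : R) : 0 <= t -> t < tn n t.
Proof. by move=> t0; rewrite ltr_pdivlMr// truncnS_gt. Qed.

Let tn_le n (t : R) : 0 <= t -> tn n t <= t + n.+1%:R^-1.
Proof.
move=> t0; rewrite ler_pdivrMr// mulrDl mulVf// -natr1 lerD2r.
by have /andP[] := @truncn_itv R (t * n.+1%:R) ltac:(by rewrite mulr_ge0).
Qed.

Let tn_cvg (t : R) : 0 <= t -> (fun n => tn n t) @ \oo --> t^'+.
Proof.
move=> t0 A [e /= e0 eA].
suff: \forall n \near \oo, A (tn n t) by [].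
near=> n.
have h : ball_ Num.norm t e (tn n t).
  rewrite /ball_ /= ltr0_norm ?subr_lt0 ?tn_gt// opprB ltrBlDl.
  rewrite (le_lt_trans (tn_le n t0))// ltrD2l.
  by near: n; exact: near_infty_natSinv_lt (PosNum e0).
exact: (eA _ h (tn_gt n t0)).
Unshelve. all: by end_near. Qed.

(** By right continuity the path is the limit of its values at grid times, and testing against [phi]
    reduces the matter to limits of real functions. Vanishing off [K] makes [phi] continuous at the
    point at infinity. *)
Let ext_path_measurable (phi : E -> R) K : continuous phi -> compact K ->
  closed K -> (forall x, ~ K x -> phi x = 0) ->
  measurable_fun [set: R * Omega]
    (fun z => oapp phi 0 (X (Num.max z.1 0) z.2 : E^Delta)).
Proof.
move=> cphi cK clK phi0.
have mphi : measurable_fun [set: borel E] (phi : borel E -> R).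
  apply: (measurability (@RGenOInfty.G R)); first exact: RGenOInfty.measurableE.
  move=> _ [_ [a ->] <-]; rewrite setTI; apply: sub_sigma_algebra.
  rewrite /= set_itvE; apply: (@open_comp _ _ phi [set r | a < r]).
    by move=> x _; exact: cphi.
  exact: open_gt.
have mext := measurable_ext (0 : R) mphi.
apply: (@measurable_fun_cvg _ (R * Omega)%type R setT
  (fun n (z : R * Omega) => oapp phi 0 (X (tn n (Num.max z.1 0)) z.2))); last first.
  move=> [t w] _ /=; set t' := Num.max t 0.
  have t'0 : 0 <= t' by rewrite /t' le_max lexx orbT.
  have c1 : (X s w : E^Delta) @[s --> t'^'+] --> (X t' w : E^Delta).
    exact: (hunt_right_cont hX).
  have c2 : oapp phi 0 e @[e --> (X t' w : E^Delta)] --> oapp phi 0 (X t' w).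
    exact: (ext_continuous cphi cK clK phi0).
  exact: (cvg_comp _ _ (cvg_comp _ _ (tn_cvg t'0) c1) c2).
move=> n.
(* On this strip the grid time is the constant [(k+1)/(n+1)]. *)
pose D k : set (R * Omega) := (fun z => Num.max z.1 0 * n.+1%:R) @^-1` `[k%:R, k.+1%:R[%classic.
have DT : \bigcup_k D k = setT.
  apply/seteqP; split=> // z _; exists (Num.truncn (Num.max z.1 0 * n.+1%:R)) => //.
  rewrite /D /= in_itv /=; apply: truncn_itv.
  by rewrite mulr_ge0// le_max lexx orbT.
have mD k : measurable (D k).
  rewrite -[D k]setTI; apply: measurable_funM => //.
  exact: measurable_maxr.
rewrite -DT; apply/measurable_fun_bigcup => // k.
apply: (@eq_measurable_fun _ _ _ _ _ (fun z => oapp phi 0 (X (k.+1%:R / n.+1%:R) z.2))).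
  move=> z /[!inE]; rewrite /D /= in_itv /= => zk.
  by rewrite /tn (truncn_def zk).
apply: measurable_funTS.
apply: (measurableT_comp mext); apply: (measurableT_comp _ measurable_snd).
by apply: (hunt_measurable hX); rewrite divr_ge0.
Qed.

Hypotheses (lcE : locally_compact [set: E]) (sE : separable E).

Definition path_map (z : R * Omega) : borel E^Delta := X (Num.max z.1 0) z.2.

(** An open ball of the basis is where the tent [max (rho - d(c, x)) 0] is positive; open sets are
    countable unions of such balls. *)
Lemma measurable_path_Some (B : set (borel E)) : measurable B ->
  measurable (path_map @^-1` (Some @` B)).
Proof.
have [c [rho bb]] := ball_basis_exists lcE sE; have [_ cK _] := bb.
have mS i : measurable (path_map @^-1` (Some @` oball (c i) (rho i))).
  pose phi (x : E) : R := Num.max (rho i - mdist (c i) x) 0.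
  have cphi : continuous phi.
    move=> x; apply: (@continuous_max _ _ (fun y => rho i - mdist (c i) y) (fun=> 0)); last exact: cvg_cst.
    by apply: cvgB; [exact: cvg_cst|exact: mdist_continuous].
  have phi0 x : ~ cball (c i) (rho i) x -> phi x = 0.
    move=> /negP; rewrite -ltNge => h; rewrite /phi; apply/max_idPr.
    by rewrite subr_le0 ltW.
  have := ext_path_measurable cphi (cK i) (@closed_cball _ _ _ _) phi0.
  move=> /(_ measurableT _ (measurable_itv `]0, +oo[)); rewrite setTI.
  congr (measurable _); apply/seteqP; split => z; rewrite /path_map /=.
    case: (X _ _) => [x|]/=; rewrite in_itv/= andbT ?ltxx// /phi lt_max ltxx orbF subr_gt0.
    by move=> h; exists x.
  by move=> [x xi <-] /=; rewrite in_itv/= andbT /phi lt_max subr_gt0; apply/orP; left.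
have mSU (U : set E) : open U -> measurable (path_map @^-1` (Some @` U)).
  move=> oU; rewrite (ball_basis_bigcup bb oU) image_bigcup preimage_bigcup.
  by apply: bigcup_measurable => i _; exact: mS.
move: B; apply: smallest_sub; [|by move=> U oU; exact: mSU].
split=> [|B mB|F mF].
- by rewrite /= image_set0 preimage_set0.
- rewrite /= setTD (_ : Some @` (~` B) = (Some @` setT) `\` (Some @` B)).
    by rewrite setDE preimage_setI preimage_setC; apply: measurableI; [exact: (mSU setT openT)|exact: measurableC].
  apply/seteqP; split=> [_ [x nBx <-]|_ [[x _ <-] nBx]].
    by split; [exists x|case=> y By [yx]; apply: nBx; rewrite -yx].
  by exists x => // Bx; apply: nBx; exists x.
- by rewrite /= image_bigcup preimage_bigcup; exact: bigcup_measurable.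
Qed.

Lemma measurable_path_map : measurable_fun setT path_map.
Proof.
move=> _ A mA; rewrite setTI.
pose B : set (borel E) := Some @^-1` A.
have mB : measurable B.
  by rewrite /B -[_ @^-1` _]setTI; exact: measurable_Some.
have mSB := measurable_path_Some mB.
have mN : measurable (path_map @^-1` [set None]).
  rewrite (_ : [set None] = ~` (Some @` setT)).
    rewrite preimage_setC; apply: measurableC; exact: measurable_path_Some.
  apply/seteqP; split=> [_ -> [x _]//|[x|//]].
  by move=> /= nx; exfalso; apply: nx; exists x.
have [AN|nAN] := pselect (A None).
  rewrite (_ : A = (Some @` B) `|` [set None]); first by rewrite preimage_setU; exact: measurableU.
  apply/seteqP; split=> [[x|]|_ [[x Bx <-//]|->//]]; last by right.
  by move=> Ax; left; exists x.
rewrite (_ : A = (Some @` B))//.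
by apply/seteqP; split=> [[x|//]|_ [x Bx <-//]] Ax; exists x.
Qed.

End process_measurability.

Lemma measurable_fun_mem {d} {T : measurableType d} (A : set T) :
  measurable A -> measurable_fun setT (fun x => x \in A).
Proof.
move=> mA; apply: (measurable_fun_bool true); rewrite setTI (_ : _ @^-1` _ = A)//.
by apply/seteqP; split => x /= h; [exact: set_mem|exact: mem_set].
Qed.

Section nonnegative_induction.
Context {d} {T : measurableType d} {R : realType}.
Local Open Scope ereal_scope.
Import HBNNSimple.

(** The monotone class argument, for identities whose two sides are additive and continuous along
    increasing sequences. *)
Lemma ge0_measurable_ind (C : (T -> \bar R) -> Prop) :
  (forall A, measurable A -> C (fun x => (\1_A x)%:E)) ->
  (forall (c : R) f, (0 <= c)%R -> measurable_fun setT f -> (forall x, 0 <= f x) ->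
     C f -> C (fun x => c%:E * f x)) ->
  (forall f g, measurable_fun setT f -> measurable_fun setT g ->
     (forall x, 0 <= f x) -> (forall x, 0 <= g x) -> C f -> C g -> C (fun x => f x + g x)) ->
  (forall (f_ : nat -> T -> \bar R) f, (forall n, measurable_fun setT (f_ n)) ->
     (forall n x, 0 <= f_ n x) ->
     (forall x, {homo f_ ^~ x : i j / (i <= j)%N >-> i <= j}) ->
     (forall x, f_ ^~ x @ \oo --> f x) ->
     (forall n, C (f_ n)) -> C f) ->
  forall f, measurable_fun setT f -> (forall x, 0 <= f x) -> C f.
Proof.
move=> C1 Cs Cd Cl f mf f0.
have Cfun (h : {nnsfun T >-> R}) : C (EFin \o h).
  have -> : EFin \o h = fun x => \sum_(r <- finmap.enum_fset (fset_set (range h)))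
      (fun r x => r%:E * (\1_(h @^-1` [set r]) x)%:E) r x.
    apply/funext => x /=; rewrite fimfunE fsbig_finite//= sumEFin.
    by congr EFin; apply: eq_bigr => r _; rewrite mulrC.
  have r0 r : r \in finmap.enum_fset (fset_set (range h)) -> (0 <= r)%R.
    by rewrite in_fset_set// inE => -[x _ <-]; exact: fun_ge0.
  have mh r : measurable (h @^-1` [set r]) by exact: measurable_funPTI.
  pose F r x : \bar R := r%:E * (\1_(h @^-1` [set r]) x)%:E.
  have mF r : measurable_fun setT (F r).
    by apply: measurable_funeM; exact/measurable_EFinP.
  have : forall s : seq R, (forall r, r \in s -> (0 <= r)%R) ->
     C (fun x => \sum_(r <- s) F r x); last by apply.
  elim=> [|r s ih] rs.
    rewrite (_ : (fun _ => _) = (fun x => (\1_(set0 : set T) x)%:E)); first exact: C1.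
    by apply/funext => x; rewrite big_nil indicE in_set0.
  rewrite (_ : (fun _ => _) = (fun x => F r x + \sum_(r <- s) F r x)); last first.
    by apply/funext => x; rewrite big_cons.
  have Fr0 q x : (0 <= q)%R -> 0 <= F q x by move=> q0; rewrite mule_ge0// lee_fin.
  apply: Cd => //.
  - by apply: emeasurable_sum => q; exact: mF.
  - by move=> x; apply: Fr0; apply: rs; rewrite mem_head.
  - move=> x; rewrite big_seq; apply: sume_ge0 => q qs; apply: Fr0.
    by apply: rs; rewrite in_cons qs orbT.
  - apply: Cs; [by apply: rs; rewrite mem_head|exact/measurable_EFinP|by move=> x; rewrite lee_fin|exact: C1].
  - by apply: ih => q qs; apply: rs; rewrite in_cons qs orbT.
pose f_ := nnsfun_approx measurableT mf.
apply: (Cl (fun n => EFin \o f_ n) f).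
- by move=> n; exact/measurable_EFinP.
- by move=> n x; rewrite lee_fin.
- by move=> x i j ij; rewrite lee_fin; exact/lefP/nd_nnsfun_approx.
- by move=> x; apply: cvg_nnsfun_approx.
- by move=> n; exact: Cfun.
Qed.

(** Covers functions of unknown measurability such as [Gamma_mod (P_t f)]: the integral of a
    non-negative function is a supremum over simple functions below it. *)
Lemma nonneg_integral_mono (mu : {measure set T -> \bar R}) (D : set T) f g :
  (forall x, D x -> 0 <= f x) -> (forall x, D x -> f x <= g x) ->
  \int[mu]_(x in D) f x <= \int[mu]_(x in D) g x.
Proof.
move=> f0 fg; have g0 x : D x -> 0 <= g x by move=> Dx; exact: le_trans (f0 _ Dx) (fg _ Dx).
rewrite !ge0_integralE//; apply: le_ereal_sup => _ [h /= hf <-].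
exists h => //= x; apply: le_trans (hf x) _.
by rewrite /patch; case: ifPn => // /set_mem Dx; exact: fg.
Qed.

Lemma monotone_cvg_integral (mu : {measure set T -> \bar R}) (D : set T) (u_ : nat -> T -> \bar R) (u : T -> \bar R) :
  measurable D -> (forall n, measurable_fun D (u_ n)) -> (forall n x, D x -> 0 <= u_ n x) ->
  (forall x, D x -> {homo u_ ^~ x : a b / (a <= b)%N >-> a <= b}) ->
  (forall x, D x -> u_ ^~ x @ \oo --> u x) ->
  (fun n => \int[mu]_(x in D) u_ n x) @ \oo --> \int[mu]_(x in D) u x.
Proof.
move=> mD mu_ u0 nd cu.
rewrite (_ : \int[mu]_(x in D) u x = \int[mu]_(x in D) limn (u_^~ x)).
  exact: cvg_monotone_convergence.
by apply: eq_integral => x /set_mem Dx; apply/esym/cvg_lim => //; exact: cu.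
Qed.

End nonnegative_induction.

Section kernel_pullback.
Context {d1 d2 d3} {X : measurableType d1} {Y : measurableType d2}
  {Z : measurableType d3} {R : realType}.
Variables (k : R.-fker X ~> Y) (f : Z -> X) (mf : measurable_fun setT f).

(** The measurability proof is an argument so that kernel structures can be attached to
    [kpull mf]. *)
Definition kpull (_ : measurable_fun setT f) (z : Z) : {measure set Y -> \bar R} := k (f z).

Let kpull_measurable U : measurable U -> measurable_fun setT (kpull mf ^~ U).
Proof. by move=> mU; exact: (measurableT_comp (measurable_kernel k U mU) mf). Qed.

HB.instance Definition _ := isKernel.Build _ _ Z Y R (kpull mf) kpull_measurable.

Let kpull_uub : measure_fam_uub (kpull mf).
Proof. by have [r kr] := measure_uub k; exists r => z; exact: kr. Qed.

HB.instance Definition _ := Kernel_isFinite.Build _ _ Z Y R (kpull mf) kpull_uub.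

Lemma measurable_kpull (g : Z * Y -> \bar R) : (forall z, 0 <= g z)%E ->
  measurable_fun setT g ->
  measurable_fun setT (fun z => \int[k (f z)]_y g (z, y))%E.
Proof.
move=> g0 mg.
exact: (measurable_fun_integral_finite_kernel g (kpull mf : R.-fker Z ~> Y) g0 mg).
Qed.

End kernel_pullback.

Section process_semigroup.
Context {R : realType} {E : pmetricType R} {d : measure_display}
  {Omega : measurableType d}.
Variable P : R.-pker borel E^Delta ~> Omega.
Variable X : R -> Omega -> borel E^Delta.
Hypothesis hX : hunt_process P X.

Lemma pker_setC (x : borel E^Delta) (A : set Omega) : measurable A ->
  P x A = 1%E -> P x (~` A) = 0%E.
Proof.
move=> mA PA; have mC : measurable (~` A) by exact: measurableC.
have : P x setT = (P x A + P x (~` A))%E by rewrite -(setUv A) measureU//; exact: setICr.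
rewrite prob_kernel PA => /esym.
have := measure_ge0 (P x) (~` A).
case: (P x (~` A)) => [y| |]//= y0 /eqP; rewrite -EFinD eqe => /eqP h.
congr EFin; lra.
Qed.

Lemma measurable_ext_path d' (T' : measurableType d') (z0 : T') (g : borel E -> T') t :
  0 <= t -> measurable_fun setT g ->
  measurable_fun setT (fun w => oapp g z0 (X t w)).
Proof.
move=> t0 mg; apply: (measurableT_comp (measurable_ext z0 mg)).
exact: (hunt_measurable hX).
Qed.

Lemma ext_ge0 (g : borel E -> \bar R) e : (forall x, 0 <= g x)%E -> (0 <= oapp g 0 e)%E.
Proof. by move=> g0; case: e => /=. Qed.

Lemma measurable_semigroup_ge0 t (g : borel E -> \bar R) : 0 <= t ->
  measurable_fun setT g -> (forall x, 0 <= g x)%E ->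
  measurable_fun setT (semigroup_ge0 P X t g).
Proof.
move=> t0 mg g0.
apply: (measurable_kpull P measurable_Some (g := fun z => oapp g 0%E (X t z.2))).
  by move=> z; exact: ext_ge0.
by apply: (measurableT_comp (measurable_ext_path _ t0 mg)); exact: measurable_snd.
Qed.

Lemma semigroup_ge0_ge0 t g x : (forall x, 0 <= g x)%E -> (0 <= semigroup_ge0 P X t g x)%E.
Proof. by move=> g0; apply: integral_ge0 => w _; exact: ext_ge0. Qed.

Lemma semigroup_ge0_mono t g h x : (forall x, 0 <= g x)%E ->
  (forall x, g x <= h x)%E -> (semigroup_ge0 P X t g x <= semigroup_ge0 P X t h x)%E.
Proof.
move=> g0 gh; apply: nonneg_integral_mono => w _; first exact: ext_ge0.
by case: (X t w) => /=.
Qed.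

Lemma ext_EFin (f : borel E -> R) (e : borel E^Delta) :
  oapp (EFin \o f) 0%E e = (oapp f 0 e)%:E.
Proof. by case: e. Qed.

Lemma bmeas_ext_path t (f : borel E -> R) : 0 <= t -> bmeas f ->
  bmeas (fun w => oapp f 0 (X t w)).
Proof.
move=> t0 [mf [c fc]]; split; first exact: measurable_ext_path.
exists c => w; case: (X t w) => /= [x|]; first exact: fc.
by rewrite normr0; exact: le_trans (fc point).
Qed.

Lemma bint_pker x (g : Omega -> R) : bmeas g -> bint (P x) g.
Proof.
move=> bg; split=> //; have [mg [c gc]] := bg.
apply: measurable_bounded_integrable => //.
  by rewrite prob_kernel ltry.
exists c; split; first exact: num_real.
by move=> r cr w _ /=; exact: le_trans (gc w) (ltW cr).
Qed.

Lemma bint_ext_path t x (f : borel E -> R) : 0 <= t -> bmeas f ->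
  bint (P x) (fun w => oapp f 0 (X t w)).
Proof. by move=> t0 bf; apply: bint_pker; exact: bmeas_ext_path. Qed.

Lemma Rint_pker_cst x (c : R) : \int[P x]_w (cst c w) = c.
Proof. by rewrite Rintegral_cst// prob_kernel /= mulr1. Qed.

Lemma semigroup_EFin t (f : borel E -> R) x : 0 <= t -> bmeas f ->
  (semigroup P X t f x)%:E = (\int[P (Some x)]_w (oapp f 0 (X t w))%:E)%E.
Proof. by move=> t0 bf; rewrite /semigroup Rint_EFin//; exact: bint_ext_path. Qed.

Lemma semigroup_ge0_EFin t (f : borel E -> R) x : 0 <= t -> bmeas f ->
  semigroup_ge0 P X t (EFin \o f) x = (semigroup P X t f x)%:E.
Proof.
move=> t0 bf; rewrite semigroup_EFin//.
by apply: eq_integral => w _; rewrite ext_EFin.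
Qed.

Lemma semigroup_lin t a (f g : borel E -> R) : 0 <= t -> bmeas f -> bmeas g ->
  semigroup P X t (fun x => a * f x + g x) =
  (fun x => a * semigroup P X t f x + semigroup P X t g x).
Proof.
move=> t0 bf bg; apply/funext => x; rewrite /semigroup.
have b1 := bint_ext_path (Some x) t0 bf; have b2 := bint_ext_path (Some x) t0 bg.
rewrite -RintZ// -RintD//; last exact: bintZ.
by apply: eq_Rintegral => w _; case: (X t w) => //=; rewrite mulr0 addr0.
Qed.

Lemma semigroup_pos t (f : borel E -> R) x : (forall x, 0 <= f x) ->
  0 <= semigroup P X t f x.
Proof. by move=> f0; apply: Rint_ge0 => w; case: (X t w) => /=. Qed.

Lemma semigroup_bmeas t (f : borel E -> R) : 0 <= t -> bmeas f ->
  bmeas (semigroup P X t f).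
Proof.
move=> t0 bf; have [mf [c fc]] := bf.
have b1 : bmeas (fun x => f x + c).
  by apply: bmeasD => //; exact: bmeas_cst.
have f1 x : 0 <= f x + c by have := fc x; rewrite ler_norml => /andP[]; lra.
split.
  have E1 : semigroup P X t f = (fun x => semigroup P X t (fun x => f x + c) x - semigroup P X t (cst c) x).
    have := semigroup_lin (-1) t0 (bmeas_cst c) b1.
    rewrite (_ : (fun x => -1 * _ + _) = f); last by apply/funext => x /=; ring.
    by move=> ->; apply/funext => x; rewrite mulN1r addrC.
  have m1 h : bmeas h -> (forall x, 0 <= h x) -> measurable_fun setT (semigroup P X t h).
    move=> bh h0; apply/measurable_EFinP.
    rewrite (_ : _ \o _ = semigroup_ge0 P X t (EFin \o h)).
      apply: measurable_semigroup_ge0 => //; first by apply/measurable_EFinP; case: bh.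
    by apply/funext => x; rewrite /= semigroup_ge0_EFin.
  rewrite E1; apply: measurable_funB; apply: m1 => //; first exact: bmeas_cst.
  by move=> x /=; exact: le_trans (fc point).
exists c => x.
have bg := bint_ext_path (Some x) t0 bf.
have c0 : 0 <= c by exact: le_trans (fc point).
have bc a : bint (P (Some x)) (cst a) by apply: bint_pker; exact: bmeas_cst.
rewrite ler_norml; apply/andP; split.
  rewrite -[leLHS](Rint_pker_cst (Some x)); apply: Rint_le => // w.
  case: (X t w) => [y|]/=; last by rewrite oppr_le0.
  by have := fc y; rewrite ler_norml => /andP[].
rewrite -[leRHS](Rint_pker_cst (Some x)); apply: Rint_le => // w.
case: (X t w) => [y|]//=.
by have := fc y; rewrite ler_norml => /andP[].
Qed.

Lemma semigroup_le1 t x : 0 <= t -> semigroup P X t (cst 1) x <= 1.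
Proof.
move=> t0; rewrite -[leRHS](Rint_pker_cst (Some x)); apply: Rint_le.
- by apply: bint_ext_path => //; exact: bmeas_cst.
- by apply: bint_pker; exact: bmeas_cst.
by move=> w; case: (X t w) => //=.
Qed.

Lemma semigroup0 (f : borel E -> R) : bmeas f -> semigroup P X 0 f = f.
Proof.
move=> bf; apply/funext => x.
have bg := bmeas_ext_path (lexx 0) bf.
rewrite /semigroup (@Rint_ae _ _ _ _ _ (cst (f x))).
- exact: Rint_pker_cst.
- by case: bg.
- exact: measurable_cst.
have m1 : measurable [set w | X 0 w = Some x].
  rewrite (_ : [set w | _] = X 0 @^-1` (Some @` [set x])).
    rewrite -[_ @^-1` _]setTI; apply: (hunt_measurable hX) => //.
    by apply: measurable_image_Some; exact: measurable_borel_set1.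
  by apply/seteqP; split => w /=; [move=> ->; exists x|case=> y -> <-].
exists (~` [set w | X 0 w = Some x]); split.
- exact: measurableC.
- by apply: pker_setC => //; exact: (hunt_normal hX).
- by move=> w /= h Xw; apply: h; rewrite Xw.
Qed.

(** For indicators this is the strong Markov property at the constant stopping time [s]. The
    functions live on [E^Delta] because [X s w] may be the cemetery. *)
Lemma semigroup_ge0_markov s t (F : borel E^Delta -> \bar R) x : 0 <= s -> 0 <= t ->
  measurable_fun setT F -> (forall e, 0 <= F e)%E ->
  (\int[P x]_w F (X (s + t) w) = \int[P x]_w \int[P (X s w)]_w' F (X t w'))%E.
Proof.
move=> s0 t0.
have mX (H : borel E^Delta -> \bar R) u : measurable_fun setT H -> 0 <= u ->
    measurable_fun setT (H \o X u : Omega -> \bar R).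
  by move=> mH u0; apply: measurableT_comp => //; exact: (hunt_measurable hX).
have mI H : measurable_fun setT H -> (forall e, 0 <= H e)%E ->
    measurable_fun setT (fun w => \int[P (X s w)]_w' H (X t w'))%E.
  move=> mH H0; apply: (measurable_kpull P (hunt_measurable hX s0) (g := fun z => H (X t z.2))) => //.
  by apply: (measurableT_comp (mX H t mH t0)); exact: measurable_snd.
have st0 : 0 <= s + t by rewrite addr_ge0.
move: F; apply: ge0_measurable_ind => [B mB|c F c0 mF F0 ih|F G mF mG F0 G0 ihF ihG|F_ F mF F0 ndF cF ih].
- have [M [adm strong _]] := hunt_filtration hX.
  have sM := adm_sigma adm.
  have MT u : 0 <= u -> M u setT.
    by move=> u0; have [M0 MC _] := sM u u0; rewrite -[setT]setD0; exact: MC.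
  have M0 u : 0 <= u -> M u set0 by move=> u0; have [] := sM u u0.
  have st : stopping_time M (fun=> s%:E).
    split=> [w|u u0]; first by rewrite lee_fin.
    have [su|us] := boolP ((s%:E <= u%:E)%E).
      by rewrite (_ : [set w | _] = setT)//; [exact: MT|apply/seteqP; split].
    rewrite (_ : [set w | _] = set0); first exact: M0.
    by apply/seteqP; split => // w /= h; move: us; rewrite h.
  have sT : stopped_sigma_algebra M (fun=> s%:E) setT.
    by split=> // u u0; rewrite setTI; case: st => _; exact.
  have := strong _ st x t B setT t0 mB sT.
  rewrite (_ : [set w | [/\ setT w, _ & _]] = X (s + t) @^-1` B); last first.
    by apply/seteqP; split => w /=; [case|move=> h; split => //; rewrite ltry].
  rewrite (_ : setT `&` _ = setT); last first.
    by apply/seteqP; split => w //= _; split => //; rewrite ltry.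
  have mpre u : 0 <= u -> measurable (X u @^-1` B).
    by move=> u0; rewrite -[_ @^-1` _]setTI; exact: (hunt_measurable hX).
  move=> H; rewrite (_ : (fun w => (\1_B (X (s + t) w))%:E) = fun w => (\1_(X (s + t) @^-1` B) w)%:E)//.
  rewrite integral_indic// ?setIT; last by apply: mpre; rewrite addr_ge0.
  rewrite H; apply: eq_integral => w _.
  rewrite (_ : (fun w => (\1_B (X t w))%:E) = fun w => (\1_(X t @^-1` B) w)%:E)//.
  by rewrite integral_indic// ?setIT//; exact: mpre.
- rewrite ge0_integralZl_EFin//; last exact: (mX F _ mF st0).
  rewrite ih -ge0_integralZl_EFin//; [|by move=> w _; exact: integral_ge0|exact: mI].
  by apply: eq_integral => w _; rewrite ge0_integralZl_EFin//; exact: (mX F _ mF t0).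
- have eD y u : 0 <= u -> (\int[P y]_w (F (X u w) + G (X u w)) =
      \int[P y]_w F (X u w) + \int[P y]_w G (X u w))%E.
    by move=> u0; apply: ge0_integralD => //; [exact: mX mF u0|exact: mX mG u0].
  rewrite (eD x _ st0) ihF ihG.
  rewrite -(@ge0_integralD _ _ _ (P x) setT measurableT
    (fun w => \int[P (X s w)]_w' F (X t w'))%E (fun w => \int[P (X s w)]_w' G (X t w'))%E
    (fun w _ => integral_ge0 _ (fun w' _ => F0 _)) (mI F mF F0)
    (fun w _ => integral_ge0 _ (fun w' _ => G0 _)) (mI G mG G0)).
  by apply: eq_integral => w _; rewrite -(eD _ _ t0).
- have lim u y : 0 <= u -> ((fun n => \int[P y]_w F_ n (X u w)) @ \oo --> \int[P y]_w F (X u w))%E.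
    move=> u0; exact: (monotone_cvg_integral (mu := P y) (u_ := fun n w => F_ n (X u w)) measurableT
      (fun n => mX _ u (mF n) u0) (fun n w _ => F0 n (X u w)) (fun w _ => ndF (X u w)) (fun w _ => cF (X u w))).
  have c1 := lim _ x st0; rewrite (funext ih) in c1; apply: (cvg_unique (@ereal_hausdorff R) c1).
  apply: (monotone_cvg_integral (mu := P x) (u_ := fun n w => (\int[P (X s w)]_w' F_ n (X t w'))%E)
    (u := fun w => (\int[P (X s w)]_w' F (X t w'))%E) measurableT (fun n => mI _ (mF n) (F0 n))) => [n w _|w _ a b ab|w _].
  - exact: integral_ge0.
  - by apply: nonneg_integral_mono => w' _ //; exact: ndF.
  - exact: lim.
Qed.

Lemma pker_None t (g : Omega -> \bar R) : 0 <= t -> measurable_fun setT g ->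
  (forall w, X t w = None -> g w = 0%E) -> (\int[P None]_w g w = 0)%E.
Proof.
move=> t0 mg g0; rewrite -(integral0 (P None) setT); apply: ae_eq_integral => //.
have m1 : measurable [set w | X t w = None].
  rewrite (_ : [set w | _] = ~` (X t @^-1` (Some @` setT))).
    apply: measurableC; rewrite -[_ @^-1` _]setTI; apply: (hunt_measurable hX) => //.
    exact: measurable_image_Some.
  apply/seteqP; split => w /=; first by move=> -> [].
  by case: (X t w) => //= x h; exfalso; apply: h; exists x.
exists (~` [set w | X t w = None]); split.
- exact: measurableC.
- by apply: pker_setC => //; exact: (hunt_trap hX).
- by move=> w /= h Xw; apply: h => _; exact: g0.
Qed.

(** Where [X s] is the cemetery the inner expectation vanishes, since the cemetery is a trap; this
    matches the value 0 that [semigroup] gives there. *)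
Lemma semigroupD s t (f : borel E -> R) : 0 <= s -> 0 <= t -> bmeas f ->
  semigroup P X (s + t) f = semigroup P X s (semigroup P X t f).
Proof.
move=> s0 t0; have st0 : 0 <= s + t by rewrite addr_ge0.
have H (h : borel E -> R) : bmeas h -> (forall x, 0 <= h x) ->
    semigroup P X (s + t) h = semigroup P X s (semigroup P X t h).
  move=> bh h0; apply/funext => x; apply/EFin_inj.
  have bPh := semigroup_bmeas t0 bh.
  rewrite !semigroup_EFin//.
  rewrite (@semigroup_ge0_markov s t (fun e => (oapp h 0 e)%:E))//; last 2 first.
  - by apply/measurable_EFinP; apply: measurable_ext; case: bh.
  - by case=> [y|]/=; rewrite lee_fin.
  apply: eq_integral => w _; case: (X s w) => [y|]/=.
    by rewrite semigroup_EFin.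
  apply: (pker_None t0) => [|w' ->//].
  by apply/measurable_EFinP; case: (bmeas_ext_path t0 bh).
move=> bf; have bp := bmeas_fpos bf; have bn := bmeas_fneg bf.
have -> : f = (fun x => -1 * fneg f x + fpos f x).
  by apply/funext => x; rewrite {1}(fposneg f x); ring.
rewrite !semigroup_lin//; [|exact: semigroup_bmeas|exact: semigroup_bmeas].
by rewrite !H//; [exact: fpos_ge0|exact: fneg_ge0].
Qed.

Variable m : {measure set (borel E) -> \bar R}.
Hypotheses (sym : process_symmetric P X m) (cons : conservative P X m).

Lemma process_markov_semigroup : markov_semigroup m (semigroup P X).
Proof.
split; [|by move=> *; exact: semigroupD|exact: semigroup0].
move=> t t0; split.
- by move=> f; exact: semigroup_bmeas.
- by move=> a f g; exact: semigroup_lin.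
- by move=> f _ f0 x; exact: semigroup_pos.
- by move=> x; exact: semigroup_le1.
- move=> f g bf bg f0 g0.
  have := sym t0 (f := EFin \o f) (g := EFin \o g).
  move=> /(_ _ _ _ _)/=.
  have m1 : measurable_fun setT (EFin \o f) by apply/measurable_EFinP; case: bf.
  have m2 : measurable_fun setT (EFin \o g) by apply/measurable_EFinP; case: bg.
  move=> /(_ m1 m2).
  under eq_integral do rewrite semigroup_ge0_EFin//.
  under [X in _ -> X = _]eq_integral do rewrite EFinM.
  move=> ->; [|by []|by []].
  by apply: eq_integral => x _; rewrite semigroup_ge0_EFin.
- have [->|tp] := eqVneq t 0.
    by apply: aeW => x; rewrite semigroup0//; exact: bmeas_cst.
  have {}tp : 0 < t by rewrite lt_neqAle eq_sym tp.
  apply: filterS (cons tp) => x.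
  rewrite (_ : cst 1%E = EFin \o (cst 1 : borel E -> R))//.
  by rewrite semigroup_ge0_EFin//; [case|exact: bmeas_cst].
Qed.

End process_semigroup.

(** * The jumping measure *)

Section null_sets.
Context {d} {T : measurableType d} {R : realType}.
Variable mu : {measure set T -> \bar R}.
Local Open Scope ereal_scope.

Lemma null_set_majorant (N : set T) (u : T -> \bar R) : measurable N -> mu N = 0 ->
  measurable_fun setT u -> (forall x, 0 <= u x) ->
  let u' := fun x => if x \in N then +oo else u x in
  [/\ measurable_fun setT u', forall x, 0 <= u' x & \int[mu]_x u' x = \int[mu]_x u x].
Proof.
move=> mN N0 mu_ u0 u'.
have mu' : measurable_fun setT u'.
  by apply: measurable_fun_ifT => //; exact: measurable_fun_mem.
have u'0 x : 0 <= u' x by rewrite /u'; case: ifP.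
split => //; apply: ge0_ae_eq_integral => //.
exists N; split => // x /= h; apply: contrapT => nN; apply: h => _.
by rewrite /u' memNset.
Qed.

(** Covers [v] of unknown measurability: it lies between [u] put to 0 on [N] and [u] put to [+oo] on
    [N], both measurable with the integral of [u]. *)
Lemma ge0_integral_null_set (N : set T) (u v : T -> \bar R) : measurable N -> mu N = 0 ->
  measurable_fun setT u -> (forall x, 0 <= u x) -> (forall x, 0 <= v x) ->
  (forall x, ~ N x -> u x = v x) -> \int[mu]_x u x = \int[mu]_x v x.
Proof.
move=> mN N0 mu_ u0 v0 uv.
have [m1 p1 E1] := null_set_majorant mN N0 mu_ u0.
apply/eqP; rewrite eq_le; apply/andP; split.
  have mr : measurable_fun setT (u \_ (~` N)).
    by apply/(measurable_restrictT _ (measurableC mN)); exact: measurable_funTS.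
  have r0 x : 0 <= (u \_ (~` N)) x by rewrite /patch; case: ifP.
  rewrite (_ : \int[mu]_x u x = \int[mu]_x (u \_ (~` N)) x).
    apply: nonneg_integral_mono => // x _; rewrite /patch; case: ifPn => //.
    by move=> /set_mem xN; rewrite uv.
  apply: ge0_ae_eq_integral => //; exists N; split => // x /= h.
  apply: contrapT => nN; apply: h => _; rewrite /patch mem_set//.
rewrite -E1; apply: nonneg_integral_mono => // x _; case: ifPn => [_|].
  exact: leey.
by move=> /negP nN; rewrite uv// => h; apply: nN; rewrite inE.
Qed.

End null_sets.

(** * Disintegration of the jumping measure *)

Section jump_integral.
Context {R : realType} {E : pmetricType R}.
Variable j : R.-ker borel E ~> borel E.
Variables A B : nat -> set (borel E).
Hypotheses (mA : forall n, measurable (A n)) (mB : forall n, measurable (B n)).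
Hypothesis AB : @off_diag R E = \bigcup_n (A n `*` B n).

Let W n : set (borel E * borel E) := seqDU (fun n => A n `*` B n) n.

Let mW n : measurable (W n).
Proof.
apply: measurableD; first exact: measurableX.
by apply: bigsetU_measurable => i _; exact: measurableX.
Qed.

Let WE : @off_diag R E = \bigcup_n W n.
Proof. by rewrite AB seqDU_bigcup_eq. Qed.

Lemma measurable_off_diag : measurable (@off_diag R E).
Proof. by rewrite WE; exact: bigcup_measurable. Qed.

Definition jump_fin n : set (borel E) := [set x | j x (B n) < +oo]%E.

Lemma measurable_jump_fin n : measurable (jump_fin n).
Proof.
rewrite -[jump_fin n]setTI.
exact: (emeasurable_fun_infty_o measurableT (measurable_kernel j (B n) (mB n))).
Qed.

(** Dividing by this weight turns [j] cut to [B n] into a finite kernel with a uniform bound;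
    [jump_int] multiplies it back. *)
Let wt n (x : borel E) : R := 1 + fine (j x (B n)).

Let wt_gt0 n x : 0 < wt n x.
Proof. by rewrite /wt ltr_wpDr// fine_ge0. Qed.

Let mwt n : measurable_fun setT (wt n).
Proof.
apply: measurable_funD => //.
by apply: (measurableT_comp (fine_measurable measurableT)); exact: measurable_kernel.
Qed.

Let coef n (x : borel E) : R := \1_(jump_fin n) x * (wt n x) `^ (- 1).

Let coef_ge0 n x : 0 <= coef n x.
Proof. by rewrite mulr_ge0// powR_ge0. Qed.

Definition jump_cut n (x : borel E) : {measure set (borel E) -> \bar R} :=
  mscale (NngNum (coef_ge0 n x)) (mrestr (j x) (mB n)).

Let jump_cutE n x U : jump_cut n x U = ((coef n x)%:E * j x (U `&` B n))%E.
Proof. by []. Qed.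

Let jump_cut_measurable n U : measurable U -> measurable_fun setT (jump_cut n ^~ U).
Proof.
move=> mU; apply: emeasurable_funM.
  apply/measurable_EFinP; apply: measurable_funM.
    by apply: measurable_indic; exact: measurable_jump_fin.
  exact: (measurableT_comp (measurable_powR _) (mwt n)).
by apply: measurable_kernel; exact: measurableI.
Qed.

HB.instance Definition _ n := isKernel.Build _ _ (borel E) (borel E) R
  (jump_cut n) (@jump_cut_measurable n).

Let jump_cut_uub n : measure_fam_uub (jump_cut n).
Proof.
exists 2 => x; rewrite jump_cutE setTI /coef indicE.
have [xf|xf] := boolP (x \in jump_fin n); last by rewrite mul0r mul0e.
move: xf; rewrite inE => xf.
rewrite mul1r powR_inv1 ?ltW//.
have -> : j x (B n) = (fine (j x (B n)))%:E by rewrite fineK// ge0_fin_numE.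
rewrite -EFinM lte_fin -/(wt n x).
apply: (@le_lt_trans _ _ 1); last by rewrite ltr1n.
by rewrite mulrC ler_pdivrMr// mul1r /wt lerDr.
Qed.

HB.instance Definition _ n := Kernel_isFinite.Build _ _ (borel E) (borel E) R
  (jump_cut n) (jump_cut_uub n).

Local Open Scope ereal_scope.

(* [j] need not be s-finite; away from a null set it coincides off the
   diagonal with the s-finite kernel integrated against here. *)
Definition jump_int (x : borel E) (g : borel E -> \bar R) : \bar R :=
  \sum_(n <oo) ((wt n x)%:E * \int[jump_cut n x]_y (g y * (\1_(W n) (x, y))%:E)).

Definition jump_good : set (borel E) := [set x | forall n, A n x -> jump_fin n x].

Lemma measurable_jump_good : measurable jump_good.
Proof.
rewrite (_ : jump_good = \bigcap_n (~` A n `|` jump_fin n)).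
  apply: bigcapT_measurable => n; apply: measurableU; first exact: measurableC.
  exact: measurable_jump_fin.
apply/seteqP; split => x /= h n; last by move=> Ax; have [] := h n I.
by move=> _; have [Ax|] := pselect (A n x); [right; exact: h|left].
Qed.

Let term_ge0 x g n : (forall y, 0 <= g y) ->
  0 <= (wt n x)%:E * \int[jump_cut n x]_y (g y * (\1_(W n) (x, y))%:E).
Proof.
move=> g0; apply: mule_ge0; first by rewrite lee_fin (ltW (wt_gt0 n x)).
by apply: integral_ge0 => y _; rewrite mule_ge0// lee_fin.
Qed.

Lemma jump_int_ge0 x g : (forall y, 0 <= g y) -> 0 <= jump_int x g.
Proof. by move=> g0; apply: nneseries_ge0 => n _ _; exact: term_ge0. Qed.

(** The sections at [x] of the disjointed rectangles partition the complement of [x]; those meeting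
    [x] have finite [j x (B n)], so there the weight and the coefficient cancel. *)
Lemma jump_intE x g : jump_good x -> measurable_fun setT g -> (forall y, 0 <= g y) ->
  jump_int x g = \int[j x]_(y in ~` [set x]) g y.
Proof.
move=> Gx mg g0.
have xW n : measurable (xsection (W n) x) by exact: measurable_xsection.
have DE : ~` [set x] = \bigcup_n xsection (W n) x.
  rewrite -xsection_bigcup -WE /xsection; apply/seteqP; split => y /=.
    by rewrite inE /off_diag /= => xy h; apply: xy.
  by rewrite inE /off_diag /= => xy h; apply: xy.
rewrite DE ge0_integral_bigcup//; last 2 first.
- exact: measurable_funTS.
- apply/trivIsetP => a b _ _ ab; rewrite -xsectionI.
  have /trivIsetP -> // := trivIset_seqDU (fun n => A n `*` B n).
  by rewrite xsection0.
apply: eq_eseriesr => n _.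
have gW y : g y * (\1_(W n) (x, y))%:E = (g \_ (xsection (W n) x)) y.
  rewrite /patch indicE mem_xsection; case: ifP => _; by rewrite ?mule1 ?mule0.
have -> : \int[jump_cut n x]_y (g y * (\1_(W n) (x, y))%:E) =
    \int[jump_cut n x]_y ((g \_ (xsection (W n) x)) y).
  by apply: eq_integral => y _; exact: gW.
rewrite -integral_mkcond.
have [Ax|nAx] := pselect (A n x); last first.
  have -> : xsection (W n) x = set0.
    apply/seteqP; split => // y; rewrite /xsection /= inE => -[[/= Ax _] _].
    by apply: nAx.
  by rewrite !integral_set0 mule0.
have fx := Gx n Ax.
rewrite ge0_integral_mscale//; last exact: measurable_funTS.
rewrite muleA -EFinM /= /coef indicE mem_set// mul1r powR_inv1 ?ltW//.
rewrite mulfV ?gt_eqF// mul1e.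
apply: eq_measure_integral => S mS SW; rewrite /mrestr; congr (j x _).
apply/setIidl => y /SW; rewrite /xsection /= inE => -[[]//].
Qed.

Lemma measurable_jump_int {d} {Z : measurableType d} (F : Z * borel E -> \bar R)
    (p : Z -> borel E) : measurable_fun setT p ->
  measurable_fun setT F -> (forall z, 0 <= F z) ->
  measurable_fun setT (fun z => jump_int (p z) (fun y => F (z, y))).
Proof.
move=> mp mF F0; apply: ge0_emeasurable_sum => [n z _ _|n _].
  by apply: term_ge0 => y; exact: F0.
apply: emeasurable_funM.
  by apply/measurable_EFinP; exact: (measurableT_comp (mwt n) mp).
apply: (measurable_kpull (jump_cut n : R.-fker _ ~> _) mp
  (g := fun zy => F zy * (\1_(W n) (p zy.1, zy.2))%:E)).
  by move=> z; rewrite mule_ge0// lee_fin.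
apply: emeasurable_funM => //; apply/measurable_EFinP.
have mI : measurable_fun setT (\1_(W n) : _ -> R) by apply: measurable_indic; exact: mW.
have mp2 : measurable_fun setT (fun zy : Z * borel E => (p zy.1, zy.2)).
  by apply: measurable_fun_pair => //; exact: (measurableT_comp mp measurable_fst).
exact: (measurableT_comp mI mp2).
Qed.

Section disintegration.
Variables (m : {measure set (borel E) -> \bar R}).
Variable (J : {measure set (borel E * borel E) -> \bar R}).
Hypotheses (Jj : jump_kernel m J j) (Jfin : forall n, J (A n `*` B n) < +oo).

(** The integral of [j x (B n)] over [A n] is [J (A n * B n)], which is finite. *)
Lemma jump_good_ae : {ae m, forall x, jump_good x}.
Proof.
have H n : {ae m, forall x, A n x -> jump_fin n x}.
  have mj : measurable_fun (A n) (fun x => j x (B n)).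
    by apply: measurable_funTS; exact: measurable_kernel.
  have : m.-integrable (A n) (fun x => j x (B n)).
    apply/integrableP; split => //.
    under eq_integral do rewrite gee0_abs//.
    have := Jfin n; rewrite (Jj (measurableX (mA n) (mB n))); last first.
      by rewrite AB => z ABz; exists n.
    rewrite integral_mkcond; congr (_ < _); apply: eq_integral => x _.
    rewrite /patch; case: ifPn => [/set_mem Ax|/negP nAx].
      by congr (j x _); apply/seteqP; split => [y []//|y By]; split.
    rewrite (_ : [set y | _] = set0) ?measure0//.
    by apply/seteqP; split => // y [/= Ax _]; apply: nAx; rewrite inE.
  move=> /(integrable_ae (mA n)); apply: filterS => x h Ax.
  by have := h Ax; rewrite ge0_fin_numE.
have := (ae_foralln H); apply: filterS => x h n; exact: h.
Qed.

Lemma jump_good_null : m (~` jump_good) = 0.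
Proof.
apply: measure_negligible; first by apply: measurableC; exact: measurable_jump_good.
exact: jump_good_ae.
Qed.

Lemma jump_int_disintegration (F : borel E * borel E -> \bar R) :
  measurable_fun setT F -> (forall z, 0 <= F z) ->
  \int[J]_(z in @off_diag R E) F z = \int[m]_x jump_int x (fun y => F (x, y)).
Proof.
have mO := measurable_off_diag; have mG := measurable_jump_good.
have mN : measurable (~` jump_good) by exact: measurableC.
have mS (H : borel E * borel E -> \bar R) x : measurable_fun setT H -> measurable_fun setT (fun y => H (x, y)).
  by move=> mH; exact: (measurableT_comp mH (pair1_measurable x)).
have mD (x : borel E) : measurable (~` [set x] : set (borel E)) by apply: measurableC; exact: measurable_borel_set1.
pose I (H : borel E * borel E -> \bar R) x := \int[j x]_(y in ~` [set x]) H (x, y).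
have I0 H x : (forall z, 0 <= H z) -> 0 <= I H x by move=> H0; exact: integral_ge0.
have mK (H : borel E * borel E -> \bar R) : measurable_fun setT H -> (forall z, 0 <= H z) ->
    measurable_fun setT (fun x => jump_int x (fun y => H (x, y))).
  by move=> mH H0; apply: (measurable_jump_int (p := id)).
have KI (H : borel E * borel E -> \bar R) : measurable_fun setT H -> (forall z, 0 <= H z) ->
    {in jump_good, (fun x => jump_int x (fun y => H (x, y))) =1 I H}.
  by move=> mH H0 x /set_mem Gx; rewrite jump_intE//; exact: mS.
have mI H : measurable_fun setT H -> (forall z, 0 <= H z) -> measurable_fun jump_good (I H).
  by move=> mH H0; apply: (eq_measurable_fun _ (KI H mH H0)); apply: measurable_funTS; exact: mK.
move=> mF F0; rewrite (ge0_negligible_integral mN measurableT (mK F mF F0) _ jump_good_null); last first.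
  by move=> x _; exact: jump_int_ge0.
rewrite setTD setCK (eq_integral _ _ (KI F mF F0)) //.
move: F mF F0; apply: ge0_measurable_ind => [S mS'|c F c0 mF F0 ih|F H mF mH F0 H0 ihF ihH|F_ F mF F0 ndF cF ih].
- have m1 : measurable_fun setT (fun z => (\1_S z)%:E : \bar R).
    exact/measurable_EFinP/measurable_indic.
  have S0 z : 0 <= (\1_S z)%:E :> \bar R by rewrite lee_fin.
  rewrite integral_indic// Jj; [|exact: measurableI|by move=> z []].
  (* The sections in [jump_kernel] are integrated over all [x], where their measurability in [x] is
     unknown; on [jump_good] they agree with a measurable function. *)
  apply/esym; rewrite integral_mkcond; apply: (ge0_integral_null_set mN jump_good_null) => //.
  - by apply/(measurable_restrictT _ mG); exact: mI.
  - by move=> x; rewrite /patch; case: ifP => // _; exact: I0.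
  move=> x /= /contrapT Gx; rewrite patchT ?inE// /I.
  have mSx : measurable [set y | S (x, y)].
    rewrite (_ : [set y | _] = xsection S x); first exact: measurable_xsection.
    by apply/seteqP; split => y; rewrite /xsection /= inE.
  rewrite (_ : (fun y => (\1_S (x, y))%:E) = fun y => (\1_[set y | S (x, y)] y)%:E).
    rewrite integral_indic//; congr (j x _).
    by apply/seteqP; split => y /=; rewrite /off_diag /= => -[h1 h2]; split => // h; apply: h2.
  by apply/funext => y; rewrite !indicE.
- rewrite (ge0_integralZl_EFin J mO (fun z _ => F0 z) (measurable_funTS mF) c0) ih.
  rewrite -(ge0_integralZl_EFin m mG (fun x _ => I0 F x F0) (mI F mF F0) c0).
  apply: eq_integral => x _; rewrite /I.
  by rewrite (ge0_integralZl_EFin (j x) (mD x) (fun y _ => F0 (x, y)) (measurable_funTS (mS F x mF)) c0).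
- rewrite (ge0_integralD J mO (fun z _ => F0 z) (measurable_funTS mF) (fun z _ => H0 z) (measurable_funTS mH)).
  rewrite ihF ihH -(ge0_integralD m mG (fun x _ => I0 F x F0) (mI F mF F0) (fun x _ => I0 H x H0) (mI H mH H0)).
  apply: eq_integral => x _; rewrite /I.
  by rewrite (ge0_integralD (j x) (mD x) (fun y _ => F0 (x, y)) (measurable_funTS (mS F x mF))
    (fun y _ => H0 (x, y)) (measurable_funTS (mS H x mH))).
- have c1 := monotone_cvg_integral (mu := J) mO (fun n => measurable_funTS (mF n))
    (fun n z _ => F0 n z) (fun z _ => ndF z) (fun z _ => cF z).
  rewrite (funext ih) in c1; apply: (cvg_unique (@ereal_hausdorff R) c1).
  apply: (monotone_cvg_integral (u_ := fun n x => I (F_ n) x)) => // [n|n x _|x _ a b ab|x _].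
  - exact: mI.
  - exact: I0.
  - by apply: nonneg_integral_mono => y _ //; exact: ndF.
  exact: (monotone_cvg_integral (mu := j x) (u_ := fun n y => F_ n (x, y)) (u := fun y => F (x, y)) (mD x)
    (fun n => measurable_funTS (mS (F_ n) x (mF n))) (fun n y _ => F0 n (x, y)) (fun y _ => ndF (x, y)) (fun y _ => cF (x, y))).
Qed.

End disintegration.
End jump_integral.

Section summable_integrals.
Context {d} {T : measurableType d} {R : realType}.
Variable mu : {measure set T -> \bar R}.
Local Open Scope ereal_scope.

(** The sum is integrable, hence finite almost everywhere, and the terms of a convergent series tend
    to 0. *)
Lemma summable_integral_cvg (f_ : nat -> T -> \bar R) :
  (forall n, measurable_fun setT (f_ n)) -> (forall n x, 0 <= f_ n x) ->
  \sum_(n <oo) \int[mu]_x f_ n x < +oo ->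
  exists N, [/\ measurable N, mu N = 0 & forall x, ~ N x -> f_ ^~ x @ \oo --> 0].
Proof.
move=> mf f0 sf.
pose F x := \sum_(n <oo) f_ n x.
have mF : measurable_fun setT F by apply: ge0_emeasurable_sum.
have F0 x : 0 <= F x by apply: nneseries_ge0.
have iF : mu.-integrable setT F.
  apply/integrableP; split => //.
  rewrite (_ : \int[mu]_x `|F x| = \int[mu]_x F x); last by apply: eq_integral => x _; rewrite gee0_abs.
  by rewrite integral_nneseries.
have [N [mN N0 NF]] := integrable_ae measurableT iF.
exists N; split => // x nNx.
have Fx : F x < +oo.
  rewrite -ge0_fin_numE//; apply: contrapT => h; apply: nNx; apply: NF => /= /(_ I); exact: h.
apply: (@squeeze_cvge _ _ _ _ (cst 0) _ (fun N => \sum_(N <= k <oo) f_ k x)); last 2 first.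
- exact: cvg_cst.
- exact: nneseries_tail_cvg.
apply: nearW => n; rewrite f0/=.
rewrite (nneseries_split n 1) => [|k _]; last exact: f0.
by rewrite addn1 big_nat1 leeDl// nneseries_ge0.
Qed.

Lemma fatou_le (D : set T) (f_ : nat -> T -> \bar R) (f : T -> \bar R) (M : \bar R) :
  measurable D -> (forall n, measurable_fun D (f_ n)) -> (forall n x, D x -> 0 <= f_ n x) ->
  (forall x, D x -> f_ ^~ x @ \oo --> f x) -> (forall n, \int[mu]_(x in D) f_ n x <= M) ->
  \int[mu]_(x in D) f x <= M.
Proof.
move=> mD mf f0 cf fM.
rewrite (_ : \int[mu]_(x in D) f x = \int[mu]_(x in D) limn_einf (f_ ^~ x)); last first.
  by apply: eq_integral => x /set_mem Dx; have [-> _] := cvg_limn_einf_sup (cf x Dx).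
apply: le_trans (fatou mu mD mf f0) _.
rewrite limn_einf_lim; apply: lime_le; first exact: is_cvg_einfs.
apply: nearW => n; apply: le_trans (fM n).
by apply: ereal_inf_lbound; exists n => /=.
Qed.

End summable_integrals.

(** * The form as a jump integral on the whole domain *)

Section jump_form.
Context {R : realType} {E : pmetricType R}.
Variables (m : {measure set (borel E) -> \bar R}) (D : set (borel E -> R))
  (Q : (borel E -> R) -> (borel E -> R) -> R)
  (J : {measure set (borel E * borel E) -> \bar R}) (j : R.-ker borel E ~> borel E).
Hypotheses (dQ : dirichlet_form m D Q) (rQ : regular_form m D Q)
  (jJ : jumping_measure J) (kJ : jump_kernel m J j) (pJ : pure_jump m D Q J).
Hypothesis mO : measurable (@off_diag R E).

Let off := @off_diag R E.

Let mfst (N : set (borel E)) : measurable N -> measurable (off `&` [set z | N z.1]).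
Proof. by move=> mN; apply: measurableI => //; rewrite -[[set z | _]]setTI; exact: measurable_fst. Qed.

Let msnd (N : set (borel E)) : measurable N -> measurable (off `&` [set z | N z.2]).
Proof. by move=> mN; apply: measurableI => //; rewrite -[[set z | _]]setTI; exact: measurable_snd. Qed.

Lemma jump_null_fst N : measurable N -> m N = 0%E -> J (off `&` [set z | N z.1]) = 0%E.
Proof.
move=> mN N0.
have mA := mfst mN.
rewrite kJ//.
rewrite -[RHS](@integral0 _ _ _ m setT); apply/esym.
apply: (ge0_integral_null_set mN N0) => // x nNx.
rewrite (_ : [set y | _] = set0) ?measure0//.
by apply/seteqP; split => // y [_].
Qed.

(** The kernel controls the first coordinate only; symmetry of [J] transfers this to the second. *)
Lemma jump_null_snd N : measurable N -> m N = 0%E -> J (off `&` [set z | N z.2]) = 0%E.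
Proof.
move=> mN N0; rewrite -(jump_null_fst mN N0).
have mA := mfst mN.
rewrite -(jJ.2 _ mA); last by move=> z [].
congr (J _); apply/seteqP; split => z [/= h Nz]; split => //= h'; exact: h.
Qed.

Lemma jump_swap (F : borel E * borel E -> \bar R) : measurable_fun setT F ->
  (forall z, 0 <= F z)%E ->
  (\int[J]_(z in off) F (z.2, z.1) = \int[J]_(z in off) F z)%E.
Proof.
move=> mF F0.
pose sw (z : borel E * borel E) := (z.2, z.1).
have msw : measurable_fun setT sw.
  by apply: measurable_fun_pair; [exact: measurable_snd|exact: measurable_fst].
have := @ge0_integral_pushforward _ _ _ _ R sw msw J off F mO.
rewrite (_ : sw @^-1` off = off); last first.
  by apply/seteqP; split => z /= h h'; apply: h.
move=> <-//; last exact: measurable_funTS.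
apply: eq_measure_integral => A mA Aoff.
by rewrite /pushforward; exact: jJ.2.
Qed.

Lemma dom_measurable u : D u -> measurable_fun setT u.
Proof. by move=> /(df_L2 dQ); rewrite inE => /andP[/[!inE]]. Qed.

Lemma dom_sqr_int u : D u -> (\int[m]_x ((u x) ^+ 2)%:E = (\int[m]_x (u x * u x))%:E)%E.
Proof.
move=> /(df_L2 dQ) /Lfun2_integrable_sqr iu.
rewrite (_ : \int[m]_x (u x * u x) = \int[m]_x ((u x)^+2)); last by apply: eq_Rintegral => x _; rewrite expr2.
by rewrite /Rintegral fineK//; exact: integrable_fin_num.
Qed.

Lemma dom0 u : D u -> D (fun=> 0).
Proof.
move=> Du; have := df_lin dQ (-1) Du Du.
by under eq_fun do rewrite mulN1r addNr.
Qed.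

Lemma formN_lin s u v : D u -> D v -> Q (fun x => s * u x + v x) (fun x => s * u x + v x) =
  s ^+ 2 * Q u u + s * Q u v *+ 2 + Q v v.
Proof.
move=> Du Dv; have Dw := df_lin dQ s Du Dv.
rewrite (df_bilin dQ)// (df_sym dQ Du Dw) (df_sym dQ Dv Dw) !(df_bilin dQ)//.
by rewrite (df_sym dQ Dv Du); ring.
Qed.

Lemma form_young (a s : R) u v : 0 < a -> D u -> D v -> s ^+ 2 = 1 ->
  Q (fun x => s * u x + v x) (fun x => s * u x + v x) <= (1 + a^-1) * Q u u + (1 + a) * Q v v.
Proof.
move=> a0 Du Dv s1; rewrite formN_lin// s1.
have := df_ge0 dQ (df_lin dQ (- s / a) Du Dv); rewrite formN_lin// => h.
have {}h : 0 <= a * ((- s / a) ^+ 2 * Q u u + - s / a * Q u v *+ 2 + Q v v) by rewrite mulr_ge0// ltW.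
have E1 : a * ((- s / a) ^+ 2 * Q u u + - s / a * Q u v *+ 2 + Q v v) =
   s ^+ 2 * a^-1 * Q u u - s * Q u v *+ 2 + a * Q v v.
  by field; rewrite gt_eqF.
by move: h; rewrite E1 s1; lra.
Qed.

Lemma form0 u : D u -> Q (fun=> 0) (fun=> 0) = 0.
Proof.
move=> Du; have := formN_lin (-1) Du Du.
under [X in Q X _]eq_fun do rewrite mulN1r addNr.
under [X in Q _ X]eq_fun do rewrite mulN1r addNr.
by move=> ->; ring.
Qed.

Lemma continuous_quasi_continuous u (w : E -> R) : D u -> continuous w -> quasi_continuous m D Q w.
Proof.
move=> Du cw e e0; exists set0; split; first exact: open0.
  apply: (@le_lt_trans _ _ 0%E); last by rewrite lte_fin.
  apply: ereal_inf_lbound; exists (fun=> 0).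
    by split; [exact: dom0 Du|apply: aeW].
  by rewrite /form1 (form0 Du) add0r; congr EFin; rewrite /Rintegral integral0_eq// => x _; rewrite mul0r.
exact: continuous_subspaceT.
Qed.

Definition jump_energy (v : borel E -> R) := (\int[J]_(z in off) ((v z.2 - v z.1) ^+ 2)%:E)%E.

Lemma measurable_jump_energy (v : borel E -> R) : measurable_fun setT v ->
  measurable_fun setT (fun z : borel E * borel E => ((v z.2 - v z.1) ^+ 2)%:E).
Proof.
move=> mv; apply/measurable_EFinP/measurable_funX/measurable_funB.
  exact: (measurableT_comp mv measurable_snd).
exact: (measurableT_comp mv measurable_fst).
Qed.

Lemma measurable_jump_energy_mul (u k : borel E -> R) : measurable_fun setT u ->
  measurable_fun setT k ->
  measurable_fun setT (fun z : borel E * borel E => (u z.2 - u z.1) ^+ 2 * k z.1).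
Proof.
move=> mu mk; apply: measurable_funM; last exact: (measurableT_comp mk measurable_fst).
by apply/measurable_EFinP; exact: measurable_jump_energy.
Qed.

Lemma jump_energy_continuous (w : E -> R) : D w -> continuous w -> jump_energy w = (2 * Q w w)%:E.
Proof.
move=> Dw cw; have qw := continuous_quasi_continuous Dw cw.
rewrite EFinM (pJ Dw Dw qw qw) muleA -EFinM mulfV// mul1e.
by apply: eq_integral => z _; rewrite expr2.
Qed.

Lemma jump_energy_lsc (w_ : nat -> borel E -> R) v (M : R) : D v ->
  (forall n, measurable_fun setT (w_ n)) ->
  (exists N, [/\ measurable N, m N = 0%E & forall x, ~ N x -> w_ ^~ x @ \oo --> v x]) ->
  (forall n, jump_energy (w_ n) <= M%:E)%E -> (jump_energy v <= M%:E)%E.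
Proof.
move=> Dv mw [N [mN N0 cw]] wM.
pose N' := (off `&` [set z | N z.1]) `|` (off `&` [set z | N z.2]) : set (borel E * borel E).
have mN' : measurable N' by apply: measurableU; [exact: mfst|exact: msnd].
have N'0 : J N' = 0%E.
  apply/eqP; rewrite eq_le measure_ge0 andbT.
  apply: le_trans (measureU2 _ (mfst mN) (msnd mN)) _.
  by rewrite /= (jump_null_fst mN N0) (jump_null_snd mN N0) adde0.
have mD : measurable (off `\` N') by exact: measurableD.
have mv := dom_measurable Dv.
rewrite /jump_energy (ge0_negligible_integral mN' mO (measurable_funTS (measurable_jump_energy mv)) _ N'0); last first.
  by move=> z _; rewrite lee_fin sqr_ge0.
apply: (fatou_le (f_ := fun n z => ((w_ n z.2 - w_ n z.1) ^+ 2)%:E) mD) => [n|n z _|z [zo zN']|n].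
- exact: (measurable_funTS (measurable_jump_energy (mw n))).
- by rewrite lee_fin sqr_ge0.
- have c2 : w_ ^~ z.2 @ \oo --> v z.2 by apply: cw => Nz; apply: zN'; right.
  have c1 : w_ ^~ z.1 @ \oo --> v z.1 by apply: cw => Nz; apply: zN'; left.
  apply: cvg_EFin; first exact: nearW.
  rewrite (_ : fine \o _ = fun n => (w_ n z.2 - w_ n z.1) * (w_ n z.2 - w_ n z.1)); last by apply/funext => n /=; rewrite expr2.
  by rewrite expr2; apply: cvgM; apply: cvgB.
- apply: le_trans (wM n); apply: ge0_subset_integral => //.
  + exact: (measurable_funTS (measurable_jump_energy (mw n))).
  + by move=> z _; rewrite lee_fin sqr_ge0.
Qed.

(** Regularity gives closeness in [Q]. For the jump energy, the differences [w n - w 0] are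
    continuous, so [pure_jump] applies to them, and Fatou along [w n -> v] handles [v - w 0]. *)
Lemma jump_energy_approx v (e : R) : D v -> 0 < e -> exists w : E -> R,
  [/\ D w, continuous w, Q (fun x => -1 * w x + v x) (fun x => -1 * w x + v x) <= e &
    (jump_energy (fun x => (-1 * w x + v x)%R) <= e%:E)%E].
Proof.
move=> Dv e0.
(* The factor [2^-n] makes the squared [L^2] distances summable, hence [w n -> v] almost everywhere;
   the 8 leaves [2 Q(w n - w 0) <= 2 (2 e/8 + 2 e/8) = e]. *)
have step n : exists w, [/\ D w, continuous (w : E -> R) &
    form1 m Q (fun x => -1 * w x + v x) (fun x => -1 * w x + v x) < e / 8 * 2^-1 ^+ n].
  have [w [Dw [cw _] h]] := rQ.1 v Dv (e / 8 * 2^-1 ^+ n) ltac:(by rewrite mulr_gt0// ?exprn_gt0// divr_gt0).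
  exists w; split => //.
  rewrite (_ : (fun x => -1 * w x + v x) = fun x => v x - w x)//.
  by apply/funext => x; rewrite mulN1r addrC.
have /choice[w Hw] := step.
have Dd n : D (fun x => -1 * w n x + v x) by apply: (df_lin dQ) => //; have [] := Hw n.
have Qd n : Q (fun x => -1 * w n x + v x) (fun x => -1 * w n x + v x) <= e / 8.
  have [_ _ h] := Hw n; apply: (@le_trans _ _ (e / 8 * 2^-1 ^+ n)).
    apply: le_trans (ltW h); rewrite lerDl /Rintegral fine_ge0//.
    by apply: integral_ge0 => x _; rewrite lee_fin -expr2 sqr_ge0.
  by rewrite ler_piMr// ?divr_ge0 ?(ltW e0)// exprn_ile1// ?invr_ge0// invf_le1// ler1n.
have Id n : (\int[m]_x ((-1 * w n x + v x) ^+ 2)%:E <= (e / 8 * 2^-1 ^+ n)%:E)%E.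
  rewrite dom_sqr_int// lee_fin; have [_ _ h] := Hw n; apply: le_trans (ltW h).
  by rewrite /form1 lerDr; exact: (df_ge0 dQ (Dd n)).
have mv := dom_measurable Dv.
have mw n : measurable_fun setT (w n) by have [h _ _] := Hw n; exact: dom_measurable.
have e8 : e / 8 <= e by rewrite ler_pdivrMr// ler_peMr// ?(ltW e0)// ler1n.
exists (w 0%N); have [Dw0 cw0 _] := Hw 0%N; split => //.
  exact: le_trans (Qd 0%N) e8.
apply: (@jump_energy_lsc (fun n x => -1 * w 0%N x + w n x)) => [//|n||n].
- by apply: measurable_funD => //; exact: measurable_funM.
- have [|||N [mN N0 h]] := @summable_integral_cvg _ _ _ m (fun n x => ((-1 * w n x + v x) ^+ 2)%:E).
  + by move=> n; apply/measurable_EFinP/measurable_funX/measurable_funD => //; exact: measurable_funM.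
  + by move=> n x; rewrite lee_fin sqr_ge0.
  + apply: (@le_lt_trans _ _ (\sum_(n <oo) (e / 8 * 2^-1 ^+ n)%:E)%E).
      apply: lee_nneseries => n _; [move=> _; apply: integral_ge0 => x _; rewrite lee_fin sqr_ge0//|exact: Id].
    apply: (@le_lt_trans _ _ (e / 4)%:E); last exact: ltry.
    apply: lime_le.
      by apply: is_cvg_nneseries => n _ _; rewrite lee_fin mulr_ge0// ?exprn_ge0// divr_ge0// ltW.
    apply: nearW => n; rewrite sumEFin lee_fin.
    have := @geometric_seriesE R (e / 8) 2^-1 ltac:(by lra) => /(congr1 (fun f => f n)).
    rewrite /series /= => ->.
    have : 0 <= e / 8 * 2^-1 ^+ n by rewrite mulr_ge0// ?exprn_ge0// divr_ge0// ltW.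
    rewrite (_ : 1 - 2^-1 = 2^-1 :> R); last lra.
    by rewrite invrK mulrBr mulr1; set q := _ * 2^-1 ^+ n => q0; lra.
  + exists N; split => // x /h h'; apply: cvgD; first exact: cvg_cst.
    have h2 : (fun n => (-1 * w n x + v x) ^+ 2) @ \oo --> (0 : R) by exact: (fine_cvg h').
    apply/cvgrPdist_lt => eps eps0; move/cvgrPdist_lt : h2 => /(_ _ (exprn_gt0 2 eps0)).
    apply: filterS => n; rewrite /= sub0r normrN normrX ltr_pXn2r ?nnegrE ?(ltW eps0)//.
    by rewrite mulN1r addrC.
- have [Dwn cwn _] := Hw n.
  have Dn : D (fun x => -1 * w 0%N x + w n x) by apply: (df_lin dQ).
  have cn : continuous (fun x : E => -1 * w 0%N x + w n x).
    by move=> x; apply: cvgD; [apply: cvgM; [exact: cvg_cst|exact: cw0]|exact: cwn].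
  rewrite (jump_energy_continuous Dn cn) lee_fin.
  rewrite (_ : (fun x => -1 * w 0%N x + w n x) = fun x => -1 * (-1 * w n x + v x) + (-1 * w 0%N x + v x)); last first.
    by apply/funext => x; ring.
  have sN1 : (-1) ^+ 2 = 1 :> R by rewrite expr2 mulrNN mulr1.
  have := form_young ltr01 (Dd n) (Dd 0%N) sN1.
  have := Qd n; have := Qd 0%N; rewrite invr1; lra.
Qed.

Lemma jump_energy_young (a s : R) (u v : borel E -> R) : 0 < a -> measurable_fun setT u ->
  measurable_fun setT v -> s ^+ 2 = 1 ->
  (jump_energy (fun x => (s * u x + v x)%R) <=
    (1 + a^-1)%:E * jump_energy u + (1 + a)%:E * jump_energy v)%E.
Proof.
move=> a0 mu mv s1.
have c1 : 0 <= 1 + a^-1 by rewrite addr_ge0// invr_ge0 ltW.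
have c2 : 0 <= 1 + a by rewrite addr_ge0// ltW.
have sq0 (w : borel E -> R) (z : borel E * borel E) : off z -> (0 <= ((w z.2 - w z.1) ^+ 2)%:E)%E.
  by move=> _; rewrite lee_fin sqr_ge0.
have mw (w : borel E -> R) : measurable_fun setT w -> measurable_fun off (fun z : borel E * borel E => ((w z.2 - w z.1) ^+ 2)%:E).
  by move=> h; apply: measurable_funTS; exact: measurable_jump_energy.
rewrite /jump_energy -(ge0_integralZl_EFin J mO (sq0 u) (mw u mu) c1).
rewrite -(ge0_integralZl_EFin J mO (sq0 v) (mw v mv) c2).
rewrite -ge0_integralD//; last 4 first.
- by move=> z oz; rewrite mule_ge0// lee_fin sqr_ge0.
- by apply: measurable_funeM; exact: mw.
- by move=> z oz; rewrite mule_ge0// lee_fin sqr_ge0.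
- by apply: measurable_funeM; exact: mw.
apply: nonneg_integral_mono => z; first by move=> _; rewrite lee_fin sqr_ge0.
move=> _; rewrite -!EFinM -EFinD lee_fin.
set p := u z.2 - u z.1; set q := v z.2 - v z.1.
rewrite (_ : _ - _ = s * p + q); last by rewrite /p /q; ring.
have h : 0 <= a * (s * p / a - q) ^+ 2 by rewrite mulr_ge0 ?sqr_ge0// ltW.
have E1 : a * (s * p / a - q) ^+ 2 = s ^+ 2 * a^-1 * p ^+ 2 - 2 * s * p * q + a * q ^+ 2.
  by field; rewrite gt_eqF.
rewrite E1 s1 in h.
have E2 : (s * p + q) ^+ 2 = s ^+ 2 * p ^+ 2 + 2 * s * p * q + q ^+ 2 by ring.
rewrite E2 s1; lra.
Qed.

Lemma le_of_near (x y : R) : 0 <= y ->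
  (forall a, 0 < a -> a <= 1 -> x <= (1 + a) * ((1 + a) * y + 2 * a) + 2 * a) -> x <= y.
Proof.
move=> y0 H; rewrite leNgt; apply/negP => xy.
(* For [a <= 1] the excess over [y] is at most [a (3y + 6)]; the choice [a = (x - y) / (2k)] keeps
   it below [(x - y) / 2]. *)
pose k := 3 * y + 6 + (x - y).
have k0 : 0 < k by rewrite /k; lra.
have a0 : 0 < (x - y) / (2 * k) by rewrite divr_gt0// ?mulr_gt0// subr_gt0.
have a1 : (x - y) / (2 * k) <= 1 by rewrite ler_pdivrMr ?mulr_gt0// /k; lra.
have := H _ a0 a1; set a := (x - y) / (2 * k) in a0 a1 *.
have E1 : a * k = (x - y) / 2 by rewrite /a; field; rewrite gt_eqF.
have h1 : a * a <= a by rewrite ler_piMr// ltW.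
have h2 : a * a * y <= a * y by rewrite ler_wpM2r.
have h3 : 0 <= a * (x - y) by apply: mulr_ge0; [exact: ltW|rewrite subr_ge0; exact: ltW].
have E3 : a * k = 3 * (a * y) + 6 * a + a * (x - y) by rewrite /k; ring.
have E2 : (1 + a) * ((1 + a) * y + 2 * a) + 2 * a = y + 2 * (a * y) + a * a * y + 4 * a + 2 * (a * a) by ring.
rewrite E2; lra.
Qed.

(* Both sides are squares of seminorms that agree on continuous functions, and every [v] in the
   domain is approximated by such functions in both seminorms. *)
Lemma jump_energyE v : D v -> jump_energy v = (2 * Q v v)%:E.
Proof.
move=> Dv.
(* [q] is [Q w w] for a continuous [w] within [a^2 / 2] of [v] in both energies; Young's inequality
   with parameter [a] then costs [(1 + a^-1) a^2 / 2 <= a]. *)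
have approx (a : R) : 0 < a -> a <= 1 -> exists q, [/\ 0 <= q,
    2 * q <= (1 + a) * (2 * Q v v) + 2 * a, 2 * Q v v <= (1 + a) * (2 * q) + 2 * a,
    ((2 * q)%:E <= (1 + a)%:E * jump_energy v + (2 * a)%:E)%E &
    (jump_energy v <= (1 + a)%:E * (2 * q)%:E + (2 * a)%:E)%E].
  move=> a0 a1.
  have e0 : 0 < a ^+ 2 / 2 by rewrite divr_gt0// exprn_gt0.
  have [w [Dw cw Qw Jw]] := jump_energy_approx Dv e0.
  have De := df_lin dQ (-1) Dw Dv.
  set e := (fun x => -1 * w x + v x) in De Qw Jw.
  have s1 : 1 ^+ 2 = 1 :> R by rewrite expr1n.
  have sN1 : (-1) ^+ 2 = 1 :> R by rewrite sqrrN expr1n.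
  have vE : v = fun x => 1 * e x + w x by apply/funext => x; rewrite /e; ring.
  have wE : w = fun x => -1 * e x + v x by apply/funext => x; rewrite /e; ring.
  have ea : (1 + a^-1) * (a ^+ 2 / 2) <= a.
    rewrite (_ : (1 + a^-1) * (a ^+ 2 / 2) = (a + 1) * a / 2); last by field; rewrite gt_eqF.
    by rewrite ler_pdivrMr// mulrC ler_pM2l//; lra.
  have ea' : (1 + a^-1) * Q e e <= a.
    by apply: le_trans ea; rewrite ler_wpM2l// addr_ge0// invr_ge0 ltW.
  have ja : ((1 + a^-1)%:E * jump_energy e <= (2 * a)%:E)%E.
    apply: (@le_trans _ _ ((1 + a^-1)%:E * (a ^+ 2 / 2)%:E)%E).
      by rewrite lee_wpmul2l// lee_fin addr_ge0// invr_ge0 ltW.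
    by rewrite -EFinM lee_fin; apply: le_trans ea _; lra.
  have me := dom_measurable De; have mv := dom_measurable Dv; have mw := dom_measurable Dw.
  have JwE := jump_energy_continuous Dw cw.
  exists (Q w w); split.
  - exact: (df_ge0 dQ).
  - by have := form_young a0 De Dv sN1; rewrite -wE; lra.
  - by have := form_young a0 De Dw s1; rewrite -vE; lra.
  - rewrite -JwE [X in (jump_energy X <= _)%E]wE.
    by apply: le_trans (jump_energy_young a0 me mv sN1) _; rewrite addeC leeD2l.
  - rewrite -JwE [X in (jump_energy X <= _)%E]vE.
    by apply: le_trans (jump_energy_young a0 me mw s1) _; rewrite addeC leeD2l.
have Jfin : jump_energy v \is a fin_num.
  have [q [q0 _ _ _ h]] := approx 1 ltr01 (lexx _).
  rewrite ge0_fin_numE; first by apply: le_lt_trans h _; rewrite -EFinM -EFinD ltry.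
  by apply: integral_ge0 => z _; rewrite lee_fin sqr_ge0.
have J0 : (0 <= jump_energy v)%E by apply: integral_ge0 => z _; rewrite lee_fin sqr_ge0.
rewrite -(fineK Jfin); congr EFin.
have J0' : 0 <= fine (jump_energy v) by exact: fine_ge0.
apply/le_anti/andP; split; apply: le_of_near => //.
- by rewrite mulr_ge0// (df_ge0 dQ).
- move=> a a0 a1; have [q [q0 h1 h2 h3 h4]] := approx a a0 a1.
  have {}h4 : fine (jump_energy v) <= (1 + a) * (2 * q) + 2 * a.
    by rewrite -lee_fin fineK// EFinD EFinM.
  apply: (le_trans h4); rewrite lerD2r ler_wpM2l//; lra.
- move=> a a0 a1; have [q [q0 h1 h2 h3 h4]] := approx a a0 a1.
  have {}h3 : 2 * q <= (1 + a) * fine (jump_energy v) + 2 * a.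
    by move: h3; rewrite -{1}(fineK Jfin) -EFinM -EFinD lee_fin.
  apply: (le_trans h2); rewrite lerD2r ler_wpM2l//; lra.
Qed.

(** Polarisation reduces both forms to energies, hence to integrable squares. The combined integrand
    is [(u(y) - u(x))^2 (k(x) + k(y)) / 2], and symmetry of [J] replaces the mean of [k] by
    [k(x)]. *)
Lemma jump_energy_carre_du_champ (u k : borel E -> R) : (forall x, 0 <= k x) ->
  D u -> D k -> D (fun x => u x * k x) -> D (fun x => u x ^+ 2) ->
  (2 * Q u (fun x => u x * k x) - Q (fun x => u x ^+ 2) k)%:E =
  (\int[J]_(z in off) ((u z.2 - u z.1) ^+ 2 * k z.1)%:E)%E.
Proof.
move=> k0 Du Dk Duk Duu.
have mu := dom_measurable Du; have mk := dom_measurable Dk.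
pose ivl (v : borel E -> R) (z : borel E * borel E) : R := (v z.2 - v z.1) ^+ 2.
have ii v : D v -> J.-integrable off (EFin \o ivl v).
  move=> Dv; apply/integrableP; split.
    by apply: measurable_funTS; apply: measurable_jump_energy; exact: dom_measurable.
  rewrite (_ : \int[J]_(z in off) `|(EFin \o ivl v) z| = jump_energy v)%E; last first.
    by apply: eq_integral => z _; rewrite gee0_abs// lee_fin sqr_ge0.
  by rewrite jump_energyE// ltry.
have RE v : D v -> \int[J]_(z in off) ivl v z = 2 * Q v v.
  by move=> Dv; rewrite /Rintegral -/(jump_energy v) jump_energyE.
have pol a b : D a -> D b -> exists v w, [/\ D v, D w, Q a b = 4^-1 * (Q v v - Q w w),
   forall x, v x = a x + b x & forall x, w x = a x - b x].
  move=> Da Db; exists (fun x => 1 * a x + b x), (fun x => -1 * b x + a x).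
  split; [exact: (df_lin dQ)|exact: (df_lin dQ)| |by move=> x; rewrite mul1r|by move=> x; rewrite mulN1r addrC].
  by rewrite !formN_lin// (df_sym dQ Db Da); field.
have [v1 [w1 [Dv1 Dw1 Q1 v1E w1E]]] := pol _ _ Du Duk.
have [v2 [w2 [Dv2 Dw2 Q2 v2E w2E]]] := pol _ _ Duu Dk.
pose G z := (u z.2 - u z.1) ^+ 2 * (k z.1 + k z.2) / 2.
have GE z : G z = 4^-1 * ivl v1 z - 4^-1 * ivl w1 z - (8^-1 * ivl v2 z - 8^-1 * ivl w2 z).
  by rewrite /G /ivl !v1E !w1E !v2E !w2E; field.
have iZ c v : D v -> J.-integrable off (EFin \o (fun z => c * ivl v z)).
  by move=> Dv; exact: (integrableZl mO c (ii v Dv)).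
have iB (f g : borel E * borel E -> R) : J.-integrable off (EFin \o f) -> J.-integrable off (EFin \o g) ->
   J.-integrable off (EFin \o (fun z => f z - g z)).
  by move=> hf hg; exact: (integrableB mO hf hg).
have i1 := iB _ _ (iZ 4^-1 _ Dv1) (iZ 4^-1 _ Dw1).
have i2 := iB _ _ (iZ 8^-1 _ Dv2) (iZ 8^-1 _ Dw2).
have iG : J.-integrable off (EFin \o G).
  by rewrite (funext GE : G = _); exact: (iB _ _ i1 i2).
have IG : \int[J]_(z in off) G z = 2 * Q u (fun x => u x * k x) - Q (fun x => u x ^+ 2) k.
  rewrite (funext GE : G = _) RintegralB//.
  rewrite !RintegralB//; [|exact: iZ|exact: iZ|exact: iZ|exact: iZ].
  rewrite !RintegralZl//; [|exact: ii|exact: ii|exact: ii|exact: ii].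
  by rewrite !RE// Q1 Q2; field.
rewrite -IG /Rintegral fineK; last exact: integrable_fin_num.
pose H (z : borel E * borel E) : \bar R := (2^-1 * ((u z.2 - u z.1) ^+ 2 * k z.1))%:E.
have H0 z : (0 <= H z)%E by rewrite lee_fin mulr_ge0// mulr_ge0// sqr_ge0.
have mdu := measurable_jump_energy_mul mu mk.
have mH : measurable_fun setT H by apply/measurable_EFinP; exact: measurable_funM.
have swm : measurable_fun setT (fun z : borel E * borel E => (z.2, z.1)).
  by apply: measurable_fun_pair; [exact: measurable_snd|exact: measurable_fst].
transitivity (\int[J]_(z in off) (H z + H (z.2, z.1)))%E.
  by apply: eq_integral => z _; rewrite -EFinD /G /=; congr EFin; field.
rewrite (ge0_integralD J mO (fun z _ => H0 z) (measurable_funTS mH) (fun z _ => H0 (z.2, z.1))); last first.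
  by apply: measurable_funTS; exact: (measurableT_comp mH swm).
rewrite jump_swap// -(ge0_integralD J mO (fun z _ => H0 z) (measurable_funTS mH) (fun z _ => H0 z) (measurable_funTS mH)).
by apply: eq_integral => z _; rewrite -EFinD; congr EFin; field.
Qed.

End jump_form.

(** * Averaging over the time grid *)

Section tonelli.
Context {d1 d2} {T1 : measurableType d1} {T2 : measurableType d2} {R : realType}.
Variables (mu : {sigma_finite_measure set T1 -> \bar R}) (m : {measure set T2 -> \bar R}).
Hypothesis sm : sigma_finite setT m.
Local Open Scope ereal_scope.

(** Sigma-finiteness of [m] is a proposition, while the Fubini-Tonelli lemmas expect it in the
    structure of the measure. *)
Let sm_packed : exists m' : {sigma_finite_measure set T2 -> \bar R},
  forall A, m' A = m A.
Proof.
have sf : sfinite_measure m by exact: sfinite_measure_sigma_finite.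
pose H1 := isSFinite.Build _ _ _ (Measure.sort m) sf.
pose H2 := isSigmaFinite.Build _ _ _ (Measure.sort m) sm.
pose m' := HB.pack_for (SigmaFiniteMeasure.type T2 R) (Measure.sort m) H1 H2.
by exists m'.
Qed.

Lemma measurable_integral_snd (f : T1 * T2 -> \bar R) : measurable_fun setT f ->
  (forall z, 0 <= f z) -> measurable_fun setT (fun x => \int[m]_y f (x, y)).
Proof.
move=> mf f0; have [m' m'E] := sm_packed.
rewrite (_ : (fun x => _) = fun x => \int[m']_y f (x, y)).
  exact: (measurable_fun_fubini_tonelli_F (m2 := m') f mf f0).
by apply/funext => x; apply: eq_measure_integral => A _ _; exact/esym/m'E.
Qed.

Let fD (D : set T1) (f : T1 * T2 -> \bar R) z := if z.1 \in D then f z else 0.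

Let mfD D f : measurable D -> measurable_fun setT f -> measurable_fun setT (fD D f).
Proof.
move=> mD mf; apply: measurable_fun_ifT => //.
exact: (measurableT_comp (measurable_fun_mem mD) measurable_fst).
Qed.

Let fD0 D f z : (forall z, 0 <= f z) -> 0 <= fD D f z.
Proof. by move=> f0; rewrite /fD; case: ifP. Qed.

Let fDE D f y : \int[mu]_(x in D) f (x, y) = \int[mu]_x fD D f (x, y).
Proof. by rewrite integral_mkcond; apply: eq_integral => x _; rewrite /patch /fD. Qed.

Lemma measurable_integral_fst (D : set T1) (f : T1 * T2 -> \bar R) : measurable D ->
  measurable_fun setT f -> (forall z, 0 <= f z) ->
  measurable_fun setT (fun y => \int[mu]_(x in D) f (x, y)).
Proof.
move=> mD mf f0; rewrite (_ : (fun y => _) = fun y => \int[mu]_x fD D f (x, y)); last exact/funext.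
by apply: measurable_fun_fubini_tonelli_G; [exact: mfD|move=> z; exact: fD0].
Qed.

Lemma tonelli_setT_l (D : set T1) (f : T1 * T2 -> \bar R) : measurable D -> measurable_fun setT f ->
  (forall z, 0 <= f z) ->
  \int[mu]_(x in D) \int[m]_y f (x, y) = \int[m]_y \int[mu]_(x in D) f (x, y).
Proof.
move=> mD mf f0; have [m' m'E] := sm_packed.
have mm' g : \int[m]_y g y = \int[m']_y g y by apply: eq_measure_integral => A _ _; exact/esym/m'E.
have E1 : \int[mu]_(x in D) \int[m]_y f (x, y) = \int[mu]_x \int[m']_y fD D f (x, y).
  rewrite integral_mkcond; apply: eq_integral => x _.
  rewrite /patch /fD /=; case: ifP => _; first exact: mm'.
  by rewrite integral0.
have E2 : \int[m]_y \int[mu]_(x in D) f (x, y) = \int[m']_y \int[mu]_x fD D f (x, y).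
  by rewrite mm'; apply: eq_integral => y _; exact: fDE.
by rewrite E1 E2 (fubini_tonelli (fD D f)) => [//||z]; [exact: mfD|exact: fD0].
Qed.

End tonelli.

Section averaging.
Context {R : realType}.
Local Notation mu := (@lebesgue_measure R).

Definition shift (a x : R) : measurableTypeR R := x + a.

Let measurable_shift a : measurable_fun setT (shift a).
Proof. exact: measurable_funD. Qed.

Lemma lebesgue_measure_shift (a : R) (A : set R) : measurable A ->
  pushforward mu (shift a) A = mu A.
Proof.
move=> mA; apply: esym; apply: (@lebesgue_measure_unique R (pushforward mu (shift a)))  => //=; first exact: measurable_shift.
move=> ? _ [[b c]] _ <-.
rewrite /pushforward (_ : _ @^-1` _ = `]b - a, c - a]%classic).
  by rewrite /= !lebesgue_measure_itv/= !lte_fin ltrD2r; case: ifP => // _; rewrite -!EFinD; congr EFin; ring.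
by apply/seteqP; split => x /=; rewrite /shift !in_itv/= ltrBlDr lerBrDr.
Qed.

Local Open Scope ereal_scope.

Lemma ge0_integral_shift (a s : R) (f : R -> \bar R) : measurable_fun setT f ->
  (forall x, 0 <= f x) ->
  \int[mu]_(x in `[a, (a + s)%R[) f x = \int[mu]_(x in `[0%R, s[) f (shift a x).
Proof.
move=> mf f0.
have -> : `[0%R, s[%classic = shift a @^-1` `[a, (a + s)%R[.
  by apply/seteqP; split => x /=; rewrite /shift !in_itv/= lerDr (addrC a) ltrD2r.
pose mu' : {measure set (measurableTypeR R) -> \bar R} := lebesgue_measure.
pose sh : measurableTypeR R -> measurableTypeR R := shift a.
have msh : measurable_fun setT sh by exact: measurable_shift.
rewrite -[RHS]/(\int[mu']_(x in sh @^-1` _) (f \o sh) x) -ge0_integral_pushforward//=.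
- by apply: eq_measure_integral => //= A mA AS; exact/esym/lebesgue_measure_shift.
- exact: measurable_funTS.
Qed.

Lemma integral_periodic_sum (s : R) (n : nat) (f : R -> \bar R) : (0 <= s)%R -> measurable_fun setT f ->
  (forall x, 0 <= f x) ->
  \int[mu]_(x in `[0%R, (n%:R * s)%R[) f x =
   \int[mu]_(x in `[0%R, s[) \sum_(k < n) f (shift (k%:R * s) x).
Proof.
move=> s0 mf f0.
have mfk (k : nat) : measurable_fun setT (fun x => f (shift (k%:R * s) x)).
  exact: (measurableT_comp mf (measurable_shift _)).
elim: n => [|n ih].
  rewrite mul0r set_itvco0 integral_set0 integral0_eq// => x _; by rewrite big_ord0.
have ns0 : (0 <= n%:R * s)%R by rewrite mulr_ge0.
rewrite -natr1 mulrDl mul1r.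
have -> : `[0%R, (n%:R * s + s)%R[%classic = `[0%R, (n%:R * s)%R[ `|` `[(n%:R * s)%R, (n%:R * s + s)%R[ :> set R.
  apply/seteqP; split => x /=; rewrite !in_itv/=; last by case=> /andP[h1 h2]; apply/andP; split; lra.
  by move=> /andP[h1 h2]; have [h|h] := ltP x (n%:R * s)%R; [left|right]; rewrite ?h1 ?h2.
rewrite ge0_integral_setU//; last 2 first.
- exact: measurable_funTS.
- by apply/disj_setPS => x /= []; rewrite !in_itv/= => /andP[_ h] /andP[h' _]; move: h; rewrite ltNge h'.
rewrite ih ge0_integral_shift// -ge0_integralD//; last 3 first.
- by move=> x _; apply: sume_ge0.
- by apply: measurable_funTS; apply: emeasurable_sum => k _; exact: (mfk k).
- by apply: measurable_funTS; exact: (mfk n).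
by apply: eq_integral => x _; rewrite big_ord_recr.
Qed.

(** Superposing the [n + 1] cells of length [T / (n+1)] turns the integral into one over the offset
    of grid sums. A bound uniform in the offset does the work of Riemann sums, which would call for
    regularity in time. *)
Lemma average_le (T M : R) (n : nat) (f : R -> \bar R) : (0 < T)%R -> measurable_fun setT f ->
  (forall x, 0 <= f x) ->
  (forall x : R, (0 <= x)%R -> \sum_(k < n.+1) f (k%:R * (T / n.+1%:R) + x)%R <= M%:E) ->
  \int[mu]_(x in `[0%R, T[) f x <= (T / n.+1%:R * M)%:E.
Proof.
move=> T0 mf f0 fM; have s0 : (0 < T / n.+1%:R)%R by rewrite divr_gt0.
rewrite (_ : T = n.+1%:R * (T / n.+1%:R))%R; last by rewrite mulrC divfK.
set s := (T / n.+1%:R)%R in s0 fM *.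
rewrite (_ : (n.+1%:R * s / n.+1%:R = s)%R); last by rewrite mulrC mulKf.
rewrite integral_periodic_sum// ?(ltW s0)//.
apply: (@le_trans _ _ (\int[mu]_(x in `[0%R, s[) M%:E)).
  apply: nonneg_integral_mono => x /=; first by move=> _; apply: sume_ge0.
  rewrite in_itv/= => /andP[x0 _]; apply: le_trans (fM x x0).
  by rewrite le_eqVlt (_ : _ == _)//; apply/eqP/eq_bigr => k _; rewrite /shift addrC.
by rewrite integral_cst//= lebesgue_measure_itv/= lte_fin s0 oppr0 adde0 muleC.
Qed.

End averaging.

(** * Joint measurability of the semigroup in time and space *)

Section joint_measurability.
Context {R : realType} {E : pmetricType R} {d : measure_display}
  {Omega : measurableType d}.
Variable P : R.-pker borel E^Delta ~> Omega.
Variable X : R -> Omega -> borel E^Delta.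
Hypothesis hX : hunt_process P X.
Hypotheses (lcE : locally_compact [set: E]) (sE : separable E).

Lemma measurable_semigroup_ge0_joint (tau : R -> R) (G : R * borel E -> \bar R) :
  measurable_fun setT tau -> measurable_fun setT G -> (forall z, 0 <= G z)%E ->
  measurable_fun setT (fun z : R * borel E =>
    semigroup_ge0 P X (Num.max (tau z.1) 0) (fun y => G (z.1, y)) z.2).
Proof.
move=> mtau mG G0.
pose pm (zw : (R * borel E) * Omega) := path_map X (tau zw.1.1, zw.2).
have mt : measurable_fun setT (fun zw : (R * borel E) * Omega => zw.1.1).
  exact: (measurableT_comp measurable_fst measurable_fst).
have mpm : measurable_fun setT pm.
  apply: (measurableT_comp (measurable_path_map hX lcE sE)).
  by apply: measurable_fun_pair; [exact: (measurableT_comp mtau mt)|exact: measurable_snd].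
(* The extension by 0 at the cemetery is split into the indicator [one] of [E] and a retraction to
   [E], so that [G] can be composed with the pair of time and position. *)
pose ret : borel E^Delta -> borel E := oapp id point.
pose one : borel E^Delta -> \bar R := oapp (fun=> 1%E) 0%E.
have mret : measurable_fun setT ret by exact: (measurable_ext point (@measurable_id _ _ setT)).
have mone : measurable_fun setT one by exact: (measurable_ext 0%E (@measurable_cst _ _ (borel E) _ setT 1%E)).
pose g (zw : (R * borel E) * Omega) : \bar R := (one (pm zw) * G (zw.1.1, ret (pm zw)))%E.
have gE z w : oapp (fun y => G (z.1, y)) 0%E (X (Num.max (tau z.1) 0) w) = g (z, w).
  rewrite /g /pm /path_map /one /ret /=.
  by case: (X _ _) => [y|] /=; rewrite ?mul1e ?mul0e.
have g0 zw : (0 <= g zw)%E.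
  by apply: mule_ge0 => //; rewrite /one; case: (pm zw).
have mg : measurable_fun setT g.
  apply: emeasurable_funM; first exact: (measurableT_comp mone mpm).
  apply: (measurableT_comp mG); apply: measurable_fun_pair => //.
  exact: (measurableT_comp mret mpm).
have mS : measurable_fun setT (fun z : R * borel E => Some z.2 : borel E^Delta).
  exact: (measurableT_comp measurable_Some measurable_snd).
rewrite (_ : (fun z => _) = fun z => (\int[P (Some z.2)]_w g (z, w))%E).
  exact: (measurable_kpull P mS).
by apply/funext => z; apply: eq_integral => w _; exact: gE.
Qed.

Lemma measurable_semigroup_joint (f : borel E -> R) : bmeas f ->
  measurable_fun setT (fun z : R * borel E => semigroup P X (Num.max z.1 0) f z.2).
Proof.
move=> bf.
have t0 (z : R * borel E) : 0 <= Num.max z.1 0 by rewrite le_max lexx orbT.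
have mpos g : bmeas g -> (forall x, 0 <= g x) ->
    measurable_fun setT (fun z : R * borel E => semigroup P X (Num.max z.1 0) g z.2).
  move=> bg g0; have mg : measurable_fun setT (fun z : R * borel E => (g z.2)%:E).
    by apply/measurable_EFinP; exact: (measurableT_comp bg.1 measurable_snd).
  have := measurable_semigroup_ge0_joint (@measurable_id _ _ setT) mg.
  have g20 (z : R * borel E) : (0 <= (g z.2)%:E)%E by rewrite lee_fin.
  move=> /(_ g20) h.
  rewrite (_ : (fun z => _) = fun z : R * borel E => fine (semigroup_ge0 P X (Num.max z.1 0) (EFin \o g) z.2)).
    exact: (measurableT_comp (fine_measurable measurableT) h).
  by apply/funext => z; rewrite semigroup_ge0_EFin.
rewrite (_ : (fun z => _) = fun z : R * borel E => semigroup P X (Num.max z.1 0) (fpos f) z.2 -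
    semigroup P X (Num.max z.1 0) (fneg f) z.2).
  apply: measurable_funB; apply: mpos.
  - exact: bmeas_fpos.
  - exact: fpos_ge0.
  - exact: bmeas_fneg.
  - exact: fneg_ge0.
apply/funext => z; have := semigroup_lin hX (-1) (t0 z) (bmeas_fneg bf) (bmeas_fpos bf).
move=> /(congr1 (fun h => h z.2)); rewrite mulN1r addrC => <-.
by congr (semigroup _ _ _ _ _); apply/funext => x; rewrite mulN1r addrC -fposneg.
Qed.

End joint_measurability.

(** * The square function *)

Section exhaustion.
Context {d} {T : measurableType d} {R : realType}.
Variable m : {measure set T -> \bar R}.

Lemma sigma_finite_exhaustion : sigma_finite setT m -> exists S : nat -> set T,
  [/\ forall n, measurable (S n) /\ (m (S n) < +oo)%E,
      forall a b, (a <= b)%N -> S a `<=` S b & forall x, exists n, S n x].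
Proof.
move=> [F FT mF]; exists (fun n => \big[setU/set0]_(i < n) F i); split.
- move=> n; split; first by apply: bigsetU_measurable => i _; exact: (mF i).1.
  elim: n => [|n [ih]]; first by rewrite big_ord0 measure0.
  rewrite big_ord_recr/=; apply: (@le_lt_trans _ _ (m (\big[setU/set0]_(i < n) F i) + m (F n))%E).
    by apply: measureU2; [apply: bigsetU_measurable => i _; exact: (mF i).1|exact: (mF n).1].
  by rewrite lte_add_pinfty//; exact: (mF n).2.
- by move=> a b ab; exact: subset_bigsetU.
- move=> x; have [n _ Fx] : (\bigcup_i F i) x by rewrite -FT.
  by exists n.+1; rewrite -bigcup_mkord; exists n => /=.
Qed.

Lemma bint_indic (S : set T) f : measurable S -> (m S < +oo)%E -> bmeas f ->
  bint m (fun x => f x * \1_S x).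
Proof.
move=> mS fS bf; apply: bintMl => //; apply: bint_ge0P.
- split; first exact: measurable_indic.
  by exists 1 => x; rewrite indicE; case: (_ \in _); rewrite ?normr1 ?normr0.
- by move=> x; rewrite indicE.
- by rewrite integral_indic// setIT.
Qed.

(* Testing against [h = g^(r-1)] with [g] a truncation of [F]: this [h] turns Young's inequality
   [r h c <= c^r + (r-1) g^r] into an equality at [c = g]. *)
Lemma powR_integral_le_dual (r K : R) (F : T -> \bar R) : sigma_finite setT m -> 1 <= r ->
  measurable_fun setT F -> (forall x, (0 <= F x)%E) ->
  (forall g h : T -> R, bint m g -> bint m h -> (forall x, 0 <= g x) -> (forall x, 0 <= h x) ->
    (forall x c, 0 <= c -> r * h x * c <= c `^ r + (r - 1) * g x `^ r) ->
    (r%:E * \int[m]_x ((h x)%:E * F x) <= (K + (r - 1) * \int[m]_x (g x `^ r))%:E)%E) ->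
  (\int[m]_x (F x `^ r) <= K%:E)%E.
Proof.
move=> sm r1 mF F0 H; have r0 : 0 < r by rewrite (lt_le_trans _ r1).
have rn0 : r != 0 by rewrite gt_eqF.
have [S [mS Sle Sx]] := sigma_finite_exhaustion sm.
pose tr (n : nat) x := fine (Order.min (F x) n%:R%:E).
have trE n x : (tr n x)%:E = Order.min (F x) n%:R%:E.
  have m0 : (0 <= Order.min (F x) n%:R%:E)%E by rewrite le_min F0 lee_fin ler0n.
  by apply: fineK; rewrite (ge0_fin_numE m0) gt_min ltry orbT.
have tr0 n x : 0 <= tr n x by rewrite -lee_fin trE le_min F0 lee_fin ler0n.
have btr n : bmeas (tr n).
  split.
    by apply: (measurableT_comp (fine_measurable measurableT)); apply: measurable_mine.
  by exists n%:R => x; rewrite ger0_norm// -lee_fin trE ge_min lexx orbT.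
pose g n x := tr n x * \1_(S n) x.
pose h n x := tr n x `^ (r - 1) * \1_(S n) x.
have i0 n x : 0 <= \1_(S n) x :> R by rewrite indicE.
have g0 n x : 0 <= g n x by rewrite mulr_ge0.
have h0 n x : 0 <= h n x by rewrite mulr_ge0// powR_ge0.
have bg n : bint m (g n) by apply: bint_indic => //; have [] := mS n.
have bh n : bint m (h n).
  apply: bint_indic => //; [by have [] := mS n|by have [] := mS n|].
  by apply: bmeas_powR => //; rewrite subr_ge0.
have gr n x : (g n x `^ r)%:E = (tr n x `^ r * \1_(S n) x)%:E.
  by rewrite /g indicE; case: (_ \in _); rewrite ?mulr1// !mulr0 powR0.
have gM n : (\int[m]_x (g n x `^ r)%:E <= K%:E)%E.
  have bgr := bint_powR r1 (g0 n) (bg n).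
  rewrite -Rint_EFin// lee_fin.
  have young x c : 0 <= c -> r * h n x * c <= c `^ r + (r - 1) * g n x `^ r.
    move=> c0; rewrite /h /g indicE; case: (_ \in _); rewrite ?mulr1.
      by rewrite mulrAC; exact: powR_amgm.
    by rewrite !mulr0 mul0r powR0// mulr0 addr0 powR_ge0.
  have := H _ _ (bg n) (bh n) (g0 n) (h0 n) young.
  have : (r%:E * \int[m]_x (g n x `^ r)%:E <= r%:E * \int[m]_x ((h n x)%:E * F x))%E.
    rewrite lee_wpmul2l ?lee_fin ?(ltW r0)//.
    apply: nonneg_integral_mono => x _; first by rewrite lee_fin powR_ge0.
    rewrite gr /h; case: (boolP (x \in S n)) => xS; rewrite indicE ?xS ?(negbTE xS) ?mulr1 ?mulr0.
      rewrite -mulr_powRB1// mulrC EFinM lee_wpmul2l ?lee_fin ?powR_ge0//.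
      by rewrite trE ge_min lexx.
    by rewrite mul0e.
  (* The truncation makes the integral of [g^r] finite, so [r - 1] copies of it can be subtracted
     from both sides. *)
  move=> h1 /(le_trans h1); rewrite -Rint_EFin// -EFinM lee_fin.
  by set I := \int[m]_x _ => h2; lra.
apply: (fatou_le (f_ := fun n x => (g n x `^ r)%:E) measurableT) => // [n|n x _|x _].
- by apply/measurable_EFinP; have [[]] := bint_powR r1 (g0 n) (bg n).
- by rewrite lee_fin powR_ge0.
have [N SN] := Sx x.
have gN n : (N <= n)%N -> g n x = tr n x.
  by move=> Nn; rewrite /g indicE mem_set ?mulr1//; exact: Sle SN.
case Fx : (F x) => [c| |]; last by have := F0 x; rewrite Fx.
  have c0 : 0 <= c by have := F0 x; rewrite Fx lee_fin.
  apply: cvg_near_cst; exists (maxn N (Num.truncn c).+1) => // n /=.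
  rewrite geq_max => /andP[Nn cn]; rewrite gN//; congr (_ `^ _)%:E.
  rewrite /tr Fx minEle lee_fin (_ : c <= n%:R)//.
  by rewrite (le_trans (ltW (truncnS_gt c)))// ler_nat.
rewrite poweRyr//; apply/cvgeyPge => A.
exists (maxn N (Num.truncn (Num.max A 1)).+1) => // n /=.
rewrite geq_max => /andP[Nn cn]; rewrite gN// lee_fin.
have -> : tr n x = n%:R by rewrite /tr Fx min_r// leey.
have An : Num.max A 1 <= n%:R.
  by rewrite (le_trans (ltW (truncnS_gt _)))// ler_nat.
move: An; rewrite ge_max => /andP[An n1].
by rewrite (le_trans An)// -[leLHS]powRr1 ?ler_powR.
Qed.

End exhaustion.

Lemma bint_Lfun2 {d} {T : measurableType d} {R : realType} (m : {measure set T -> \bar R}) (u : T -> R) :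
  bint m u -> u \in Lfun m 2%:E.
Proof.
move=> bu; rewrite inE; apply/andP; split; rewrite inE/=; first by case: bu => -[].
rewrite /finite_norm unlock /Lnorm poweR_lty//.
rewrite (_ : \int[m]_x _ = \int[m]_x (u x ^+ 2)%:E)%E.
  by rewrite -Rint_EFin ?ltry//; exact: bintX.
by apply: eq_integral => x _; rewrite /= (_ : `|u x| `^ 2 = `|u x| ^+ 2) ?powR_mulrn// -normrX ger0_norm ?sqr_ge0.
Qed.

Lemma chi_ge0 {R : realType} (s t : R) : 0 <= chi s t.
Proof. by rewrite /chi; case: ifP => // _; case: ifP. Qed.

Lemma chi_le1 {R : realType} (s t : R) : chi s t <= 1.
Proof. by rewrite /chi; case: ifP => // _; case: ifP => // _; rewrite invf_le1// ler1n. Qed.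

Lemma Gamma_mod_ge0 {R : realType} {E : pmetricType R} (j : R.-ker borel E ~> borel E) u x :
  (0 <= Gamma_mod j u x)%E.
Proof. by apply: integral_ge0 => y _; rewrite lee_fin mulr_ge0 ?sqr_ge0 ?chi_ge0. Qed.

Section square_function.
Context {R : realType} {E : pmetricType R}.
Variables (m : {measure set (borel E) -> \bar R}) (D : set (borel E -> R))
  (Q : (borel E -> R) -> (borel E -> R) -> R)
  (J : {measure set (borel E * borel E) -> \bar R}) (j : R.-ker borel E ~> borel E).
Context {d : measure_display} {Omega : measurableType d}.
Variables (P : R.-pker borel E^Delta ~> Omega) (X : R -> Omega -> borel E^Delta).
Hypotheses (lcE : locally_compact [set: E]) (sE : separable E) (rm : radon m).
Hypotheses (dQ : dirichlet_form m D Q) (rQ : regular_form m D Q)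
  (jJ : jumping_measure J) (kJ : jump_kernel m J j) (pJ : pure_jump m D Q J).
Hypotheses (hX : hunt_process P X) (sym : process_symmetric P X m)
  (ass : associated P X m D Q) (cons : conservative P X m).
Variables A B : nat -> set (borel E).
Hypotheses (mA : forall n, measurable (A n)) (mB : forall n, measurable (B n)).
Hypothesis AB : @off_diag R E = \bigcup_n (A n `*` B n).
Hypothesis Jfin : forall n, (J (A n `*` B n) < +oo)%E.
Variable r : R.
Hypothesis r1 : 1 <= r.

Let Pt := semigroup P X.
Let mP : markov_semigroup m Pt. Proof. exact: process_markov_semigroup. Qed.
Let sm : sigma_finite setT m. Proof. exact: radon_sigma_finite. Qed.
Let mO : measurable (@off_diag R E). Proof. exact: (measurable_off_diag mA mB AB). Qed.
Let r0 : 0 < r. Proof. by rewrite (lt_le_trans _ r1). Qed.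

Let DE u : bint m u -> D u <-> cvg (sg_form m Pt t u u @[t --> 0^'+]).
Proof.
move=> bu; rewrite (ass.1 u (bint_Lfun2 bu)).
by rewrite (_ : (fun t => approx_form P X m t u u) = fun t => sg_form m Pt t u u).
Qed.

Let QE u v : D u -> D v -> bint m u -> sg_form m Pt t u v @[t --> 0^'+] --> Q u v.
Proof. by move=> Du Dv _; exact: ass.2. Qed.

(** Times are clamped so that functions of time are defined and measurable on all of [R]. *)
Let pt (t : R) : R := Num.max t 0.
Let pt_ge0 t : 0 <= pt t. Proof. by rewrite le_max lexx orbT. Qed.
Let ptE t : 0 <= t -> pt t = t. Proof. by move=> t0; apply/max_idPl. Qed.

Definition jump_carre (u : borel E -> R) (x : borel E) : \bar R :=
  jump_int j A mB x (fun y => ((u y - u x) ^+ 2)%:E).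

Lemma jump_carre_ge0 u x : (0 <= jump_carre u x)%E.
Proof. by apply: jump_int_ge0 => y; rewrite lee_fin sqr_ge0. Qed.

Lemma measurable_jump_carre_joint (u : R * borel E -> R) : measurable_fun setT u ->
  measurable_fun setT (fun z => jump_carre (fun y => u (z.1, y)) z.2).
Proof.
move=> mu.
have mF : measurable_fun setT (fun zy : (R * borel E) * borel E =>
    ((u (zy.1.1, zy.2) - u (zy.1.1, zy.1.2)) ^+ 2)%:E).
  rewrite (_ : (fun zy => _) = fun zy => ((u (zy.1.1, zy.2) - u zy.1) ^+ 2)%:E); last first.
    by apply/funext => -[[t x] y].
  apply/measurable_EFinP; apply: measurable_funX; apply: measurable_funB.
    apply: (measurableT_comp mu); apply: measurable_fun_pair => //.
    exact: (measurableT_comp measurable_fst measurable_fst).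
  exact: (measurableT_comp mu measurable_fst).
have F0 (zy : (R * borel E) * borel E) : (0 <= ((u (zy.1.1, zy.2) - u (zy.1.1, zy.1.2)) ^+ 2)%:E)%E.
  by rewrite lee_fin sqr_ge0.
exact: (measurable_jump_int j mA mB (@measurable_snd _ _ R (borel E)) mF F0).
Qed.

Lemma measurable_jump_carre u : measurable_fun setT u -> measurable_fun setT (jump_carre u).
Proof.
move=> mu; have mu2 : measurable_fun setT (fun z : R * borel E => u z.2).
  exact: (measurableT_comp mu measurable_snd).
have h := measurable_jump_carre_joint mu2.
have p : measurable_fun setT (pair (0 : R) : borel E -> _) by exact: pair1_measurable.
exact: (measurableT_comp h p).
Qed.

(** The weight [P_t h] lies in the domain for [t > 0], which makes the limit of the discrete
    energies computable; the disintegration of [J] brings the result back to an integral over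
    [m]. *)
Lemma jump_carre_form (t : R) f h : 0 < t -> bint m f -> bint m h -> (forall x, 0 <= h x) ->
  (\int[m]_x ((Pt t h x)%:E * jump_carre (Pt t f) x) =
   (2 * Q (Pt t f) (fun x => Pt t f x * Pt t h x) - Q (fun x => Pt t f x ^+ 2) (Pt t h))%:E)%E.
Proof.
move=> t0 bf bh h0; set u := Pt t f; set k := Pt t h.
have bu : bint m u by apply: (ms_bint mP (ltW t0)).
have bk : bint m k by apply: (ms_bint mP (ltW t0)).
have k0 x : 0 <= k x by apply: (mo_ge0 (ms_op mP (ltW t0))) => //; case: bh.
have Du : D u by exact: (dom_smooth mP DE t0 bf).
have Dk : D k by exact: (dom_smooth mP DE t0 bh).
have mu := bu.1.1; have mk := bk.1.1.
rewrite (jump_energy_carre_du_champ dQ rQ jJ kJ pJ mO k0 Du Dk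
  (dom_mul mP DE QE bu bk Du Dk) (dom_sqr mP DE QE bu Du)).
have mdu := measurable_jump_energy_mul mu mk.
pose F (z : borel E * borel E) := ((u z.2 - u z.1) ^+ 2 * k z.1)%:E.
have F0 z : (0 <= F z)%E by rewrite lee_fin mulr_ge0// sqr_ge0.
have mF : measurable_fun setT F by apply/measurable_EFinP.
rewrite -[RHS]/(\int[J]_(z in off_diag) F z)%E (jump_int_disintegration mA mB AB kJ Jfin mF F0).
have mN : measurable (~` jump_good j A B) by apply: measurableC; exact: measurable_jump_good.
apply: (ge0_integral_null_set mN (jump_good_null mA mB AB kJ Jfin)) => [|x|x|x /= /contrapT Gx].
- by apply: emeasurable_funM; [exact/measurable_EFinP|exact: measurable_jump_carre].
- by rewrite mule_ge0 ?lee_fin// jump_carre_ge0.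
- by apply: jump_int_ge0.
have mg : measurable_fun setT (fun y => ((u y - u x) ^+ 2)%:E).
  by apply/measurable_EFinP; apply: measurable_funX; exact: measurable_funB.
rewrite /jump_carre (jump_intE mA mB AB Gx mg); last by move=> y; rewrite lee_fin sqr_ge0.
rewrite (jump_intE mA mB AB Gx (g := fun y => F (x, y))) => [||//]; last first.
  exact: (measurableT_comp mF (pair1_measurable x)).
have mD : measurable (~` [set x] : set (borel E)) by apply: measurableC; exact: measurable_borel_set1.
rewrite -(ge0_integralZl_EFin _ mD) //.
- by apply: eq_integral => y _; rewrite /F -EFinM mulrC.
- by move=> y _; rewrite lee_fin sqr_ge0.
- exact: measurable_funTS.
Qed.

Let mu_joint f : bmeas f -> measurable_fun setT (fun z : R * borel E => Pt (pt z.1) f z.2).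
Proof. by move=> bf; exact: (measurable_semigroup_joint hX lcE sE bf). Qed.

Let mpt : measurable_fun setT pt.
Proof. by apply: measurable_maxr => //; exact: measurable_cst. Qed.

Lemma measurable_mo_var_joint s f : 0 <= s -> bmeas f ->
  measurable_fun setT (fun z : R * borel E => mo_var (Pt s) (Pt (pt z.1) f) z.2).
Proof.
move=> s0 bf; have mu := mu_joint bf.
have bu t : bmeas (Pt (pt t) f) by exact: (ms_bmeas mP).
have mG : measurable_fun setT (fun z : R * borel E => ((Pt (pt z.1) f z.2) ^+ 2)%:E).
  by apply/measurable_EFinP; exact: measurable_funX.
have G0 (z : R * borel E) : (0 <= ((Pt (pt z.1) f z.2) ^+ 2)%:E)%E by rewrite lee_fin sqr_ge0.
have m1 := measurable_semigroup_ge0_joint hX lcE sE (@measurable_cst _ _ R R setT s) mG G0.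
have {}m1 : measurable_fun setT (fun z : R * borel E => Pt s (fun y => Pt (pt z.1) f y ^+ 2) z.2).
  apply/measurable_EFinP; move: m1; congr (measurable_fun _ _); apply/funext => z /=.
  rewrite (max_idPl s0); exact: (semigroup_ge0_EFin hX z.2 s0 (bmeasX 2 (bu z.1))).
apply: measurable_funB => //; apply: measurable_funX.
(* [P_s P_t f = P_(s+t) f] reduces this term to a shift of time. *)
have mt : measurable_fun setT (fun z : R * borel E => (s + pt z.1, z.2)).
  apply: measurable_fun_pair => //; apply: measurable_funD => //.
  exact: (measurableT_comp mpt measurable_fst).
move: (measurableT_comp mu mt); congr (measurable_fun _ _); apply/funext => z /=.
by rewrite -(msD mP)// ptE// addr_ge0.
Qed.

Lemma measurable_energy s f h : 0 <= s -> bint m f -> bint m h -> (forall x, 0 <= h x) ->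
  measurable_fun setT (fun t : R => (energy m Pt s (pt t) f h)%:E).
Proof.
move=> s0 bf bh h0.
have bu t : bint m (Pt (pt t) f) by exact: (ms_bint mP).
have bk t : bint m (Pt (pt t) h) by exact: (ms_bint mP).
have mF : measurable_fun setT (fun z : R * borel E =>
    (mo_var (Pt s) (Pt (pt z.1) f) z.2 * Pt (pt z.1) h z.2)%:E).
  apply/measurable_EFinP; apply: measurable_funM.
    exact: measurable_mo_var_joint bf.1.
  exact: (mu_joint bh.1).
have F0 (z : R * borel E) : (0 <= (mo_var (Pt s) (Pt (pt z.1) f) z.2 * Pt (pt z.1) h z.2)%:E)%E.
  rewrite lee_fin mulr_ge0//; first exact: (mo_var_ge0 (ms_op mP s0) z.2 (bu z.1).1).
  exact: (mo_ge0 (ms_op mP (pt_ge0 z.1)) bh.1 h0).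
move: (measurable_integral_snd sm mF F0); congr (measurable_fun _ _); apply/funext => t /=.
rewrite /energy Rint_EFin//; apply: bintM => //.
exact: (bint_mo_var (ms_op mP s0) (bu t)).
Qed.

Lemma energy_ge0 s t f h : 0 <= s -> 0 <= t -> bint m f -> bint m h -> (forall x, 0 <= h x) ->
  0 <= energy m Pt s t f h.
Proof.
move=> s0 t0 bf bh h0; apply: Rint_ge0 => x.
rewrite mulr_ge0//; last exact: (mo_ge0 (ms_op mP t0) bh.1 h0).
exact: (mo_var_ge0 (ms_op mP s0) x (ms_bint mP t0 bf).1).
Qed.

(** * The linear estimate for bounded integrable functions *)

Section young_pair.
Variables f g h : borel E -> R.
Hypotheses (bf : bint m f) (bg : bint m g) (bh : bint m h).
Hypotheses (g0 : forall x, 0 <= g x) (h0 : forall x, 0 <= h x).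
Hypothesis young : forall x c, 0 <= c -> r * h x * c <= c `^ r + (r - 1) * g x `^ r.

Let K := r `^ r * \int[m]_x (f x ^+ 2) `^ r + (r - 1) * \int[m]_x (g x `^ r).

Let pair t := (\int[m]_x ((Pt (pt t) h x)%:E * jump_carre (Pt (pt t) f) x))%E.

Lemma measurable_pair : measurable_fun setT pair.
Proof.
apply: (measurable_integral_snd sm (f := fun z => ((Pt (pt z.1) h z.2)%:E * jump_carre (Pt (pt z.1) f) z.2)%E)).
  apply: emeasurable_funM; first by apply/measurable_EFinP; exact: (mu_joint bh.1).
  exact: (measurable_jump_carre_joint (mu_joint bf.1)).
by move=> z; rewrite mule_ge0 ?jump_carre_ge0// lee_fin; exact: (mo_ge0 (ms_op mP (pt_ge0 z.1)) bh.1 h0).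
Qed.

Lemma pair_ge0 t : (0 <= pair t)%E.
Proof.
apply: integral_ge0 => x _.
by rewrite mule_ge0 ?jump_carre_ge0// lee_fin; exact: (mo_ge0 (ms_op mP (pt_ge0 t)) bh.1 h0).
Qed.

Let step (T : R) n := T / n.+1%:R.

Let step_cvg T : 0 < T -> step T @ \oo --> 0^'+.
Proof.
move=> T0 U [e /= e0 eU].
suff: \forall n \near \oo, U (step T n) by [].
have eT : 0 < e / T by rewrite divr_gt0.
near=> n.
have s0 : 0 < step T n by rewrite divr_gt0.
apply: (eU _ _ s0); rewrite /ball_ /= sub0r normrN gtr0_norm// /step mulrC -ltr_pdivlMr//.
near: n; exact: near_infty_natSinv_lt (PosNum eT).
Unshelve. all: by end_near. Qed.

Lemma pair_cvg T t : 0 < T -> 0 < t ->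
  (fun n => ((step T n)^-1 * energy m Pt (step T n) (pt t) f h)%:E) @ \oo --> pair t.
Proof.
move=> T0 t0; rewrite /pair (ptE (ltW t0)) (jump_carre_form t0 bf bh h0).
apply: cvg_EFin; first exact: nearW.
have bu : bint m (Pt t f) by exact: (ms_bint mP (ltW t0) bf).
have bk : bint m (Pt t h) by exact: (ms_bint mP (ltW t0) bh).
have Du : D (Pt t f) by exact: (dom_smooth mP DE t0 bf).
have Dk : D (Pt t h) by exact: (dom_smooth mP DE t0 bh).
exact: (cvg_comp _ _ (step_cvg T0) (sg_var_cvg mP DE QE bu bk Du Dk)).
Qed.

(** Fatou as the grid is refined: [energy_sum] and [average_le] bound the discrete integrals by [K].
    The left end is open because the convergence relies on [P_t f] being in the domain, known for
    [t > 0]. *)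
Lemma pair_integral_le T : 0 < T ->
  (\int[lebesgue_measure]_(t in `]0%R, T[) (r%:E * pair t) <= K%:E)%E.
Proof.
move=> T0.
have s0 n : 0 < step T n by rewrite divr_gt0.
have me n := measurable_energy (ltW (s0 n)) bf bh h0.
have e0 n t : 0 <= energy m Pt (step T n) (pt t) f h by exact: energy_ge0 (ltW (s0 n)) (pt_ge0 t) bf bh h0.
pose c n := r * (step T n)^-1.
have c0 n : 0 <= c n by rewrite mulr_ge0 ?invr_ge0// ltW.
pose F n (t : R) : \bar R := ((c n)%:E * (energy m Pt (step T n) (pt t) f h)%:E)%E.
have F0 n t : (0 <= F n t)%E by rewrite mule_ge0// lee_fin.
have mF n : measurable_fun setT (F n) by exact: measurable_funeM.
apply: (@fatou_le _ (measurableTypeR R) R lebesgue_measure _ F) => // [n|t /=|n].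
- exact: (measurable_funTS (mF n)).
- rewrite in_itv/= => /andP[t0 _].
  rewrite (_ : F ^~ t = fun n => (r%:E * ((step T n)^-1 * energy m Pt (step T n) (pt t) f h)%:E)%E); last first.
    by apply/funext => n; rewrite /F /c -!EFinM mulrA.
  by apply: cvgeZl => //; exact: pair_cvg.
- apply: (@le_trans _ _ (\int[lebesgue_measure]_(t in `[0%R, T[) F n t)%E).
    apply: ge0_subset_integral => //; first exact: (measurable_funTS (mF n)).
    by move=> t /=; rewrite !in_itv/= => /andP[/ltW -> ->].
  (* With step [s], averaging gives [s * (r / s) * (r^-1 K) = K]. *)
  have := @average_le R T (c n * (r^-1 * K)) n (F n) T0 (mF n) (F0 n).
  rewrite (_ : T / n.+1%:R * _ = K); last first.
    by rewrite -/(step T n) /c; field; rewrite !gt_eqF.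
  apply => t t0; rewrite /F.
  under eq_bigr => k _ do rewrite -EFinM.
  rewrite sumEFin lee_fin -mulr_sumr ler_wpM2l// -ler_pdivrMl ?invr_gt0// invrK.
  apply: le_trans (energy_sum mP n r1 (ltW (s0 n)) t0 bf bh bg g0 h0 young).
  rewrite ler_wpM2l ?(ltW r0)// le_eqVlt; apply/orP; left; apply/eqP.
  apply: eq_bigr => k _.
  have h' : 0 <= k%:R * (T / n.+1%:R) + t by rewrite addr_ge0// mulr_ge0// divr_ge0// ltW.
  by rewrite (ptE h').
Qed.

Lemma pair_integral_ray_le :
  (\int[lebesgue_measure]_(t in `]0%R, +oo[) (r%:E * pair t) <= K%:E)%E.
Proof.
have mp : measurable_fun setT (fun t => r%:E * pair t)%E.
  by apply: measurable_funeM; exact: measurable_pair.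
have p0 t : (0 <= r%:E * pair t)%E by rewrite mule_ge0 ?pair_ge0// lee_fin ltW.
pose F (n : nat) : R -> \bar R := ((fun t => r%:E * pair t) \_ `]0%R, n.+1%:R[)%E.
have F0 n t : (0 <= F n t)%E by rewrite /F /patch; case: ifP.
apply: (@fatou_le _ (measurableTypeR R) R lebesgue_measure _ F) => // [n|t /=|n].
- by apply: measurable_funTS; apply/(measurable_restrictT _ (measurable_itv _)); exact: measurable_funTS.
- rewrite in_itv/= andbT => t0; apply: cvg_near_cst.
  exists (Num.truncn t) => // n /= tn; rewrite /F patchT//.
  by rewrite inE /= in_itv/= t0 (lt_le_trans (truncnS_gt t))// ler_nat.
- rewrite /F -integral_mkcondr.
  apply: le_trans (pair_integral_le (ltr0Sn _ n)).
  rewrite (_ : _ `&` _ = `]0, n.+1%:R[%classic)//.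
  by apply/setIidr => t /=; rewrite !in_itv/= => /andP[->].
Qed.

End young_pair.

(** * Passage from bounded integrable functions to [f] with finite [2r]-th moment *)

Section approximation.
Variable f : borel E -> R.
Hypothesis mf : measurable_fun setT f.
Hypothesis fr : (\int[m]_x (`|f x| `^ (2 * r))%:E < +oo)%E.
Variable S : nat -> set (borel E).
Hypotheses (mS : forall n, measurable (S n) /\ (m (S n) < +oo)%E)
  (Sle : forall a b, (a <= b)%N -> S a `<=` S b) (Sx : forall x, exists n, S n x).

Let fn (n : nat) x := Num.max (- n%:R) (Num.min (f x) n%:R) * \1_(S n) x.

Let fn_bint n : bint m (fn n).
Proof.
have [mSn fSn] := mS n.
apply: bint_indic => //; split.
  apply: measurable_maxr; first exact: measurable_cst.
  by apply: measurable_minr => //; exact: measurable_cst.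
exists n%:R => x; rewrite ler_norml le_max lexx/= ge_max ge_min lexx orbT andbT.
by rewrite (@le_trans _ _ 0)// oppr_le0.
Qed.

Let fn_le n x : `|fn n x| <= `|f x|.
Proof.
rewrite /fn normrM indicE; case: (_ \in _); rewrite ?normr0 ?mulr0// normr1 mulr1.
have n0 : 0 <= n%:R :> R by [].
case: (leP (f x) n%:R) => h1; case: (leP (- n%:R)) => h2; rewrite ?normrN ?(ger0_norm n0)//.
- by rewrite ltr0_norm; lra.
- by rewrite gtr0_norm ?(ltW h1)//; exact: le_lt_trans h1.
- by rewrite gtr0_norm ?(ltW h1)//; exact: le_lt_trans h1.
Qed.

Let fn_cvg x : (fn ^~ x) @ \oo --> f x.
Proof.
have [N SN] := Sx x; apply: cvg_near_cst.
exists (maxn N (Num.truncn `|f x|).+1) => // n /=; rewrite geq_max => /andP[Nn fn'].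
have h : `|f x| <= n%:R by rewrite (le_trans (ltW (truncnS_gt _)))// ler_nat.
rewrite /fn indicE mem_set ?mulr1; last exact: Sle SN.
by move: h; rewrite ler_norml => /andP[h1 h2]; rewrite min_l// max_r.
Qed.

Let fn_powR_le n : \int[m]_x (fn n x ^+ 2) `^ r <= fine (\int[m]_x (`|f x| `^ (2 * r))%:E).
Proof.
rewrite -lee_fin Rint_EFin; last first.
  by apply: bint_powR => // [x|]; [exact: sqr_ge0|exact: bintX].
rewrite fineK; last by rewrite ge0_fin_numE//; apply: integral_ge0 => x _; rewrite lee_fin powR_ge0.
apply: nonneg_integral_mono => x _; rewrite lee_fin ?powR_ge0//.
rewrite powRrM powR_mulrn// ge0_ler_powR ?nnegrE ?sqr_ge0 ?exprn_ge0// ?(ltW r0)//.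
by rewrite -[leLHS]ger0_norm ?sqr_ge0// normrX lerXn2r ?nnegrE.
Qed.

Let absP (z : R * borel E) := semigroup_ge0 P X (pt z.1) (fun y => `|f y|%:E) z.2.

Let mabs : measurable_fun setT (fun y => `|f y|%:E).
Proof. by apply/measurable_EFinP; exact: measurableT_comp. Qed.

Let absP_ge0 z : (0 <= absP z)%E.
Proof. by apply: semigroup_ge0_ge0 => x; rewrite lee_fin. Qed.

Let mabsP : measurable_fun setT absP.
Proof.
have mG : measurable_fun setT (fun z : R * borel E => `|f z.2|%:E).
  exact: (measurableT_comp mabs measurable_snd).
by apply: (measurable_semigroup_ge0_joint hX lcE sE (@measurable_id _ _ setT) mG) => z; rewrite lee_fin.
Qed.

(** Off this set [|f|] dominates and [P_t (fn n)] converges to [P_t f]; on it the real-valued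
    [semigroup] carries no information. *)
Let Inf : set (R * borel E) := absP @^-1` [set +oo%E].

Let mInf : measurable Inf.
Proof. by rewrite -[Inf]setTI; apply: mabsP => //; exact: measurable_set1. Qed.

Let mI : measurable_fun setT (\1_Inf : _ -> R).
Proof. by apply: measurable_indic. Qed.

Let mpair t (U : set (R * borel E)) : measurable U -> measurable [set x | U (t, x)].
Proof.
move=> mU; have p : measurable_fun setT (pair t : borel E -> _) by exact: pair1_measurable.
by have := p measurableT _ mU; rewrite setTI.
Qed.

Lemma semigroup_ge0_integral_le t (g : borel E -> \bar R) : 0 <= t ->
  measurable_fun setT g -> (forall x, (0 <= g x)%E) ->
  (\int[m]_x semigroup_ge0 P X t g x <= \int[m]_x g x)%E.
Proof.
move=> t0 mg g0.
have m1 : measurable_fun [set: borel E] (cst 1%E : borel E -> \bar R) by exact: measurable_cst.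
have := sym t0 m1 mg (fun=> lee01) g0.
rewrite (_ : (fun x => _) = semigroup_ge0 P X t g); last by apply/funext => x; rewrite mul1e.
move=> ->; apply: nonneg_integral_mono => x _.
  by rewrite mule_ge0// semigroup_ge0_ge0// => y; exact: lee01.
rewrite -[leRHS]mul1e lee_wpmul2r//.
have -> : semigroup_ge0 P X t (cst 1%E) x = (semigroup P X t (cst 1) x)%:E.
  by rewrite -(semigroup_ge0_EFin hX x t0 (bmeas_cst 1)).
by rewrite lee_fin; exact: (semigroup_le1 hX x t0).
Qed.

(** From [|f| <= 1 + |f|^(2r)] and total mass 1 of the path measures, [P_t |f| <= 1 + P_t |f|^(2r)],
    whose last term is integrable. *)
Let Inf_null t : m [set x | Inf (t, x)] = 0%E.
Proof.
pose g (y : borel E) : \bar R := (`|f y| `^ (2 * r))%:E.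
have mg : measurable_fun setT g.
  apply/measurable_EFinP; apply: (measurableT_comp (measurable_powR _)).
  exact: measurableT_comp.
have g0 y : (0 <= g y)%E by rewrite lee_fin powR_ge0.
pose h := semigroup_ge0 P X (pt t) g.
have mh : measurable_fun setT h by exact: (measurable_semigroup_ge0 hX (pt_ge0 t) mg g0).
have h0 x : (0 <= h x)%E by exact: semigroup_ge0_ge0.
have ih : m.-integrable setT h.
  apply/integrableP; split => //.
  rewrite (_ : \int[m]_x `|h x| = \int[m]_x h x)%E; last by apply: eq_integral => x _; rewrite gee0_abs.
  by apply: le_lt_trans fr; exact: semigroup_ge0_integral_le.
apply: measure_negligible; first exact: mpair.
apply: negligibleS (integrable_ae measurableT ih) => x /= hx nx.
have {nx} hfin : h x \is a fin_num by exact: nx.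
move: hx; rewrite /Inf /absP /=; apply/eqP; rewrite lt_eqF//.
apply: (@le_lt_trans _ _ (1 + h x)%E); last by rewrite ltey_eq fin_numD hfin.
have mex (k : borel E -> \bar R) : measurable_fun setT k ->
    measurable_fun setT (fun w => oapp k 0%E (X (pt t) w)).
  by move=> mk; exact: (measurable_ext_path hX 0%E (pt_ge0 t) mk).
rewrite (_ : 1 + h x = \int[P (Some x)]_w (1 + oapp g 0 (X (pt t) w)))%E; last first.
  rewrite ge0_integralD//; [|by move=> w _; exact: ext_ge0|exact: mex].
  by rewrite integral_cst// mul1e prob_kernel.
apply: nonneg_integral_mono => w _; first by apply: ext_ge0 => y; rewrite lee_fin.
case: (X (pt t) w) => [y|] /=; last by rewrite adde0 lee01.
rewrite -EFinD lee_fin; have [f1|f1] := leP `|f y| 1.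
  by rewrite (le_trans f1)// lerDl powR_ge0.
have h2 : `|f y| <= `|f y| `^ (2 * r).
  by rewrite -[leLHS]powRr1 ?ler_powR ?(ltW f1)//; have := r1; lra.
by rewrite (le_trans h2)// lerDr.
Qed.

Let semigroup_fn_cvg t x : 0 <= t -> ~ Inf (t, x) -> Pt t (fn n) x @[n --> \oo] --> Pt t f x.
Proof.
move=> t0 nI.
have fin : (absP (t, x) < +oo)%E by rewrite ltey; apply/eqP.
have mex (k : borel E -> R) : measurable_fun setT k -> measurable_fun setT (fun w => oapp k 0 (X t w)).
  by move=> mk; exact: (@measurable_ext_path _ _ _ _ _ _ hX _ R (0 : R) k t t0 mk).
have absE w : (`|oapp f 0 (X t w)|)%:E = oapp (fun y => `|f y|%:E) 0%E (X t w).
  by case: (X t w) => //=; rewrite normr0.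
have ig : (P (Some x)).-integrable setT (fun w => `|oapp f 0 (X t w)|%:E).
  apply/integrableP; split.
    by apply/measurable_EFinP; apply: measurableT_comp => //; exact: mex.
  move: fin; rewrite /absP /= (ptE t0); congr (_ < _)%E.
  by apply: eq_integral => w _; rewrite -absE /= normr_id.
apply: (@fine_cvg _ _ _ _ (fun n => \int[P (Some x)]_w (oapp (fn n) 0 (X t w))%:E)%E).
rewrite /Pt /semigroup /Rintegral fineK; last first.
  apply: integrable_fin_num => //; apply: le_integrable ig => //.
    by apply/measurable_EFinP; exact: mex.
  by move=> w _ /=; rewrite normr_id.
apply: (@dominated_cvg _ _ _ (P (Some x)) setT measurableT _ _ (fun w => `|oapp f 0 (X t w)|%:E)) => //.
- by move=> n; apply/measurable_EFinP; apply: mex; exact: (fn_bint n).1.1.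
- move=> w _; apply: cvg_EFin; first exact: nearW.
  case: (X t w) => [y|] /=; first exact: fn_cvg.
  exact: cvg_cst.
- move=> n w _ /=; rewrite lee_fin; case: (X t w) => [y|] /=; first exact: fn_le.
  by rewrite normr0.
Qed.

(** The mass that jumps from [x] give to [Inf] at time [t], written with [jump_int] for joint
    measurability. *)
Let badJ (z : R * borel E) : \bar R := jump_int j A mB z.2 (fun y => (\1_Inf (z.1, y))%:E).

Let badJ_ge0 z : (0 <= badJ z)%E.
Proof. by apply: jump_int_ge0 => y; rewrite lee_fin. Qed.

Let mbadJ : measurable_fun setT badJ.
Proof.
have mp : measurable_fun setT (fun zy : (R * borel E) * borel E => (zy.1.1, zy.2)).
  by apply: measurable_fun_pair => //; exact: (measurableT_comp measurable_fst measurable_fst).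
have mF : measurable_fun setT (fun zy : (R * borel E) * borel E => (\1_Inf (zy.1.1, zy.2))%:E : \bar R).
  apply/measurable_EFinP; exact: (measurableT_comp mI mp).
have F0 (zy : (R * borel E) * borel E) : (0 <= (\1_Inf (zy.1.1, zy.2))%:E :> \bar R)%E by rewrite lee_fin.
exact: (measurable_jump_int j mA mB (@measurable_snd _ _ R (borel E)) mF F0).
Qed.

(* Where [Gamma_mod] of [P_t f] is not controlled by the approximations [P_t (fn n)]; this set is
   null at each time, so a majorant of the square function may be [+oo] there. *)
Let Bad : set (R * borel E) := Inf `|` [set z | ~ jump_good j A B z.2] `|` [set z | (0 < badJ z)%E].

Let mBad : measurable Bad.
Proof.
apply: measurableU; first apply: measurableU => //.
  have mG : measurable (~` jump_good j A B) by apply: measurableC; exact: measurable_jump_good.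
  by have := @measurable_snd _ _ R (borel E) measurableT _ mG; rewrite setTI.
by rewrite -[[set z | _]]setTI; exact: emeasurable_fun_o_infty.
Qed.

Let Bad_null t : m [set x | Bad (t, x)] = 0%E.
Proof.
have mt1 := mpair t mInf.
apply: measure_negligible; first exact: mpair.
rewrite (_ : [set x | _] = [set x | Inf (t, x)] `|` ~` jump_good j A B `|` [set x | (0 < badJ (t, x))%E])//.
apply: negligibleU; first apply: negligibleU.
- by apply/negligibleP => //; exact: Inf_null.
- apply/negligibleP; first by apply: measurableC; exact: measurable_jump_good.
  exact: (jump_good_null mA mB AB kJ Jfin).
have p : measurable_fun setT (pair t : borel E -> _) by exact: pair1_measurable.
have mb : measurable_fun setT (fun x => badJ (t, x)) by exact: (measurableT_comp mbadJ p).
have mF : measurable_fun setT (fun z : borel E * borel E => (\1_Inf (t, z.2))%:E : \bar R).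
  apply/measurable_EFinP.
  exact: (measurableT_comp mI (measurableT_comp p measurable_snd)).
have F0 (z : borel E * borel E) : (0 <= (\1_Inf (t, z.2))%:E :> \bar R)%E by rewrite lee_fin.
have I0 : (\int[m]_x `|badJ (t, x)| = 0)%E.
  rewrite (_ : \int[m]_x _ = \int[m]_x badJ (t, x))%E; last first.
    by apply: eq_integral => x _; rewrite gee0_abs.
  rewrite /badJ /= -(jump_int_disintegration mA mB AB kJ Jfin mF F0).
  have mN : measurable [set z : borel E * borel E | Inf (t, z.2)].
    rewrite -[[set z | _]]setTI.
    exact: (@measurable_snd _ _ (borel E) (borel E) measurableT _ mt1).
  rewrite (_ : (fun z => _) = fun z : borel E * borel E => (\1_[set z | Inf (t, z.2)] z)%:E).
    rewrite integral_indic// setIC; exact: (jump_null_snd jJ kJ mO mt1 (Inf_null t)).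
  by apply/funext => z; rewrite !indicE.
have [N [mN N0 NS]] := (ae_eq_integral_abs m measurableT mb).1 I0.
exists N; split => // x /= bx; apply: NS => /= h.
by move: bx; rewrite (h I) ltxx.
Qed.

Let gk n (z : R * borel E) := jump_carre (Pt (pt z.1) (fn n)) z.2.

Let mgk n : measurable_fun setT (gk n).
Proof. exact: (measurable_jump_carre_joint (mu_joint (fn_bint n).1)). Qed.

Let gk_ge0 n z : (0 <= gk n z)%E. Proof. exact: jump_carre_ge0. Qed.

Let ginf N z := einfs (gk ^~ z) N.

Let mginf N : measurable_fun setT (ginf N).
Proof. exact: measurable_fun_einfs. Qed.

Let ginf_ge0 N z : (0 <= ginf N z)%E.
Proof. by apply: le_ereal_inf_tmp => _ [n _ <-]; exact: gk_ge0. Qed.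

Let ginf_le N z : (ginf N z <= gk N z)%E.
Proof. by apply: ereal_inf_lbound; exists N => /=. Qed.

Let glim z := limn_einf (gk ^~ z).

Let ginf_cvg z : ginf ^~ z @ \oo --> glim z.
Proof. by rewrite /glim limn_einf_lim; exact: is_cvg_einfs. Qed.

Let mglim : measurable_fun setT glim.
Proof. by apply: (emeasurable_fun_cvg ginf) => // z _; exact: ginf_cvg. Qed.

Let glim_ge0 z : (0 <= glim z)%E.
Proof.
rewrite /glim limn_einf_lim; apply: lime_ge; first exact: is_cvg_einfs.
by apply: nearW => n; exact: (ginf_ge0 n z).
Qed.

Let maj z := if z \in Bad then +oo%E else glim z.

Let mmaj : measurable_fun setT maj.
Proof.
by apply: measurable_fun_ifT => //; exact: measurable_fun_mem.
Qed.

Let maj_ge0 z : (0 <= maj z)%E. Proof. by rewrite /maj; case: ifP. Qed.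

(** Off [Bad], [Inf] at time [t] is [j x]-null away from [x], so [P_t (fn n)] converges at [x] and
    almost everywhere for [j x]; Fatou under [j x] concludes, with [chi <= 1]. *)
Let Gamma_mod_le t x : 0 < t -> (Gamma_mod j (Pt t f) x <= maj (t, x))%E.
Proof.
move=> t0; rewrite /maj; case: ifPn => [_|/negP nB]; first exact: leey.
have {}nB : ~ Bad (t, x) by move=> h; apply: nB; rewrite inE.
have nI : ~ Inf (t, x) by move=> h; apply: nB; left; left.
have Gx : jump_good j A B x by apply: contrapT => h; apply: nB; left; right.
have bJ : badJ (t, x) = 0%E.
  apply/eqP; rewrite eq_le badJ_ge0 andbT leNgt; apply/negP => h; by apply: nB; right.
have mD : measurable (~` [set x] : set (borel E)) by apply: measurableC; exact: measurable_borel_set1.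
have mt1 := mpair t mInf.
pose N := [set y | Inf (t, y)] `&` ~` [set x].
have mN : measurable N by exact: measurableI.
have jN : j x N = 0%E.
  have p : measurable_fun setT (pair t : borel E -> _) by exact: pair1_measurable.
  have mi : measurable_fun setT (fun y => (\1_Inf (t, y))%:E : \bar R).
    by apply/measurable_EFinP; exact: (measurableT_comp mI p).
  rewrite -bJ /badJ (jump_intE mA mB AB Gx mi) => [|y]; last by rewrite lee_fin.
  rewrite (_ : (fun y => _) = fun y => (\1_[set y | Inf (t, y)] y)%:E).
    by rewrite integral_indic.
  by apply/funext => y; rewrite !indicE.
have pn n : measurable_fun setT (Pt t (fn n)) by have [] := ms_bmeas mP (ltW t0) (fn_bint n).1.
pose a n y : \bar R := ((Pt t (fn n) y - Pt t (fn n) x) ^+ 2)%:E.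
have ma n : measurable_fun setT (a n).
  by apply/measurable_EFinP; apply: measurable_funX; exact: measurable_funB.
have a0 n y : (0 <= a n y)%E by rewrite lee_fin sqr_ge0.
have mla : measurable_fun setT (fun y => limn_einf (a ^~ y)).
  apply: (emeasurable_fun_cvg (fun n y => einfs (a ^~ y) n)); first exact: measurable_fun_einfs.
  by move=> y _; rewrite limn_einf_lim; exact: is_cvg_einfs.
have la0 y : (0 <= limn_einf (a ^~ y))%E.
  rewrite limn_einf_lim; apply: lime_ge; first exact: is_cvg_einfs.
  by apply: nearW => n; apply: le_ereal_inf_tmp => _ [k _ <-]; exact: a0.
pose b y := if y \in [set y | Inf (t, y)] then +oo%E else limn_einf (a ^~ y).
have mb : measurable_fun setT b.
  by apply: measurable_fun_ifT => //; exact: (measurable_fun_mem mt1).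
have b0 y : (0 <= b y)%E by rewrite /b; case: ifP.
apply: (@le_trans _ _ (\int[j x]_(y in ~` [set x]) b y)%E).
  apply: nonneg_integral_mono => y _.
    by rewrite lee_fin mulr_ge0 ?sqr_ge0 ?chi_ge0.
  rewrite /b; case: ifPn => [_|/negP nIy]; first exact: leey.
  have {}nIy : ~ Inf (t, y) by move=> h; apply: nIy; rewrite inE.
  have c : a ^~ y @ \oo --> ((Pt t f y - Pt t f x) ^+ 2)%:E.
    apply: cvg_EFin; first exact: nearW.
    have cy := semigroup_fn_cvg (ltW t0) nIy; have cx := semigroup_fn_cvg (ltW t0) nI.
    rewrite (_ : fine \o _ = fun n => (Pt t (fn n) y - Pt t (fn n) x) * (Pt t (fn n) y - Pt t (fn n) x)); last first.
      by apply/funext => n /=; rewrite expr2.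
    by rewrite expr2; apply: cvgM; apply: cvgB.
  have [-> _] := cvg_limn_einf_sup c.
  by rewrite lee_fin ler_piMr ?sqr_ge0 ?chi_le1.
rewrite (ge0_negligible_integral mN mD (measurable_funTS mb) (fun y _ => b0 y) jN).
rewrite (_ : \int[j x]_(y in _) b y = \int[j x]_(y in ~` [set x] `\` N) limn_einf (a ^~ y))%E; last first.
  apply: eq_integral => y /set_mem[yx yN]; rewrite /b memNset//= => h; exact: yN.
rewrite -(ge0_negligible_integral mN mD (measurable_funTS mla) (fun y _ => la0 y) jN).
apply: le_trans (fatou (j x) mD (fun n => measurable_funTS (ma n)) (fun n y _ => a0 n y)) _.
rewrite /glim le_eqVlt; apply/orP; left; apply/eqP; congr limn_einf; apply/funext => n.
by rewrite /gk /jump_carre (ptE (ltW t0)) (jump_intE mA mB AB Gx (ma n) (a0 n)).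
Qed.

Let maj_int x := (\int[lebesgue_measure]_(t in `]0%R, +oo[)
  semigroup_ge0 P X (pt t) (fun y => maj (t, y)) x)%E.

Let Sm_ge0 (z : R * borel E) : (0 <= semigroup_ge0 P X (pt z.1) (fun y => maj (z.1, y)) z.2)%E.
Proof. by apply: semigroup_ge0_ge0 => y; exact: maj_ge0. Qed.

Let mSm : measurable_fun setT (fun z : R * borel E =>
  semigroup_ge0 P X (pt z.1) (fun y => maj (z.1, y)) z.2).
Proof. exact: (measurable_semigroup_ge0_joint hX lcE sE (@measurable_id _ _ setT) mmaj maj_ge0). Qed.

Let mmaj_int : measurable_fun setT maj_int.
Proof. exact: (measurable_integral_fst lebesgue_measure (measurable_itv `]0%R, +oo[) mSm Sm_ge0). Qed.

Let maj_int_ge0 x : (0 <= maj_int x)%E.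
Proof. by apply: integral_ge0 => t _; exact: (Sm_ge0 (t, x)). Qed.

Let square_function_le_maj x : (\int[lebesgue_measure]_(t in `[0%R, +oo[)
  semigroup_ge0 P X t (Gamma_mod j (semigroup P X t f)) x <= maj_int x)%E.
Proof.
(* The majorant is valid for [t > 0]; time 0 gets [+oo], which Lebesgue measure ignores. *)
pose M (t : R) := if t == 0 then +oo%E else semigroup_ge0 P X (pt t) (fun y => maj (t, y)) x.
have p : measurable_fun setT (pair^~ x : R -> _) by exact: pair2_measurable.
have MS : {in `]0%R, +oo[%classic, (fun t => semigroup_ge0 P X (pt t) (fun y => maj (t, y)) x) =1 M}.
  by move=> t; rewrite inE /= in_itv/= andbT => t0; rewrite /M gt_eqF.
apply: (@le_trans _ _ (\int[lebesgue_measure]_(t in `[0%R, +oo[) M t)%E).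
  apply: nonneg_integral_mono => t /=; first by move=> _; apply: semigroup_ge0_ge0 => y; exact: Gamma_mod_ge0.
  rewrite in_itv/= andbT => t0; rewrite /M; case: ifPn => [_|tn0]; first exact: leey.
  rewrite (ptE t0); apply: semigroup_ge0_mono => y; first exact: Gamma_mod_ge0.
  by apply: Gamma_mod_le; rewrite lt_neqAle eq_sym tn0.
rewrite -integral_itv_obnd_cbnd; last first.
  apply: (eq_measurable_fun _ MS); apply: measurable_funTS.
  exact: (measurableT_comp mSm p).
by rewrite le_eqVlt; apply/orP; left; apply/eqP/eq_integral => t tD; exact/esym/MS.
Qed.

Let K := r `^ r * fine (\int[m]_x (`|f x| `^ (2 * r))%:E).

(** Tonelli and symmetry move [P_t] from the majorant to [h]. There [Bad] is null at each time,
    leaving [glim], the increasing limit of [ginf N], and [ginf N] is at most the carré du champ of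
    [P_t (fn N)], so Fatou carries over the estimate for [fn N]. *)
Let maj_int_dual (g h : borel E -> R) : bint m g -> bint m h ->
  (forall x, 0 <= g x) -> (forall x, 0 <= h x) ->
  (forall x c, 0 <= c -> r * h x * c <= c `^ r + (r - 1) * g x `^ r) ->
  (r%:E * \int[m]_x ((h x)%:E * maj_int x) <= (K + (r - 1) * \int[m]_x (g x `^ r))%:E)%E.
Proof.
move=> bg bh g0 h0 young.
have mray : measurable (`]0%R, +oo[%classic : set (measurableTypeR R)) by exact: measurable_itv.
have mh : measurable_fun setT (EFin \o h) by apply/measurable_EFinP; exact: bh.1.1.
have eh0 x : (0 <= (EFin \o h) x)%E by rewrite lee_fin.
pose pk t x := (Pt (pt t) h x)%:E.
have pk0 t x : (0 <= pk t x)%E by rewrite lee_fin; exact: (mo_ge0 (ms_op mP (pt_ge0 t)) bh.1 h0).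
have pair1 (t : R) : measurable_fun setT (pair t : borel E -> _) by exact: pair1_measurable.
have mpk t : measurable_fun setT (pk t).
  by apply/measurable_EFinP; have [] := ms_bmeas mP (pt_ge0 t) bh.1.
have mpkj : measurable_fun setT (fun z : R * borel E => pk z.1 z.2).
  by apply/measurable_EFinP; exact: (mu_joint bh.1).
have unpair (k : R * borel E -> \bar R) : (fun z : R * borel E => k (z.1, z.2)) = k.
  by apply/funext => -[].
have E1 : (\int[m]_x ((h x)%:E * maj_int x) =
    \int[lebesgue_measure]_(t in `]0%R, +oo[) \int[m]_x (pk t x * glim (t, x)))%E.
  have mF : measurable_fun setT (fun z : R * borel E =>
      (h z.2)%:E * semigroup_ge0 P X (pt z.1) (fun y => maj (z.1, y)) z.2)%E.
    by apply: emeasurable_funM => //; exact: (measurableT_comp mh measurable_snd).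
  have F0 (z : R * borel E) :
      (0 <= (h z.2)%:E * semigroup_ge0 P X (pt z.1) (fun y => maj (z.1, y)) z.2)%E.
    by rewrite mule_ge0// lee_fin.
  transitivity (\int[m]_x \int[lebesgue_measure]_(t in `]0%R, +oo[)
      ((h x)%:E * semigroup_ge0 P X (pt t) (fun y => maj (t, y)) x))%E.
    apply: eq_integral => x _.
    have p : measurable_fun setT (pair^~ x : R -> _) by exact: pair2_measurable.
    rewrite (ge0_integralZl_EFin _ mray)//; first by move=> t _; exact: (Sm_ge0 (t, x)).
    by apply: measurable_funTS; exact: (measurableT_comp mSm p).
  rewrite -(tonelli_setT_l lebesgue_measure sm mray mF F0).
  apply: eq_integral => t _.
  have mm : measurable_fun setT (fun y => maj (t, y)) by exact: (measurableT_comp mmaj (pair1 t)).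
  have := sym (pt_ge0 t) mh mm eh0 (fun y => maj_ge0 (t, y)).
  move=> /= ->.
  transitivity (\int[m]_x (pk t x * maj (t, x)))%E.
    by apply: eq_integral => x _; rewrite /pk (semigroup_ge0_EFin hX x (pt_ge0 t) bh.1).
  apply: (ge0_integral_null_set (mpair t mBad) (Bad_null t)) => [|x|x|x /= nB].
  - exact: emeasurable_funM.
  - by rewrite mule_ge0.
  - by rewrite mule_ge0.
  - by rewrite /maj memNset.
pose F N (t : R) : \bar R := (r%:E * \int[m]_x (pk t x * ginf N (t, x)))%E.
have mFj N : measurable_fun setT (fun z : R * borel E => pk z.1 z.2 * ginf N (z.1, z.2))%E.
  by apply: emeasurable_funM => //; rewrite (unpair (ginf N)).
have mF N : measurable_fun setT (F N).
  apply: measurable_funeM.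
  apply: (measurable_integral_snd sm (f := fun z => (pk z.1 z.2 * ginf N (z.1, z.2))%E)) => // z.
  by rewrite mule_ge0.
have F0 N t : (0 <= F N t)%E.
  rewrite mule_ge0 ?lee_fin ?(ltW r0)//; apply: integral_ge0 => x _; by rewrite mule_ge0.
rewrite E1 -(ge0_integralZl_EFin _ mray) ?(ltW r0)//; last 2 first.
- by move=> t _; apply: integral_ge0 => x _; rewrite mule_ge0.
- apply: measurable_funTS.
  apply: (measurable_integral_snd sm (f := fun z => (pk z.1 z.2 * glim (z.1, z.2))%E)) => [|z].
    by apply: emeasurable_funM => //; rewrite (unpair glim).
  by rewrite mule_ge0.
apply: (@fatou_le _ (measurableTypeR R) R lebesgue_measure _ F) => // [n|t _|n].
- exact: (measurable_funTS (mF n)).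
- apply: cvgeZl => //.
  apply: monotone_cvg_integral => // [n|n x _|x _ a b ab|x _].
  + by apply: emeasurable_funM => //; exact: (measurableT_comp (mginf n) (pair1 t)).
  + by rewrite mule_ge0.
  + by rewrite lee_wpmul2l//; exact: nondecreasing_einfs.
  + by apply: cvgeZl => //; exact: ginf_cvg.
- apply: (@le_trans _ _ (r `^ r * \int[m]_x (fn n x ^+ 2) `^ r + (r - 1) * \int[m]_x (g x `^ r))%:E).
    apply: le_trans (pair_integral_ray_le (fn_bint n) bg bh g0 h0 young).
    apply: nonneg_integral_mono => t _ //.
    rewrite lee_wpmul2l ?lee_fin ?(ltW r0)//.
    apply: nonneg_integral_mono => x _; first by rewrite mule_ge0.
    by rewrite lee_wpmul2l//; exact: ginf_le.
  by rewrite lee_fin lerD2r ler_wpM2l ?powR_ge0.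
Qed.

Lemma square_function_powR_le :
  (\int[m]_x ((\int[lebesgue_measure]_(t in `[0%R, +oo[)
     semigroup_ge0 P X t (Gamma_mod j (semigroup P X t f)) x) `^ r) <= K%:E)%E.
Proof.
apply: le_trans (powR_integral_le_dual sm r1 mmaj_int maj_int_ge0 maj_int_dual).
apply: nonneg_integral_mono => x _; first exact: poweR_ge0.
have I0 : (0 <= \int[lebesgue_measure]_(t in `[0%R, +oo[)
    semigroup_ge0 P X t (Gamma_mod j (semigroup P X t f)) x)%E.
  by apply: integral_ge0 => t _; apply: semigroup_ge0_ge0 => y; exact: Gamma_mod_ge0.
apply: gt0_ler_poweR; [exact: (ltW r0)|by rewrite in_itv/= leey andbT|by rewrite in_itv/= leey andbT|].
exact: square_function_le_maj.
Qed.

End approximation.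
End square_function.

Theorem proposition4p10 (R : realType) (p : R) (hp : 2 <= p) :
  exists2 C : R, 0 < C &
  forall (E : pmetricType R) (m : {measure set (borel E) -> \bar R})
    (D : set (borel E -> R)) (Q : (borel E -> R) -> (borel E -> R) -> R)
    (J : {measure set (borel E * borel E) -> \bar R})
    (j : R.-ker borel E ~> borel E)
    (d : measure_display) (Omega : measurableType d)
    (P : R.-pker borel E^Delta ~> Omega) (X : R -> Omega -> borel E^Delta),
  locally_compact [set: E] -> separable E -> radon m -> full_support m ->
  dirichlet_form m D Q -> regular_form m D Q ->
  jumping_measure J -> jump_kernel m J j -> pure_jump m D Q J ->
  hunt_process P X -> process_symmetric P X m -> associated P X m D Q ->
  conservative P X m ->
  forall f : borel E -> R, f \in Lfun m p%:E ->
  ('N[m]_p%:E[square_function P X j f] <= C%:E * 'N[m]_p%:E[EFin \o f])%E.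
Proof.
pose r := p / 2.
have r1 : 1 <= r by rewrite ler_pdivlMr// mul1r.
have r0 : 0 < r by rewrite (lt_le_trans _ r1).
have pE : 2 * r = p by rewrite mulrC divfK.
have p0 : 0 < p by rewrite (lt_le_trans _ hp).
(* The square function is [F^(1/2)] and [2r = p], so [r^r] bounds the ratio of [p]-th powers of the
   norms; its [p]-th root is the square root of [p / 2]. *)
exists ((r `^ r) `^ p^-1); first by rewrite !powR_gt0.
move=> E m D Q J j d Omega P X lcE sE rm _ dQ rQ jJ kJ pJ hX sym ass cons f fLp.
have [c [rho bb]] := ball_basis_exists lcE sE.
have [A [B [HA HB AB]]] := off_diag_rectangles bb.
have mA n : measurable (A n) by have [] := HA n.
have mB n : measurable (B n) by have [] := HB n.
have Jfin n : (J (A n `*` B n) < +oo)%E.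
  apply: jJ.1.1; first exact: measurableX.
    by apply: compact_setX; [have [] := HA n|have [] := HB n].
  by rewrite AB => z ABz; exists n.
have mf : measurable_fun setT f by move: fLp; rewrite inE => /andP[/[!inE]].
have fp : (\int[m]_x (`|f x| `^ (2 * r))%:E < +oo)%E.
  have /integrableP[_] := Lfun_integrable (le_trans (ler1n _ 2) hp) fLp.
  rewrite pE; congr (_ < _)%E; apply: eq_integral => x _.
  by rewrite gee0_abs// lee_fin powR_ge0.
have [S [mS Sle Sx]] := sigma_finite_exhaustion (radon_sigma_finite lcE sE rm).
have H := square_function_powR_le lcE sE rm dQ rQ jJ kJ pJ hX sym ass cons mA mB AB Jfin r1
  mf fp mS Sle Sx.
have L0 : (0 <= \int[m]_x (`|f x| `^ (2 * r))%:E)%E.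
  by apply: integral_ge0 => x _; rewrite lee_fin powR_ge0.
rewrite unlock /Lnorm.
rewrite (_ : \int[m]_x `|square_function P X j f x| `^ p =
  \int[m]_x (\int[lebesgue_measure]_(t in `[0%R, +oo[)
     semigroup_ge0 P X t (Gamma_mod j (semigroup P X t f)) x) `^ r)%E; last first.
  apply: eq_integral => x _; rewrite gee0_abs ?poweR_ge0// -poweRrM.
  by congr (_ `^ _)%E; rewrite mulrC.
rewrite (_ : \int[m]_x `|(EFin \o f) x| `^ p = \int[m]_x (`|f x| `^ (2 * r))%:E)%E; last first.
  by apply: eq_integral => x _; rewrite pE.
rewrite -poweR_EFin -poweRM ?lee_fin ?powR_ge0//.
have I0 : (0 <= \int[m]_x (\int[lebesgue_measure]_(t in `[0%R, +oo[)
     semigroup_ge0 P X t (Gamma_mod j (semigroup P X t f)) x) `^ r)%E.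
  by apply: integral_ge0 => x _; exact: poweR_ge0.
apply: gt0_ler_poweR.
- by rewrite invr_ge0 ltW.
- by rewrite in_itv/= leey andbT.
- by rewrite in_itv/= leey andbT mule_ge0// lee_fin powR_ge0.
by apply: le_trans H _; rewrite EFinM fineK// ge0_fin_numE.
Qed.
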